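(* For any chamber $C_\omega$ in $\mathring{\Delta}_{n,2}$ such that $\dim C_\omega\le n-2$ there exists a Losev-Manin space $\overline{L}_{0,n,k}$ such that there exists a birational morphism $\overline{L}_{0,n,k}\to F_\omega$.
   Context: Hassett spaces: weight data (genus $0$) is a vector $\mathcal{A}=(a_1,\ldots,a_n)\in\mathbb{Q}^n$ with $0<a_i\le 1$ and $a_1+\cdots+a_n>2$. An $\mathcal{A}$-stable genus $0$ curve is a connected nodal curve $C$ of arithmetic genus $0$ with marked points $s_1,\ldots,s_n$ in its smooth locus such that $K_C+\sum a_is_i$ is ample and $\sum_{i\in I}a_i\le 1$ whenever the points $s_i$, $i\in I$, coincide. $\overline{\mathcal{M}}_{0,\mathcal{A}}$ is the moduli space of such curves. For $2\le k\le n-2$ the Losev-Manin space $\overline{L}_{0,n,k}$ (genus $0$ stable curves with $k$ white and $n-k$ black points, white points being distinct from each other and from black ones, while black points may coincide) equals $\overline{\mathcal{M}}_{0,\mathcal{A}}$ for $\mathcal{A}=(1,\ldots,1,a_{k+1},\ldots,a_n)$ with $k$ ones, $0<a_i<1$ and $\sum_{i=k+1}^na_i\le 1$; this does not depend on the choice of such $a_i$. Grassmannian side: $G_{n,2}$ is the Grassmannian of $2$-dimensional subspaces of $\mathbb{C}^n$ with Plücker coordinates $P^I$, $I\subset\{1,\ldots,n\}$, $|I|=2$, and the canonical actions of $(\mathbb{C}^* )^n$ and of the compact torus $T^n$. The moment map is $\mu(L)=\frac{1}{\sum_I|P^I(L)|^2}\sum_I|P^I(L)|^2\Lambda_I$,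 where $\Lambda_I\in\mathbb{Z}^n$ is the indicator vector of $I$; its image is the hypersimplex $\Delta_{n,2}=\{x\in[0,1]^n : \sum x_i=2\}$, with relative interior $\mathring{\Delta}_{n,2}$. It induces $\hat\mu:G_{n,2}/T^n\to\Delta_{n,2}$. For a set $\sigma$ of two-element subsets of $\{1,\ldots,n\}$, the stratum is $W_\sigma=\{L : P^I(L)\ne 0\iff I\in\sigma\}$; when it is non-empty, $P_\sigma=\mathrm{conv}(\Lambda_I, I\in\sigma)$ is an admissible polytope, $\mu(W_\sigma)=\mathring{P}_\sigma$ (relative interior), and $F_\sigma=W_\sigma/(\mathbb{C}^* )^n$. For a set $\omega$ of such $\sigma$, the chamber $C_\omega$ is $C_\omega=\bigcap_{\sigma\in\omega}\mathring{P}_\sigma$, required to be non-empty and such that $C_\omega\cap\mathring{P}_\sigma=\emptyset$ for $\sigma\notin\omega$. The space of parameters is $F_\omega=\bigcup_{\sigma\in\omega}F_\sigma$, homeomorphic to $\hat\mu^{-1}(x)$ for every $x\in C_\omega$; as a variety it is the categorical quotient of $\bigcup_{\sigma\in\omega}W_\sigma$ by $(\mathbb{C}^* )^n$, identified with the GIT quotient of $(\mathbb{C}P^1)^n$ by the diagonal action of $PGL_2(\mathbb{C})$ with fractional linearisation in $C_\omega$. *)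

(* Defs.v *)
(* The complex numbers are R[i] for R : realType. *)
From HB Require Import structures.
From mathcomp Require Import all_boot all_order all_algebra.
From mathcomp Require Import all_classical all_reals all_analysis.
From mathcomp Require Import complex.

Set Implicit Arguments.
Unset Strict Implicit.
Unset Printing Implicit Defensive.

Import Order.TTheory GRing.Theory Num.Theory numFieldNormedType.Exports.

Local Open Scope ring_scope.
Local Open Scope classical_set_scope.

(** * Complex varieties as spaces with functions *)

(* Varieties are handled classically, through their closed points: a set with
   its Zariski-open sets and, for each of them, its regular functions.
   [regular U h] is meant for open [U]; the values of [h] off [U] are junk. *)
Record space (C : Type) := Space {
  point :> Type;
  zopen : set point -> Prop;
  regular : set point -> (point -> C) -> Prop }.

Section Morphisms.
Variable C : Type.

Definition morphism_on (X Y : space C) (U : set X) (V : set Y) (f : X -> Y) :=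
  [/\ forall x, U x -> V (f x),
      forall W, zopen W -> W `<=` V -> zopen (U `&` f @^-1` W) &
      forall W h, zopen W -> W `<=` V -> regular W h ->
        regular (U `&` f @^-1` W) (h \o f)].

Definition morphism (X Y : space C) (f : X -> Y) := morphism_on setT setT f.

Definition zdense (X : space C) (U : set X) :=
  forall W, zopen W -> W !=set0 -> W `&` U !=set0.

Definition birational_morphism (X Y : space C) (f : X -> Y) :=
  morphism f /\
  exists (U : set X) (V : set Y) (g : Y -> X),
    [/\ zopen U /\ zdense U, zopen V /\ zdense V,
        morphism_on U V f, morphism_on V U g &
        (forall x, U x -> g (f x) = x) /\ (forall y, V y -> f (g y) = y)].

(* The quotient by an equivalence relation: the points are the classes, and
   open sets and regular functions are those which pull back to such. It is the
   categorical quotient in the category of spaces with functions. *)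
Definition quot_class (X : Type) (E : X -> X -> Prop) :=
  {K : set X | exists x, K = [set y | E x y]}.

Definition to_class (X : Type) (E : X -> X -> Prop) (x : X) : quot_class E :=
  exist _ [set y | E x y] (ex_intro _ x erefl).

Definition quotient (X : space C) (E : X -> X -> Prop) : space C :=
  {| point := quot_class E;
     zopen := fun W => zopen (@to_class X E @^-1` W);
     regular := fun W h =>
       regular (@to_class X E @^-1` W) (h \o @to_class X E) |}.

End Morphisms.

(* The coarsest structure of space with functions on [T] in which every domain
   [dom s] is open and every [val s] is regular on [dom s]: the open sets are
   the unions of non-vanishing loci of polynomials in the [val s], the regular
   functions are locally quotients of such polynomials. *)
Section Generated.
Variables (C : fieldType) (T S : Type) (dom : S -> set T) (val : S -> T -> C).

Inductive gexpr :=
  | GConst of C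
  | GGen of S
  | GAdd of gexpr & gexpr
  | GMul of gexpr & gexpr.

Fixpoint gdefined (e : gexpr) (t : T) : Prop :=
  match e with
  | GConst _ => True
  | GGen s => dom s t
  | GAdd e1 e2 | GMul e1 e2 => gdefined e1 t /\ gdefined e2 t
  end.

Fixpoint geval (e : gexpr) (t : T) : C :=
  match e with
  | GConst c => c
  | GGen s => val s t
  | GAdd e1 e2 => geval e1 t + geval e2 t
  | GMul e1 e2 => geval e1 t * geval e2 t
  end.

Definition gbasic (e : gexpr) : set T :=
  [set t | gdefined e t /\ geval e t != 0].

Definition generated_space : space C :=
  {| point := T;
     zopen := fun U => forall t, U t -> exists2 e, gbasic e t & gbasic e `<=` U;
     regular := fun U h => forall t, U t -> exists p q,
       [/\ gdefined p t, gbasic q t &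
           forall u, U u -> gdefined p u -> gbasic q u ->
             h u = geval p u / geval q u] |}.

End Generated.

(** * Hassett and Losev-Manin spaces in genus 0 *)

Section Hassett.
Variables (C : fieldType) (n : nat).

(* Points of P^1 are given by homogeneous coordinates, non-zero row vectors;
   two of them are the same point iff their bracket vanishes. *)
Definition bracket (u v : 'rV[C]_2) : C :=
  u 0 0 * v 0 1 - u 0 1 * v 0 0.

(* A connected nodal curve of arithmetic genus 0 is a tree of projective lines:
   [adj] is the dual graph, [node v w] the point of the component [v] which is
   glued to a point of the adjacent component [w], and [mark i] is the i-th
   marked point, on the component [comp i]. Values of [node] at non-adjacent
   pairs are junk. *)
Record marked_curve := MarkedCurve {
  ncomp : nat;
  adj : 'I_ncomp -> 'I_ncomp -> bool;
  node : 'I_ncomp -> 'I_ncomp -> 'rV[C]_2;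
  comp : 'I_n -> 'I_ncomp;
  mark : 'I_n -> 'rV[C]_2 }.

Definition nnodes (X : marked_curve) : nat :=
  #|[set e : 'I_(ncomp X) * 'I_(ncomp X) | adj e.1 e.2]|./2.

(* As the components are rational, the arithmetic genus is the first Betti
   number nnodes - ncomp + 1 of the connected dual graph. *)
Definition genus0_curve (X : marked_curve) : Prop :=
  [/\ symmetric (@adj X) /\ irreflexive (@adj X),
      forall v w, connect (@adj X) v w,
      (nnodes X).+1 = ncomp X,
      (forall v w : 'I_(ncomp X), adj v w -> node v w != 0) /\
      (forall v w w' : 'I_(ncomp X), adj v w -> adj v w' -> w != w' ->
         bracket (node v w) (node v w') != 0) &
      (forall i, mark X i != 0) /\
      (forall i w, adj (comp X i) w ->
         bracket (mark X i) (node (comp X i) w) != 0)].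

Definition coincide (X : marked_curve) (i j : 'I_n) : bool :=
  (comp X i == comp X j) && (bracket (mark X i) (mark X j) == 0).

Definition weight_data (A : 'I_n -> rat) : Prop :=
  (forall i, 0 < A i <= 1) /\ 2 < \sum_i A i.

(* Degree of K_X + sum_i a_i s_i on the component v. *)
Definition log_degree (A : 'I_n -> rat) (X : marked_curve) (v : 'I_(ncomp X))
    : rat :=
  - 2 + #|[set w | adj v w]|%:R + \sum_(i | comp X i == v) A i.

(* A Q-divisor class on a curve is ample iff it has positive degree on every
   irreducible component. *)
Definition stable_curve (A : 'I_n -> rat) (X : marked_curve) : Prop :=
  [/\ genus0_curve X,
      forall v, 0 < log_degree A (X := X) v &
      forall I : {set 'I_n}, {in I &, forall i j, coincide X i j} ->
        \sum_(i in I) A i <= 1].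

Definition curve_iso (X Y : marked_curve) : Prop :=
  exists (f : 'I_(ncomp X) -> 'I_(ncomp Y)) (g : 'I_(ncomp X) -> 'M[C]_2),
    [/\ bijective f, forall v, g v \in unitmx,
        forall v w, adj (f v) (f w) = adj v w,
        forall v w, adj v w ->
          bracket (node v w *m g v) (node (f v) (f w)) = 0 &
        forall i, comp Y i = f (comp X i) /\
          bracket (mark X i *m g (comp X i)) (mark Y i) = 0].

(* The image of the i-th marked point under the contraction of the curve to its
   component v: if that point is not on v, it is the node of v leading to it. *)
Definition contraction (X : marked_curve) (v : 'I_(ncomp X)) (i : 'I_n)
    : 'rV[C]_2 :=
  if comp X i == v then mark X i else
  if [pick w | adj v w &&
       connect [rel x y | [&& adj x y, x != v & y != v]] w (comp X i)]
  is Some w then node v w else 0.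

Definition separates (X : marked_curve) (v : 'I_(ncomp X)) (i j : 'I_n) : bool :=
  bracket (contraction v i) (contraction v j) != 0.

(* If the marked points a, b, c are pairwise distinct, there is exactly one
   component on which their contractions are pairwise distinct. *)
Definition median (X : marked_curve) (a b c : 'I_n) : option 'I_(ncomp X) :=
  [pick v | [&& separates v a b, separates v b c & separates v a c]].

(* [cross_ratio (a, b, c, i)] is the coordinate of the i-th marked point,
   contracted to the median component of a, b, c, for which these three points
   are 0, 1, oo. It is finite on [cross_ratio_dom (a, b, c, i)]. In other words
   it is the forgetful map to M_{0,(1,1,1,e)} = P^1, defined where the points
   a, b, c are pairwise distinct. *)
Definition cross_ratio_dom (s : 'I_n * 'I_n * 'I_n * 'I_n) (X : marked_curve)
    : Prop :=
  let: (a, b, c, i) := s in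
  if median X a b c is Some v then separates v i c else False.

Definition cross_ratio (s : 'I_n * 'I_n * 'I_n * 'I_n) (X : marked_curve) : C :=
  let: (a, b, c, i) := s in
  if median X a b c is Some v then
    let z := contraction v in
    (bracket (z i) (z a) * bracket (z b) (z c)) /
    (bracket (z i) (z c) * bracket (z b) (z a))
  else 0.

(* The moduli space of A-stable genus 0 curves: its points are the isomorphism
   classes, its algebraic structure is the coarsest one for which all forgetful
   maps to P^1 are morphisms on (open) domains of definition. *)
Definition hassett_space (A : 'I_n -> rat) : space C :=
  @quotient C
    (generated_space
       (fun s (X : {X : marked_curve | stable_curve A X}) =>
          cross_ratio_dom s (sval X))
       (fun s X => cross_ratio s (sval X)))
    (fun X Y => curve_iso (sval X) (sval Y)).

(* The Losev-Manin space L_{0,n,k}, 2 <= k <= n - 2, is [hassett_space A] for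
   any such A; the points k, ..., n - 1 are the black ones. *)
Definition losev_manin_weights (k : nat) (A : 'I_n -> rat) : Prop :=
  [/\ weight_data A,
      forall i : 'I_n, (i < k)%N -> A i = 1,
      forall i : 'I_n, (k <= i)%N -> 0 < A i < 1 &
      \sum_(i < n | (k <= i)%N) A i <= 1].

End Hassett.

(** * The Grassmannian G_{n,2}, its strata and their torus quotients *)

Section Grassmannian.
Variables (C : fieldType) (n : nat).

Definition grassmannian := {L : {vspace 'rV[C]_n} | \dim L = 2%N}.

(* Plücker coordinate for the index set {i, j} with i < j, computed in the basis
   [vbasis]; another basis multiplies all of them by a common scalar. *)
Definition plucker (L : grassmannian) (i j : 'I_n) : C :=
  let e := vbasis (sval L) in
  e`_0 0 i * e`_1 0 j - e`_0 0 j * e`_1 0 i.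

(* Index sets I with |I| <> 2 are not allowed in sigma. *)
Definition stratum (sigma : {set {set 'I_n}}) : set grassmannian :=
  [set L | (forall I, I \in sigma -> #|I| = 2%N) /\
           (forall i j : 'I_n, (i < j)%N ->
              (plucker L i j != 0) = ([set i; j]%SET \in sigma))].

Definition admissible (sigma : {set {set 'I_n}}) : Prop :=
  stratum sigma !=set0.

Definition torus_orbit (L L' : grassmannian) : Prop :=
  exists2 t : 'rV[C]_n, (forall i, t 0 i != 0) &
    sval L' = (linfun (mulmxr (diag_mx t)) @: sval L)%VS.

Definition strata_union (omega : {set {set {set 'I_n}}}) :=
  {L : grassmannian | exists2 sigma, sigma \in omega & stratum sigma L}.

(* F_omega as categorical quotient of the union of the W_sigma by the algebraic
   torus. The union carries the structure induced by the Plücker embedding of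
   the Grassmannian, i.e. generated by the quotients of Plücker coordinates. *)
Definition parameter_space (omega : {set {set {set 'I_n}}}) : space C :=
  @quotient C
    (generated_space
       (fun (s : ('I_n * 'I_n) * ('I_n * 'I_n)) (L : strata_union omega) =>
          plucker (sval L) s.2.1 s.2.2 != 0)
       (fun s L =>
          plucker (sval L) s.1.1 s.1.2 / plucker (sval L) s.2.1 s.2.2))
    (fun L L' => torus_orbit (sval L) (sval L')).

End Grassmannian.

(** * The chamber decomposition of the hypersimplex *)

Section Chambers.
Variables (R : realType) (n : nat).

Definition affine_hull (P : set 'rV[R]_n) : set 'rV[R]_n :=
  [set x | exists (m : nat) (p : 'I_m -> 'rV[R]_n) (c : 'I_m -> R),
    [/\ forall i, P (p i), \sum_i c i = 1 & x = \sum_i c i *: p i]].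

Definition relative_interior (P : set 'rV[R]_n) : set 'rV[R]_n :=
  [set x | P x /\ \forall y \near x, affine_hull P y -> P y].

(* Dimension of the affine hull: the largest number of linearly independent
   differences of points of P. *)
Definition affine_dim (P : set 'rV[R]_n) : nat :=
  \max_(d < n.+1 | `[< exists2 D : 'M[R]_(d, n), row_free D &
     forall i, exists x y, [/\ P x, P y & row i D = x - y] >]) d.

Definition hypersimplex : set 'rV[R]_n :=
  [set x | (forall i, 0 <= x 0 i <= 1) /\ \sum_i x 0 i = 2].

Definition indicator_vector (I : {set 'I_n}) : 'rV[R]_n :=
  \row_i (i \in I)%:R.

Definition matroid_polytope (sigma : {set {set 'I_n}}) : set 'rV[R]_n :=
  [set x | exists c : {set 'I_n} -> R,
    [/\ forall I, 0 <= c I, \sum_(I in sigma) c I = 1 &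
        x = \sum_(I in sigma) c I *: indicator_vector I]].

Definition chamber (omega : {set {set {set 'I_n}}}) : set 'rV[R]_n :=
  [set x | forall sigma, sigma \in omega ->
    relative_interior (matroid_polytope sigma) x].

Definition is_chamber (omega : {set {set {set 'I_n}}}) : Prop :=
  [/\ forall sigma, sigma \in omega -> admissible R[i] sigma,
      chamber omega !=set0 &
      forall sigma, admissible R[i] sigma -> sigma \notin omega ->
        chamber omega `&` relative_interior (matroid_polytope sigma) = set0].

End Chambers.

Arguments hypersimplex R n : clear implicits.
Arguments chamber R {n} omega.

(* Main.v *)
(** The walls of the chamber decomposition are the hyperplanes x(S) = 1, so a
    chamber of dimension at most n - 2 lies on one of them, and S serves as the
    set of black points of a Losev-Manin space. Its weights dominate a point x
    of the chamber: contracting a stable curve to a suitable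
    component gives a configuration of n points of P^1 which is semistable for
    x, and its closed orbit is a point of F_omega. Several components may
    qualify, but only if a node splits x into 1 + 1, and then they give the same
    closed orbit.

    Locally the configuration is given by cross-ratios. At a strictly semistable
    point only the weight zero part, for the one-parameter group contracting
    the configuration to its closed orbit, of an expression in the Plücker
    coordinates descends, and this suffices for the map to be a morphism.
    On configurations of distinct points it is inverse to the map sending a
    generic plane to the smooth curve marked by its columns. Density of these
    loci is proved by smoothing the nodes and perturbing the points. *)
Require Import Defs.
From mathcomp Require Import all_boot all_order all_algebra.
From mathcomp Require Import all_classical all_reals all_analysis.
From mathcomp Require Import complex.
From mathcomp Require Import zify ring lra.

Import Defs Order.TTheory GRing.Theory Num.Theory numFieldNormedType.Exports.
Local Open Scope ring_scope.
Local Open Scope classical_set_scope.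

Set Implicit Arguments.
Unset Strict Implicit.
Unset Printing Implicit Defensive.

(** * Local lifts and morphisms between quotients *)

(** The points of [F_omega] are the torus orbits whose moment polytope has x in its relative
    interior. If the columns of a plane are read as points of the line, these are the stable
    configurations, where coincident points weigh less than 1, and the configurations at two points
    of weight 1 each. A semistable configuration with a class of weight 1 and at least three
    distinct points has x on the boundary of its polytope, so it is missing from [F_omega] and a
    two-point one stands in for it. The representative plane then jumps under small deformations of
    the curve. This is the obstacle to a direct proof that the map is a morphism, and the reason for
    [local_lift], which compares representatives with whole families of translates.

    Domination of x by the weights is meant set by set: a set of marked points of A-weight at most 1
    has x-weight at most 1. It fails coordinatewise, since the black weights may add up to less than
    1 while x has sum exactly 1 on the wall set.

    The bound on the dimension is used by contraposition: off all walls, every matroid polytope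
    through x spans the hyperplane of coordinate sum 2, which makes the chamber open in it. *)

Lemma poly_nonroot (C : numFieldType) (P : {poly C}) :
  P != 0 -> exists2 l, l != 0 & P.[l] != 0.
Proof.
move=> P0.
pose rs := [seq k%:R : C | k <- iota 1 (size P)].
have us : uniq rs.
  rewrite map_inj_uniq ?iota_uniq // => x y /eqP.
  by rewrite eqr_nat => /eqP.
have [/(max_poly_roots P0)/(_ us)|] := boolP (all (root P) rs).
  by rewrite size_map size_iota ltnn.
case/allPn => l /mapP[k]; rewrite mem_iota => /andP[k0 _] -> rl.
by exists k%:R => //; rewrite pnatr_eq0 -lt0n.
Qed.

Lemma poly_eq_cofinite (C : numFieldType) (P Q D : {poly C}) : D != 0 ->
  (forall l, l != 0 -> D.[l] != 0 -> P.[l] = Q.[l]) -> P = Q.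
Proof.
move=> D0 PQ; apply/eqP; rewrite -subr_eq0; apply/negPn/negP => PQ0.
have [l l0] : exists2 l, l != 0 & ((P - Q) * D).[l] != 0.
  by apply: poly_nonroot; rewrite mulf_neq0.
by rewrite !hornerE mulf_eq0 negb_or => /andP[+ Dl]; rewrite subr_eq0 PQ ?eqxx.
Qed.

Section Gexpr.
Variables (C : fieldType) (S : Type).
Local Notation expr := (gexpr C S).

Definition gprod (I : Type) (r : seq I) (F : I -> expr) : expr :=
  foldr (fun i e => GMul (F i) e) (GConst S 1) r.
Definition gsum (I : Type) (r : seq I) (F : I -> expr) : expr :=
  foldr (fun i e => GAdd (F i) e) (GConst S 0) r.
Definition gsub (e1 e2 : expr) := GAdd e1 (GMul (GConst S (-1)) e2).

Variables (T : Type) (dom : S -> set T) (val : S -> T -> C).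

Lemma gprod_defined (I : eqType) (r : seq I) F t :
  gdefined dom (gprod r F) t <-> {in r, forall i, gdefined dom (F i) t}.
Proof.
elim: r => [|i r IH] /=; first by split.
split=> [[Fi /IH Fr] j|Fr].
  by rewrite inE => /predU1P[->//|/Fr].
split; first by apply: Fr; rewrite mem_head.
by apply/IH => j jr; apply: Fr; rewrite inE jr orbT.
Qed.

Lemma gsum_defined (I : eqType) (r : seq I) F t :
  {in r, forall i, gdefined dom (F i) t} -> gdefined dom (gsum r F) t.
Proof.
elim: r => [|i r IH] //= Fr; split; first by apply: Fr; rewrite mem_head.
by apply/IH => j jr; apply: Fr; rewrite inE jr orbT.
Qed.

Lemma geval_gprod (I : Type) (r : seq I) F t :
  geval val (gprod r F) t = \prod_(i <- r) geval val (F i) t.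
Proof. by elim: r => [|i r IH] /=; rewrite ?big_nil ?big_cons ?IH. Qed.

Lemma geval_gsum (I : Type) (r : seq I) F t :
  geval val (gsum r F) t = \sum_(i <- r) geval val (F i) t.
Proof. by elim: r => [|i r IH] /=; rewrite ?big_nil ?big_cons ?IH. Qed.

Lemma geval_gsub e1 e2 t :
  geval val (gsub e1 e2) t = geval val e1 t - geval val e2 t.
Proof. by rewrite /= mulN1r. Qed.

Lemma gbasic_mul e1 e2 t : gbasic dom val (GMul e1 e2) t <->
  gbasic dom val e1 t /\ gbasic dom val e2 t.
Proof.
rewrite /gbasic /= mulf_eq0 negb_or; split.
  by case=> [] [? ?] /andP[].
by case=> [] [? ->] [? ->].
Qed.

Lemma gbasic_prod (I : eqType) (r : seq I) F t :
  gbasic dom val (gprod r F) t <->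
  {in r, forall i, gbasic dom val (F i) t}.
Proof.
split=> [[/gprod_defined d +] i ir|d].
  rewrite geval_gprod prodf_seq_neq0 => /allP/(_ i ir) /= Fi0.
  by split; first exact: d.
split; first by apply/gprod_defined => i /d [].
by rewrite geval_gprod prodf_seq_neq0; apply/allP => i /d [] ? /= ->.
Qed.

End Gexpr.

(** * Local lifts along one-parameter groups *)

Section LocalLift.
Variables (C : numFieldType) (T S T' S' : Type).
Variables (dom : S -> set T) (val : S -> T -> C).
Variables (dom' : S' -> set T') (val' : S' -> T' -> C).
Variable E' : T' -> T' -> Prop.

Definition gratio (r : gexpr C S * gexpr C S) t :=
  geval val r.1 t / geval val r.2 t.

(** For l going to infinity, [l ^ (k s - 1)] times the fraction at t tends to [val' s t0']: exponent
    -1 dies, exponent 0 stays, and a positive exponent requires a vanishing numerator. *)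
Definition lift_limit (t0' : T') (k : S' -> nat)
    (rho : S' -> gexpr C S * gexpr C S) t :=
  forall s, dom' s t0' ->
    val' s t0' = (if k s == 1 then gratio (rho s) t else 0) /\
    ((1 < k s)%N -> geval val (rho s).1 t = 0).

Definition lift_scaled (t0' : T') (k : S' -> nat)
    (rho : S' -> gexpr C S * gexpr C S) t l t' :=
  forall s, dom' s t0' -> dom' s t' /\
    l * val' s t' = l ^+ k s * gratio (rho s) t.

Definition lift_defined (eN : gexpr C S) (t0' : T')
    (rho : S' -> gexpr C S * gexpr C S) :=
  forall s t, dom' s t0' -> gbasic dom val eN t ->
    gdefined dom (rho s).1 t /\ gbasic dom val (rho s).2 t.

(* Up to [E'], [F t] is either the limit point [t0'], or a point whose translate
   [t'] by the parameter [l] of a one-parameter group has generators equal to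
   [l ^ (k s - 1)] times fractions [rho s] at [t], of which only those with
   [k s = 1] survive in the limit. The shift by one avoids negative exponents. *)
Definition local_lift (F : T -> T') (t0 : T) :=
  exists (eN : gexpr C S) (t0' : T') (k : S' -> nat)
         (rho : S' -> gexpr C S * gexpr C S),
  [/\ gbasic dom val eN t0, E' (F t0) t0', lift_defined eN t0' rho,
      lift_limit t0' k rho t0 &
      forall t, gbasic dom val eN t ->
        (E' (F t) t0' /\ lift_limit t0' k rho t) \/
        (forall l, l != 0 -> exists2 t', E' (F t) t' &
           lift_scaled t0' k rho t l t')].

(** Along the translates an expression is a Laurent polynomial in l over the common denominator [d];
    the factor [l ^ m] turns it into the polynomial [P], whose coefficients are again expressions on
    the source. Degree m is the weight zero part. Under [lift_limit] no higher degree survives, so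
    the limit at infinity identifies that part with the value at [t0']. *)
Lemma laurent_coefficients (eN : gexpr C S) (t0' : T') (k : S' -> nat)
    (rho : S' -> gexpr C S * gexpr C S) :
  lift_defined eN t0' rho ->
  forall e, gdefined dom' e t0' ->
  exists (m : nat) (c : nat -> gexpr C S) (d : gexpr C S),
  (forall i t, gbasic dom val eN t ->
     gdefined dom (c i) t /\ gbasic dom val d t) /\
  (forall t, gbasic dom val eN t -> exists P : {poly C},
     [/\ forall i, P`_i = geval val (c i) t,
         lift_limit t0' k rho t ->
           (forall i, (m < i)%N -> P`_i = 0) /\
           P`_m = geval val d t * geval val' e t0' &
         forall l t', lift_scaled t0' k rho t l t' ->
           gdefined dom' e t' /\
           l ^+ m * (geval val d t * geval val' e t') = P.[l]]).
Proof.
move=> rhoN; elim=> [a|s|e1 IH1 e2 IH2|e1 IH1 e2 IH2] /=.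
- move=> _.
  exists 0, (fun i => GConst S (if i == 0 then a else 0)), (GConst S 1).
  split=> [i t _|t _]; first by split=> //; split; rewrite //= oner_eq0.
  exists a%:P; rewrite mul1r; split=> [i|_|l t' _]; first by rewrite coefC.
    by split=> [i i0|]; rewrite coefC // eqn0Ngt i0.
  by rewrite hornerC mul1r.
- move=> s0.
  exists 1, (fun i => if i == k s then (rho s).1 else GConst S 0), (rho s).2.
  split=> [i t Nt|t Nt]; have [d1 d2] := rhoN s t s0 Nt.
    by split=> //; case: ifP.
  have den0 : geval val (rho s).2 t != 0 by case: d2.
  exists ((geval val (rho s).1 t)%:P * 'X^(k s)); split=> [i|lim|l t' sc].
  + by rewrite coefCM coefXn; case: eqP => _ /=; rewrite ?mulr1 ?mulr0.
  + have [v0 z] := lim _ s0; split=> [i i1|].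
      rewrite coefCM coefXn; case: eqP => [ik|_]; last by rewrite mulr0.
      by rewrite z ?mul0r // -ik.
    rewrite v0 coefCM coefXn eq_sym /gratio.
    case: eqP => _ /=; rewrite ?mulr1 ?mulr0 //.
    by rewrite mulrCA divff ?mulr1.
  + have [d e] := sc _ s0; split=> //.
    rewrite expr1 mulrCA e hornerM hornerC hornerXn /gratio.
    by move: (l ^+ k s) => a; field.
- case=> /IH1[m1 [c1 [d1 [D1 P1]]]] /IH2[m2 [c2 [d2 [D2 P2]]]].
  exists (m1 + m2)%N, (fun i => GAdd
    (if (i < m2)%N then GConst S 0 else GMul (c1 (i - m2)%N) d2)
    (if (i < m1)%N then GConst S 0 else GMul (c2 (i - m1)%N) d1)), (GMul d1 d2).
  split=> [i t Nt /=|t Nt].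
    split; last first.
      by apply/gbasic_mul; split; [case: (D1 i t Nt)|case: (D2 i t Nt)].
    split; case: ifP => // _ /=.
      by have [? _] := D1 (i - m2)%N t Nt; have [_ []] := D2 i t Nt.
    by have [? _] := D2 (i - m1)%N t Nt; have [_ []] := D1 i t Nt.
  have [p1 [q1 l1 s1]] := P1 t Nt; have [p2 [q2 l2 s2]] := P2 t Nt.
  pose f1 := geval val d1 t; pose f2 := geval val d2 t.
  exists (p1 * 'X^m2 * f2%:P + p2 * 'X^m1 * f1%:P); split=> [i|lim|l t' sc].
  + rewrite coefD !coefMC !coefMXn /=; congr (_ + _); case: ifP => // _.
      by rewrite mul0r.
    by rewrite ?q1.
      by rewrite mul0r.
    by rewrite ?q2.
  + have [z1 e1'] := l1 lim; have [z2 e2'] := l2 lim.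
    split=> [i im|]; rewrite coefD !coefMC !coefMXn.
      by rewrite !ifF ?z1 ?z2 ?mul0r ?addr0 //; lia.
    rewrite !ifF; try lia.
    by rewrite addnK addKn e1' e2' /f1 /f2 /=; ring.
  + have [d1' e1'] := s1 _ _ sc; have [d2' e2'] := s2 _ _ sc; split=> //.
    rewrite hornerD !hornerM !hornerXn !hornerC -e1' -e2' exprD /f1 /f2 /=.
    by move: (l ^+ m1) (l ^+ m2) => a b; ring.
- case=> /IH1[m1 [c1 [d1 [D1 P1]]]] /IH2[m2 [c2 [d2 [D2 P2]]]].
  exists (m1 + m2)%N, (fun i => gsum (enum 'I_i.+1)
    (fun j : 'I_i.+1 => GMul (c1 j) (c2 (i - j)%N))), (GMul d1 d2).
  split=> [i t Nt|t Nt].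
    split; last first.
      by apply/gbasic_mul; split; [case: (D1 i t Nt)|case: (D2 i t Nt)].
    apply/gsum_defined => j _ /=.
    by split; [case: (D1 j t Nt)|case: (D2 (i - j)%N t Nt)].
  have [p1 [q1 l1 s1]] := P1 t Nt; have [p2 [q2 l2 s2]] := P2 t Nt.
  exists (p1 * p2); split=> [i|lim|l t' sc].
  + rewrite coefM geval_gsum big_enum /=.
    by apply: eq_bigr => j _; rewrite /= q1 q2.
  + have [z1 e1'] := l1 lim; have [z2 e2'] := l2 lim.
    split=> [i im|]; rewrite coefM.
      rewrite big1 // => j _; have [jm|jm] := ltnP m1 j.
        by rewrite z1 ?mul0r.
      by rewrite z2 ?mulr0 //; have := ltn_ord j; lia.
    (* As the coefficients above [m1] and [m2] vanish, only the product of these two degrees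
       contributes. *)
    have m1lt : (m1 < (m1 + m2).+1)%N by lia.
    rewrite (bigD1 (Ordinal m1lt)) //= addKn e1' e2' big1 ?addr0 => [|j jm].
      by rewrite mulrACA.
    have [jm'|jm'] := ltnP m1 j; first by rewrite z1 ?mul0r.
    rewrite z2 ?mulr0 //; have := ltn_ord j.
    have : (j : nat) != m1 by [].
    by lia.
  + have [d1' e1'] := s1 _ _ sc; have [d2' e2'] := s2 _ _ sc; split=> //.
    rewrite hornerM -e1' -e2' exprD /=.
    by rewrite [RHS]mulrACA [X in _ = _ * X]mulrACA.
Qed.

Definition saturated (O : set T') := forall x y, E' x y -> O x -> O y.

(** Take an expression cutting out a neighbourhood of [t0'] in [O]. Its weight zero coefficient
    [c m] is nonzero at [t0]; wherever it stays nonzero, the polynomial in l is nonzero, so some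
    translate lies in the neighbourhood, and saturation carries [F t] into [O]. *)
Lemma local_lift_open F t0 O : local_lift F t0 ->
  (forall x y, E' x y -> E' y x) -> saturated O -> O (F t0) ->
  (forall x, O x -> exists2 e, gbasic dom' val' e x & gbasic dom' val' e `<=` O) ->
  exists2 e, gbasic dom val e t0 & forall t, gbasic dom val e t -> O (F t).
Proof.
move=> [eN [t0' [k [rho [N0 E0 rhoN lim0 H]]]]] sym sat Ot0 Oopen.
have O0 : O t0' by exact: sat E0 Ot0.
have [e [d0 e0] eO] := Oopen _ O0.
have [m [c [d [dc Pt]]]] := laurent_coefficients k rhoN d0.
exists (GMul eN (c m)).
  apply/gbasic_mul; split=> //; have [? [_ dt0]] := dc m t0 N0; split=> //.
  have [P [<- /(_ lim0)[_ ->] _]] := Pt t0 N0.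
  by rewrite mulf_neq0.
move=> t /gbasic_mul[Nt [_ ct]]; case: (H t Nt) => [[E1 _]|sc].
  exact: sat (sym _ _ E1) O0.
have [P [Pc _ Ps]] := Pt t Nt.
have P0 : P != 0.
  by apply: contra_neq ct => P0; rewrite -Pc P0 coef0.
have [l l0 Pl] := poly_nonroot P0.
have [t' Et' /Ps[dt' et']] := sc _ l0.
apply: (sat _ _ (sym _ _ Et')).
apply: eO; split=> //; apply: contra_neq Pl => et0.
by rewrite -et' et0 !mulr0.
Qed.

(** Since [h] is constant on translates, the fraction p/q representing it yields a polynomial
    identity in l with the constant factor [h (F t)]. Comparing weight zero parts writes [h (F t)]
    as a fraction on the source. *)
Lemma local_lift_regular F t0 O (h : T' -> C) : local_lift F t0 ->
  (forall x y, E' x y -> E' y x) -> saturated O -> O (F t0) ->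
  (forall x y, E' x y -> h x = h y) ->
  (forall x, O x -> exists p q, [/\ gdefined dom' p x, gbasic dom' val' q x &
     forall u, O u -> gdefined dom' p u -> gbasic dom' val' q u ->
       h u = geval val' p u / geval val' q u]) ->
  exists p q, [/\ gdefined dom p t0, gbasic dom val q t0 &
     forall t, O (F t) -> gdefined dom p t -> gbasic dom val q t ->
       h (F t) = geval val p t / geval val q t].
Proof.
move=> [eN [t0' [k [rho [N0 E0 rhoN lim0 H]]]]] sym sat Ot0 hE Oreg.
have O0 : O t0' by exact: sat E0 Ot0.
have [p [q [dp [dq q0] hpq]]] := Oreg _ O0.
have [m [c [d [dc Pt]]]] := laurent_coefficients k rhoN dp.
have [m' [c' [d' [dc' Pt']]]] := laurent_coefficients k rhoN dq.
(* The common factor [eN] cancels; it restricts the fraction to the neighbourhood where the lift is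
   valid. *)
exists (GMul eN (GMul (c m) d')), (GMul eN (GMul (c' m') d)).
have [dcm dd] := dc m t0 N0; have [dcm' dd'] := dc' m' t0 N0.
split.
- by split; [case: N0|split=> //; case: dd'].
- do 2![apply/gbasic_mul; split=> //]; split=> //.
  have [P [<- /(_ lim0)[_ ->] _]] := Pt' t0 N0.
  by rewrite mulf_neq0 //; case: dd'.
move=> t Ot _ /gbasic_mul[Nt /gbasic_mul[[_ ct] _]] /=.
have eN0 : geval val eN t != 0 by case: Nt.
have [_ [_ dt0]] := dc m t Nt; have [_ [_ dt0']] := dc' m' t Nt.
rewrite -mulf_div divff // mul1r.
have [P [Pc Pl Ps]] := Pt t Nt; have [P' [Pc' Pl' Ps']] := Pt' t Nt.
case: (H t Nt) => [[E1 lim]|sc].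
  have [_ Pe] := Pl lim; have [_ Pe'] := Pl' lim.
  rewrite -Pc -Pc' Pe Pe' (hE _ _ E1) hpq //.
  by field; rewrite q0 dt0 dt0'.
have P0 : P' != 0.
  by apply: contra_neq ct => P0; rewrite -Pc' P0 coef0.
pose f := geval val d t; pose f' := geval val d' t.
have PP : (P * 'X^m') * f'%:P = h (F t) *: ((P' * 'X^m) * f%:P).
  apply: (poly_eq_cofinite P0) => l l0 P'l.
  have [t' Et' sl] := sc _ l0.
  have [dt et] := Ps _ _ sl; have [dt' et'] := Ps' _ _ sl.
  have qt' : geval val' q t' != 0.
    by apply: contra_neq P'l => q0'; rewrite -et' q0' !mulr0.
  rewrite (hE _ _ Et') hpq //; last exact: sat Et' Ot.
  rewrite hornerZ !hornerM !hornerXn !hornerC -et -et' /f /f'.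
  by move: (l ^+ m) (l ^+ m') => a b; field.
(* The shifts by [m'] and [m] bring both weight zero parts to this degree. *)
have /(congr1 (fun p : {poly C} => p`_(m + m'))) := PP.
rewrite coefZ !coefMC !coefMXn !ifF; try lia.
rewrite addnK addKn Pc Pc' /f /f' => ->.
by rewrite mulfK // mulf_neq0.
Qed.

End LocalLift.

Definition equivalence_prop (T : Type) (E : T -> T -> Prop) :=
  [/\ forall x, E x x, forall x y, E x y -> E y x &
      forall x y z, E x y -> E y z -> E x z].

Lemma to_class_eq (T : Type) (E : T -> T -> Prop) : equivalence_prop E ->
  forall x y, to_class E x = to_class E y <-> E x y.
Proof.
move=> [r s t] x y; split=> [/(congr1 sval)/= Exy|Exy].
  by have : [set z | E y z] y by []; rewrite -Exy.
apply: eq_exist; apply/seteqP; split=> z /= Ez; last exact: t Ez.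
exact: t (s _ _ Exy) Ez.
Qed.

Lemma to_class_surj (T : Type) (E : T -> T -> Prop) (K : quot_class E) :
  exists x, K = to_class E x.
Proof. by case: K => K [x Kx]; exists x; apply: eq_exist. Qed.

Section QuotientMorphism.
Variables (C : numFieldType) (T S T' S' : Type).
Variables (dom : S -> set T) (val : S -> T -> C).
Variables (dom' : S' -> set T') (val' : S' -> T' -> C).
Variables (E : T -> T -> Prop) (E' : T' -> T' -> Prop).
Hypotheses (equivE' : equivalence_prop E').
Let X := quotient (X := generated_space dom val) E.
Let Y := quotient (X := generated_space dom' val') E'.

(** [F] itself may be discontinuous: on the quotient only saturated open sets and invariant
    functions count, and these are what a local lift controls. *)
Lemma quotient_morphism_on (U : set X) (V : set Y) (F : T -> T') (f : X -> Y) :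
  zopen U ->
  (forall t, U (to_class E t) -> f (to_class E t) = to_class E' (F t)) ->
  (forall t, U (to_class E t) -> V (to_class E' (F t))) ->
  (forall t, U (to_class E t) -> local_lift dom val dom' val' E' F t) ->
  morphism_on U V f.
Proof.
move=> Uo fF FV FL; have [_ sym _] := equivE'.
split.
- by move=> K; have [t ->] := to_class_surj K => Ut; rewrite fF //; apply: FV.
- move=> W Wo WV t /= [Ut]; rewrite /preimage /= fF // => Wt.
  have [e1 e1t e1U] := Uo t Ut.
  have sat : saturated E' [set t' | W (to_class E' t')].
    by move=> x y /(to_class_eq equivE') /= ->.
  have [e2 e2t e2W] := local_lift_open (FL t Ut) sym sat Wt Wo.
  exists (GMul e1 e2); first exact/gbasic_mul.
  move=> u /gbasic_mul[/e1U Uu /e2W /= Wu]; split=> //=.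
  by rewrite fF.
- move=> W h Wo WV hreg t /= [Ut]; rewrite /preimage /= fF // => Wt.
  have sat : saturated E' [set t' | W (to_class E' t')].
    by move=> x y /(to_class_eq equivE') /= ->.
  have hE x y : E' x y -> (h \o to_class E') x = (h \o to_class E') y.
    by move=> /(to_class_eq equivE') /= ->.
  have [p [q [dp dq pq]]] :=
    local_lift_regular (FL t Ut) sym sat Wt hE hreg.
  exists p, q; split=> // u /= [Uu]; rewrite /preimage /= fF // => Wu du qu.
  exact: pq.
Qed.

End QuotientMorphism.

Lemma zopen_setT_quotient (C : fieldType) (T S : Type) dom val E :
  zopen (s := quotient (X := @generated_space C T S dom val) E) setT.
Proof. by move=> t _; exists (GConst S 1) => //; split; rewrite //= oner_eq0. Qed.

(** The tool for density. If the generators along the family are rational in l and specialize at 0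
    to their values at [x0], so does every expression, and a nonzero value at [x0] excludes only
    finitely many l. The family need not pass through [x0] at l = 0: [x0] may be a singular curve
    and all [x l] smooth. *)
Lemma gbasic_specialization (C : numFieldType) (T S : Type)
    (dom : S -> set T) (val : S -> T -> C) (x0 : T) (x : C -> T)
    (D : {poly C}) : D != 0 ->
  (forall s, dom s x0 -> exists p q : {poly C},
     [/\ q.[0] != 0, val s x0 = p.[0] / q.[0] &
         forall l, l != 0 -> D.[l] != 0 -> q.[l] != 0 ->
           dom s (x l) /\ val s (x l) = p.[l] / q.[l]]) ->
  forall e, gbasic dom val e x0 ->
  exists l, [/\ l != 0, D.[l] != 0 & gbasic dom val e (x l)].
Proof.
move=> D0 Hs e [d0 e0].
suff [p [q [q0 epq H]]] : exists p q : {poly C},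
    [/\ q.[0] != 0, geval val e x0 = p.[0] / q.[0] &
        forall l, l != 0 -> D.[l] != 0 -> q.[l] != 0 ->
          gdefined dom e (x l) /\ geval val e (x l) = p.[l] / q.[l]].
  have p0 : p.[0] != 0.
    by apply: contra_neq e0 => p0; rewrite epq p0 mul0r.
  have nz (r : {poly C}) : r.[0] != 0 -> r != 0.
    by apply: contra_neq => ->; rewrite horner0.
  have [l l0] : exists2 l, l != 0 & (D * (p * q)).[l] != 0.
    by apply: poly_nonroot; rewrite !mulf_eq0 !negb_or D0 !nz.
  rewrite !hornerM !mulf_eq0 !negb_or => /and3P[Dl pl ql].
  have [dl el] := H l l0 Dl ql.
  by exists l; split=> //; split=> //; rewrite el mulf_neq0 ?invr_eq0.
elim: e d0 {e0} => [a|s|e1 IH1 e2 IH2|e1 IH1 e2 IH2] /=.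
- move=> _; exists a%:P, 1; rewrite !hornerE oner_eq0 divr1; split=> // l.
  by rewrite !hornerE divr1.
- exact: Hs.
- case=> /IH1[p1 [q1 [z1 v1 H1]]] /IH2[p2 [q2 [z2 v2 H2]]].
  exists (p1 * q2 + p2 * q1), (q1 * q2); rewrite !hornerE mulf_neq0 //.
  split=> //; first by rewrite v1 v2 addf_div.
  move=> l l0 Dl; rewrite !hornerE mulf_eq0 negb_or => /andP[ql1 ql2].
  have [? ->] := H1 _ l0 Dl ql1; have [? ->] := H2 _ l0 Dl ql2.
  by rewrite addf_div.
- case=> /IH1[p1 [q1 [z1 v1 H1]]] /IH2[p2 [q2 [z2 v2 H2]]].
  exists (p1 * p2), (q1 * q2); rewrite !hornerE mulf_neq0 //.
  split=> //; first by rewrite v1 v2 mulf_div.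
  move=> l l0 Dl; rewrite !hornerE mulf_eq0 negb_or => /andP[ql1 ql2].
  have [? ->] := H1 _ l0 Dl ql1; have [? ->] := H2 _ l0 Dl ql2.
  by rewrite mulf_div.
Qed.

(** * Trees *)

Section Trees.
Variable V : finType.
Implicit Types (e : rel V) (u v w : V).

(** Each vertex other than [r] has an edge to a parent nearer to [r], and the two orientations of
    these edges are all distinct. *)
Lemma connected_card e r : symmetric e -> (forall v, connect e r v) ->
  (#|V|.-1 * 2 <= #|[pred p : V * V | e p.1 p.2]|)%N.
Proof.
move=> se ce.
have exP v : exists n, [exists p : n.-tuple V, path e r p && (last r p == v)].
  have /connectP[p ep ->] := ce v; exists (size p).
  by apply/existsP; exists (in_tuple p); rewrite ep eqxx.
pose dist v := ex_minn (exP v).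
have dist_le v p : path e r p -> last r p = v -> (dist v <= size p)%N.
  move=> ep lp; rewrite /dist; case: ex_minnP => m _; apply.
  by apply/existsP; exists (in_tuple p); rewrite ep lp eqxx.
(* The parent is the last vertex but one on a shortest path from [r]. *)
have /choice[par parP] v : exists u,
    v != r -> e u v /\ (dist u < dist v)%N.
  have [->|vr] := eqVneq v r; first by exists r.
  rewrite {2}/dist; case: ex_minnP => m /existsP[p /andP[ep /eqP lp]] _.
  case/lastP: (tval p) (size_tuple p) ep lp => [|q x] sp ep lp.
    by rewrite -lp eqxx in vr.
  move: ep lp; rewrite rcons_path last_rcons => /andP[eq elq] xv.
  exists (last r q) => _; rewrite -xv; split=> //.
  by rewrite -sp size_rcons ltnS; apply: dist_le.
pose f (x : V * bool) := if x.2 then (par x.1, x.1) else (x.1, par x.1).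
pose D := finset.setX [set~ r]%SET [set: bool]%SET.
have -> : (#|V|.-1 * 2)%N = #|f @: D|.
  rewrite card_in_imset ?cardsX ?cardsT ?card_bool ?cardsC1 //.
  move=> [v b] [v' b']; rewrite !inE /= !andbT => vr v'r.
  have [_ dv] := parP v vr; have [_ dv'] := parP v' v'r.
  rewrite /f; case: b b' => [] [] /= [].
  - by move=> _ ->.
  - by move=> pv vp; move: dv dv'; rewrite pv -vp; lia.
  - by move=> vp pv; move: dv dv'; rewrite pv -vp; lia.
  - by move=> -> _.
apply/subset_leq_card/fintype.subsetP => _ /imsetP[[v b] + ->].
rewrite !inE /f /= andbT => vr; have [pv _] := parP v vr.
by case: b => /=; rewrite // se.
Qed.

Variable adj : rel V.

Definition off v : rel V := [rel x y | [&& adj x y, x != v & y != v]].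

(** In a tree, the neighbour through which the path from [v] to [u] leaves; the default [v] is the
    value at u = v. *)
Definition dir v u : V := odflt v [pick w | adj v w && connect (off v) w u].

Definition branch v w u := (u != v) && (dir v u == w).

Definition tree := [/\ symmetric adj, irreflexive adj,
  forall v w, connect adj v w &
  (#|[pred p : V * V | adj p.1 p.2]|./2.+1 = #|V|)%N].

Hypothesis tadj : tree.

Let sadj : symmetric adj. Proof. by case: tadj. Qed.
Let iadj : irreflexive adj. Proof. by case: tadj. Qed.
Let cadj v w : connect adj v w. Proof. by case: tadj. Qed.
Let ncard : (#|[pred p : V * V | adj p.1 p.2]|./2.+1 = #|V|)%N.
Proof. by case: tadj. Qed.

Lemma off_sym v : connect_sym (off v).
Proof.
apply: sym_connect_sym => x y; rewrite /off /=.
by rewrite sadj [(x != v) && _]andbC.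
Qed.

(** Otherwise the graph stays connected, by way of [w'], when the edge from [v] to [w] is deleted,
    and it then has two ordered pairs fewer than [connected_card] demands. *)
Lemma off_inj v w w' : adj v w -> adj v w' -> connect (off v) w w' -> w = w'.
Proof.
move=> vw vw' ww'; apply/eqP/negPn/negP => nww'.
pose e' := [rel x y | adj x y && ((x, y) \notin [:: (v, w); (w, v)])].
have vw0 : v != w by apply: contraTneq vw => ->; rewrite iadj.
have se' : symmetric e'.
  move=> x y; rewrite /= sadj !inE !xpair_eqE !negb_or.
  by rewrite [(y == w) && _]andbC [(y == v) && _]andbC [X in _ && X]andbC.
have sub x y : connect (off v) x y -> connect e' x y.
  apply: connect_sub => a b /= /and3P[ab av bv]; apply: connect1.
  by rewrite /= ab !inE !xpair_eqE (negPf av) (negPf bv) andbF.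
have cvw : connect e' v w.
  apply: (@connect_trans _ _ w'); last by rewrite off_sym in ww'; exact: sub.
  apply: connect1; rewrite /= vw' !inE !xpair_eqE eq_sym (negPf nww') andbF.
  by rewrite (negPf vw0).
have ce' x : connect e' v x.
  apply: connect_sub (cadj v x) => a b ab.
  have [|nab] := boolP ((a, b) \in [:: (v, w); (w, v)]).
    rewrite !inE => /orP[] /eqP[-> ->] //.
    by rewrite sym_connect_sym.
  by apply: connect1; rewrite /= ab nab.
have := connected_card se' ce'.
move: ncard; have : (0 < #|V|)%N by apply/card_gt0P; exists v.
suff -> : #|[pred p : V * V | adj p.1 p.2]| = #|[pred p : V * V | e' p.1 p.2]|.+2.
  move: #|V| #|[pred p | _]| => N M N0 /= H1 H2.
  by have := odd_double_half M; lia.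
have wv_vw : ((w, v) == (v, w)) = false.
  by rewrite xpair_eqE [w == v]eq_sym (negPf vw0).
rewrite (cardD1 (v, w) [pred p | adj p.1 p.2]) (cardD1 (w, v)).
rewrite !inE /= [adj w v]sadj vw wv_vw /= !add1n; congr _.+2.
apply: eq_card => -[x y]; rewrite !inE /= negb_or.
by rewrite andbA andbC [((x, y) != (w, v)) && _]andbC.
Qed.

Lemma dirP v u : u != v -> adj v (dir v u) /\ connect (off v) (dir v u) u.
Proof.
move=> uv; rewrite /dir; case: pickP => [w /andP[]|] //= H.
have /connectP[p0 ep0 up0] := cadj v u.
move: up0; case: (shortenP ep0) => -[|w q] /= ep up _ up0.
  by rewrite up0 eqxx in uv.
case/andP: ep => vw ep; case/andP: up; rewrite inE negb_or => /andP[vw0 vq] _.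
have := H w; rewrite vw /= => /negP[]; apply/connectP; exists q => //.
have {}up0 := I; elim: q w vw0 vq ep {vw} => [|x q IH] w //= vw0.
rewrite inE negb_or => /andP[vx vq] /andP[wx qx].
apply/andP; split; last exact: IH.
by rewrite /off /= wx !(eq_sym _ v) vw0 vx.
Qed.

Lemma dir_eq v w u : u != v -> adj v w -> connect (off v) w u -> dir v u = w.
Proof.
move=> uv vw wu; have [vd du] := dirP uv; apply: (off_inj vd vw).
by apply: connect_trans du _; rewrite off_sym.
Qed.

Lemma adj_neq v w : adj v w -> v != w.
Proof. by move=> vw; apply: contraTneq vw => ->; rewrite iadj. Qed.

Lemma dir_adj v w : adj v w -> dir v w = w.
Proof. by move=> vw; apply: dir_eq; rewrite ?connect0 // eq_sym adj_neq. Qed.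

Lemma dir_step v u u' : adj u u' -> u != v -> u' != v -> dir v u = dir v u'.
Proof.
move=> uu' uv u'v; have [vd du] := dirP u'v; apply: dir_eq => //.
apply: connect_trans du (connect1 _).
by rewrite /off /= sadj uu' u'v.
Qed.

Lemma adj_ind (P : V -> Prop) v : P v ->
  (forall u u', adj u u' -> P u -> P u') -> forall u, P u.
Proof.
move=> Pv step u; have /connectP[p] := cadj v u.
elim: p v Pv => [|w p IH] v Pv /=; first by move=> _ ->.
by case/andP=> vw; apply: IH; apply: step Pv.
Qed.

(** Lying in at least one of the two branches, and lying in both, are each inherited by neighbours.
    Connectedness gives the first for all vertices, whereas the second would spread to [v], which is
    not in its own branch. *)
Lemma branchC v w u : adj v w -> branch w v u = ~~ branch v w u.
Proof.
move=> vw; have wv : adj w v by rewrite sadj.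
have nvw := adj_neq vw.
have bw : branch v w w by rewrite /branch eq_sym nvw dir_adj /=.
have bv : branch w v v by rewrite /branch nvw dir_adj /=.
have stepA a b x x' : adj a b -> adj x x' -> branch a b x -> x' != a ->
    branch a b x'.
  move=> ab xx' /andP[xa /eqP d] x'a.
  by rewrite /branch x'a -(dir_step xx') // d /=.
have A : branch v w u || branch w v u.
  move: u; apply: (adj_ind (v := v)); first by rewrite bv orbT.
  move=> x x' xx' /orP[] b.
    by have [->|x'v] := eqVneq x' v; rewrite ?bv ?orbT ?(stepA _ _ _ _ vw xx').
  by have [->|x'w] := eqVneq x' w; rewrite ?bw ?(stepA _ _ _ _ wv xx') ?orbT.
have [b1|/negPf b1] := boolP (branch v w u); last by rewrite b1 in A.
apply/negP => b2.
have stepB x x' : adj x x' -> branch v w x && branch w v x ->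
    branch v w x' && branch w v x'.
  move=> xx' /andP[b3 b4]; have x'x : adj x' x by rewrite sadj.
  have x'v : x' != v.
    apply/eqP => x'v; rewrite x'v in x'x.
    by case/andP: b3 => _; rewrite dir_adj // => /eqP xw; case/andP: b4; rewrite xw eqxx.
  have x'w : x' != w.
    apply/eqP => x'w; rewrite x'w in x'x.
    by case/andP: b4 => _; rewrite dir_adj // => /eqP xw; case/andP: b3; rewrite xw eqxx.
  by rewrite (stepA _ _ _ _ vw xx') ?(stepA _ _ _ _ wv xx').
have /andP[/andP[]] : branch v w v && branch w v v.
  by apply: (adj_ind (P := fun x => _ && _) (v := u) _ stepB); rewrite b1 b2.
by rewrite eqxx.
Qed.

Lemma branch_cover v v' u : v != v' ->
  branch v (dir v v') u || branch v' (dir v' v) u.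
Proof.
move=> vv'; move: u; apply: (adj_ind (v := v)).
  by rewrite /branch vv' !eqxx orbT.
move=> x x' xx' /orP[] /andP[xv /eqP dx].
  have [->|x'v] := eqVneq x' v; first by rewrite /branch vv' !eqxx orbT.
  by rewrite /branch x'v -(dir_step xx' xv x'v) dx eqxx.
have [->|x'v] := eqVneq x' v'; first by rewrite /branch eq_sym vv' eqxx.
by rewrite /branch [_ != v']x'v -(dir_step xx' xv x'v) dx eqxx orbT.
Qed.

Lemma branch_sub v w w' u : adj v w -> adj w w' -> w' != v ->
  branch w w' u -> branch v w u.
Proof.
move=> vw ww' w'v /andP[uw /eqP d]; rewrite -[branch v w u]negbK -branchC //.
by rewrite /branch uw d.
Qed.

Lemma branch_proper v w w' : adj v w -> adj w w' -> w' != v ->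
  (#|[pred u | branch w w' u]| < #|[pred u | branch v w u]|)%N.
Proof.
move=> vw ww' w'v; apply: proper_card; apply/properP; split.
  by apply/fintype.subsetP => u; rewrite !inE; apply: branch_sub.
exists w; rewrite !inE /branch ?eqxx // eq_sym adj_neq // dir_adj //.
by rewrite eqxx.
Qed.

(** Induction from the leaves inwards: the branches beyond [w] are strictly smaller than the branch
    of [v] at [w]. *)
Lemma branch_ind (P : V -> V -> Prop) :
  (forall v w, adj v w ->
     (forall w', adj w w' -> w' != v -> P w w') -> P v w) ->
  forall v w, adj v w -> P v w.
Proof.
move=> IH v w vw; have [n] := ubnP #|[pred u | branch v w u]|.
elim: n v w vw => // n IHn v w vw; rewrite ltnS => le_n.
apply: IH => // w' ww' w'v; apply: IHn => //.
exact: leq_trans (branch_proper vw ww' w'v) le_n.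
Qed.

(** * Induction and recursion along the paths to a fixed vertex *)

Section Towards.
Variable u : V.

Let depth v := if v == u then 0%N else #|[pred x | branch v (dir v u) x]|.

Let depth_dir v : v != u -> (depth (dir v u) < depth v)%N.
Proof.
move=> vu; have uv : u != v by rewrite eq_sym.
have [vw _] := dirP uv.
have bu : branch v (dir v u) u by rewrite /branch uv eqxx.
rewrite /depth (negPf vu); case: eqP => [_|/eqP wu].
  by apply/card_gt0P; exists u; rewrite inE.
have uw : u != dir v u by rewrite eq_sym.
apply: branch_proper => //; first by have [] := dirP uw.
apply: contraTneq bu => d.
by rewrite -branchC // /branch uw d eqxx.
Qed.

Lemma dir_ind (P : V -> Prop) : P u ->
  (forall v, v != u -> P (dir v u) -> P v) -> forall v, P v.
Proof.
move=> Pu step v; have [n] := ubnP (depth v).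
elim: n v => // n IH v; rewrite ltnS => le_n.
have [->//|vu] := eqVneq v u; apply: step => //.
by apply: IH; apply: leq_trans (depth_dir vu) le_n.
Qed.

(** Recursion on fuel, where every fuel bounding [depth] gives the same value. It serves to carry a
    marked point from its own component to all the others. *)
Lemma dir_rec (T : Type) (base : T) (step : V -> T -> T) :
  exists f : V -> T, f u = base /\
    forall v, v != u -> f v = step v (f (dir v u)).
Proof.
pose F := fix F k v := if k is k'.+1 then
  if v == u then base else step v (F k' (dir v u)) else base.
have FE k : forall k' v, (depth v <= k)%N -> (depth v <= k')%N -> F k v = F k' v.
  elim: k => [|k IH] [|k'] v //= dk dk'.
  - by case: eqP => // /eqP /depth_dir; lia.
  - by case: eqP => // /eqP /depth_dir; lia.
  - case: eqP => // /eqP vu; have := depth_dir vu => dv.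
    by congr step; apply: IH; lia.
have le_V v : (depth v <= #|V|)%N.
  by rewrite /depth; case: ifP => // _; exact: max_card.
exists (F #|V|); split=> [|v vu].
  by case: #|V| => //= k; rewrite eqxx.
rewrite (FE _ #|V|.+1 v) ?le_V //=; first by rewrite (negPf vu).
exact: leq_trans (le_V v) _.
Qed.

End Towards.

End Trees.

(** * Configurations of points on the projective line *)

Section Brackets.
Variable C : fieldType.
Implicit Types (u v w : 'rV[C]_2) (g : 'M[C]_2).

Definition row2 (x y : C) : 'rV[C]_2 := \row_j (if j == 0 then x else y).

Lemma row2_0 x y : row2 x y 0 0 = x. Proof. by rewrite mxE. Qed.
Lemma row2_1 x y : row2 x y 0 1 = y. Proof. by rewrite mxE. Qed.
Definition row2E := (row2_0, row2_1).

Lemma row2_eta u : u = row2 (u 0 0) (u 0 1).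
Proof.
apply/rowP => j; rewrite mxE; case: eqP => [->//|/eqP j0].
by congr (u 0 _); apply/val_inj; case: j j0 => -[|[|]].
Qed.

Lemma row2_eq u v : u 0 0 = v 0 0 -> u 0 1 = v 0 1 -> u = v.
Proof. by move=> e0 e1; rewrite (row2_eta u) (row2_eta v) e0 e1. Qed.

Lemma row2_eq0 u : (u == 0) = (u 0 0 == 0) && (u 0 1 == 0).
Proof.
apply/eqP/andP => [->|[/eqP u0 /eqP u1]]; first by rewrite !mxE !eqxx.
by apply: row2_eq; rewrite ?u0 ?u1 mxE.
Qed.

Lemma mul_rV2E u g j : (u *m g) 0 j = u 0 0 * g 0 j + u 0 1 * g 1 j.
Proof.
rewrite mxE !big_ord_recl big_ord0 addr0; congr (_ + u 0 _ * g _ j).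
  exact/val_inj.
exact/val_inj.
Qed.

Lemma bracketE u v : bracket u v = u 0 0 * v 0 1 - u 0 1 * v 0 0.
Proof. by []. Qed.

Lemma bracketC u v : bracket u v = - bracket v u.
Proof. by rewrite /bracket; ring. Qed.

Lemma bracketvv u : bracket u u = 0.
Proof. by rewrite /bracket; ring. Qed.

Lemma bracketC_eq0 u v : (bracket u v == 0) = (bracket v u == 0).
Proof. by rewrite bracketC oppr_eq0. Qed.

Lemma bracketZl c u v : bracket (c *: u) v = c * bracket u v.
Proof. by rewrite /bracket !mxE; ring. Qed.

Lemma bracketZr c u v : bracket u (c *: v) = c * bracket u v.
Proof. by rewrite /bracket !mxE; ring. Qed.

Lemma bracketDl u v w : bracket (u + v) w = bracket u w + bracket v w.
Proof. by rewrite /bracket !mxE; ring. Qed.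

Lemma bracketDr u v w : bracket w (u + v) = bracket w u + bracket w v.
Proof. by rewrite /bracket !mxE; ring. Qed.

Definition det2 g := g 0 0 * g 1 1 - g 0 1 * g 1 0.

Lemma bracketM u v g : bracket (u *m g) (v *m g) = det2 g * bracket u v.
Proof. by rewrite /bracket /det2 !mul_rV2E; ring. Qed.

Lemma det2E g : \det g = det2 g.
Proof.
rewrite (expand_det_row _ 0) !big_ord_recl big_ord0 addr0 /cofactor !det_mx11.
rewrite !mxE /det2 /= expr0 expr1 mul1r mulN1r mulrN.
have e1 : lift ord0 ord0 = 1 :> 'I_2 by exact/val_inj.
have e2 : lift (1 : 'I_2) ord0 = 0 :> 'I_2 by exact/val_inj.
by rewrite !e1 e2.
Qed.

Lemma unitmx2 g : (g \in unitmx) = (det2 g != 0).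
Proof. by rewrite unitmxE det2E unitfE. Qed.

Lemma bracket_eq0 u v : u != 0 -> v != 0 ->
  (bracket u v == 0) <-> exists2 c, c != 0 & v = c *: u.
Proof.
move=> u0 v0; split=> [/eqP uv|[c c0 ->]]; last first.
  by rewrite bracketZr bracketvv mulr0.
have [c vc] : exists c, v = c *: u.
  move: u0; rewrite row2_eq0 negb_and => /orP[] u0.
    exists (v 0 0 / u 0 0); apply: row2_eq; rewrite mxE; first by rewrite mulfVK.
    apply: (mulfI u0); rewrite mulrA [u 0 0 * (_ / _)]mulrC mulfVK //.
    by apply/eqP; rewrite -subr_eq0 [v 0 0 * _]mulrC -bracketE uv.
  exists (v 0 1 / u 0 1); apply: row2_eq; rewrite mxE; last by rewrite mulfVK.
  apply: (mulfI u0); rewrite mulrA [u 0 1 * (_ / _)]mulrC mulfVK //.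
  by apply/esym/eqP; rewrite -subr_eq0 [v 0 1 * _]mulrC -bracketE uv.
exists c => //; apply: contra_neq v0 => c0.
by rewrite vc c0 scale0r.
Qed.

Lemma bracket_trans u v w : u != 0 -> v != 0 -> w != 0 ->
  bracket u v == 0 -> bracket v w == 0 -> bracket u w == 0.
Proof.
move=> u0 v0 w0 /(bracket_eq0 u0 v0)[c c0 ->] /bracket_eq0[||d d0 ->] //.
  by rewrite scaler_eq0 negb_or c0.
by rewrite !bracketZr bracketvv !mulr0.
Qed.

Lemma bracket_congl u v w : u != 0 -> v != 0 -> w != 0 ->
  bracket u v == 0 -> (bracket u w == 0) = (bracket v w == 0).
Proof.
move=> u0 v0 w0 /(bracket_eq0 u0 v0)[c c0 ->].
by rewrite bracketZl mulf_eq0 (negPf c0).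
Qed.

Lemma mul_unitmx2_neq0 u g : g \in unitmx -> u != 0 -> u *m g != 0.
Proof.
by move=> gu; apply: contra_neq => ug0; rewrite -[u](mulmxK gu) ug0 mul0mx.
Qed.

End Brackets.

Section Configurations.
Variables (C : fieldType) (I : Type).
Implicit Types (xi zeta : I -> 'rV[C]_2).

(** Equality of configurations on the line up to projective maps: [g] is the map, and the scalars
    absorb the choice of homogeneous coordinates. *)
Definition ceq xi xi' := exists2 g, g \in unitmx &
  forall i, exists2 c, c != 0 & xi' i = c *: (xi i *m g).

Lemma ceq_refl xi : ceq xi xi.
Proof.
exists 1%:M; first exact: unitmx1.
by move=> i; exists 1; rewrite ?oner_eq0 // scale1r mulmx1.
Qed.

Lemma ceq_sym xi xi' : ceq xi xi' -> ceq xi' xi.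
Proof.
case=> g gu H; exists (invmx g); first by rewrite unitmx_inv.
move=> i; have [c c0 ->] := H i; exists c^-1; first by rewrite invr_eq0.
by rewrite -scalemxAl mulmxK // scalerA mulVf // scale1r.
Qed.

Lemma ceq_trans xi xi' xi'' : ceq xi xi' -> ceq xi' xi'' -> ceq xi xi''.
Proof.
case=> g gu H [g' gu' H']; exists (g *m g'); first by rewrite unitmx_mul gu.
move=> i; have [c c0 e] := H i; have [d d0 ->] := H' i.
by exists (d * c); rewrite ?mulf_neq0 // e -scalemxAl scalerA mulmxA.
Qed.

Lemma ceq_neq0 xi xi' i : ceq xi xi' -> xi i != 0 -> xi' i != 0.
Proof.
case=> g gu H xi0; have [c c0 ->] := H i.
by rewrite scaler_eq0 negb_or c0 mul_unitmx2_neq0.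
Qed.

Lemma ceq_bracket xi xi' i j : ceq xi xi' ->
  (bracket (xi' i) (xi' j) == 0) = (bracket (xi i) (xi j) == 0).
Proof.
case=> g gu H; have [c c0 ->] := H i; have [d d0 ->] := H j.
rewrite bracketZl bracketZr bracketM !mulf_eq0 (negPf c0) (negPf d0).
by move: gu; rewrite unitmx2 => /negPf ->.
Qed.

Definition two_point (p : I -> bool) (i : I) : 'rV[C]_2 :=
  if p i then row2 0 1 else row2 1 0.

Lemma two_point_bracket p i j :
  (bracket (two_point p i) (two_point p j) == 0) = (p i == p j).
Proof.
rewrite /two_point /bracket; case: (p i) (p j) => [] [];
by rewrite !row2E ?(mul0r, mulr0, mul1r, subrr, subr0, sub0r, oppr_eq0, oner_eq0, eqxx).
Qed.

Lemma two_pointN p : ceq (two_point p) (two_point (fun i => ~~ p i)).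
Proof.
exists (\matrix_(i < 2, j < 2) (i != j)%:R).
  rewrite unitmx2 /det2 !mxE /= mulr0 sub0r oppr_eq0 mulr1 oner_eq0 //.
move=> i; exists 1; first by rewrite oner_eq0.
rewrite scale1r /two_point; case: (p i); apply: row2_eq;
by rewrite mul_rV2E !mxE /= ?(mul0r, mulr0, mul1r, addr0, add0r).
Qed.

Lemma two_point_ext p q : p =1 q -> two_point p = two_point q.
Proof. by move=> pq; apply/funext => i; rewrite /two_point pq. Qed.

End Configurations.

(** * Semistability of configurations for a weight vector *)

Section Weights.
Variables (C : fieldType) (R : realFieldType) (I : finType) (y : I -> R).
Implicit Types (xi zeta : I -> 'rV[C]_2) (D : pred I).
Hypotheses (y_gt0 : forall i, 0 < y i) (y_sum : \sum_i y i = 2).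

(** Two sets of weight at most 1 that cover a total of 2 leave no room for an overlap, all weights
    being positive. *)
Lemma cover_weight D D' : \sum_(i | D i) y i <= 1 -> \sum_(i | D' i) y i <= 1 ->
  (forall i, D i || D' i) ->
  [/\ \sum_(i | D i) y i = 1, \sum_(i | D' i) y i = 1 & D' =1 predC D].
Proof.
move=> w w' cov.
have e : \sum_(i | ~~ D i) y i = 2 - \sum_(i | D i) y i.
  by have := y_sum; rewrite (bigID D) /=; lra.
have e' : \sum_(i | D' i) y i =
    \sum_(i | D' i && D i) y i + \sum_(i | ~~ D i) y i.
  rewrite (bigID D) /=; congr (_ + _); apply: eq_bigl => i.
  by have := cov i; case: (D i) (D' i) => [] [].
have pos : 0 <= \sum_(i | D' i && D i) y i by apply: sumr_ge0 => i _; exact: ltW.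
have w1 : \sum_(i | D i) y i = 1 by lra.
have w1' : \sum_(i | D' i) y i = 1 by lra.
split=> // i; have /eqP : \sum_(i | D' i && D i) y i = 0 by lra.
rewrite psumr_eq0 => [/allP/(_ i)|j _]; last exact: ltW.
rewrite mem_index_enum (gt_eqF (y_gt0 i)) implybF /= => /(_ isT).
by have := cov i; case: (D i) (D' i) => [] [].
Qed.

Lemma disjoint_weight D D' : \sum_(i | D i) y i = 1 ->
  \sum_(i | D' i) y i = 1 -> (forall i, ~~ (D i && D' i)) -> D' =1 predC D.
Proof.
move=> w w' dis.
have : \sum_(i | ~~ D i) y i = 1.
  by move: y_sum; rewrite (bigID D) /= w; lra.
rewrite (bigID D') /=.
have -> : \sum_(i | ~~ D i && D' i) y i = 1.
  rewrite -[RHS]w'; apply: eq_bigl => i.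
  by have := dis i; case: (D i) (D' i) => [] [].
move=> e i; have /eqP : \sum_(i | ~~ D i && ~~ D' i) y i = 0 by lra.
rewrite psumr_eq0 => [/allP/(_ i)|j _]; last exact: ltW.
rewrite mem_index_enum (gt_eqF (y_gt0 i)) implybF /= => /(_ isT).
by have := dis i; case: (D i) (D' i) => [] [].
Qed.

Definition cwt xi i := \sum_(j | bracket (xi i) (xi j) == 0) y j.

(** Mumford's criterion for weighted points on the line: coincident points carry at most half of the
    total weight 2, and strictly less in [stable]. *)
Definition semistable xi := (forall i, xi i != 0) /\ (forall i, cwt xi i <= 1).

Definition stable xi := (forall i, xi i != 0) /\ (forall i, cwt xi i < 1).

(* [xi] represents the closed orbit in the closure of the orbit of the
   semistable configuration [zeta]. *)
Definition polystable_limit zeta xi := semistable zeta /\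
  ((stable zeta /\ xi = zeta) \/
   exists2 c, cwt zeta c = 1 &
     xi = two_point C (fun i => bracket (zeta c) (zeta i) != 0)).

Lemma cwt_ceq xi xi' i : ceq xi xi' -> cwt xi' i = cwt xi i.
Proof. by move=> e; apply: eq_bigl => j; rewrite (ceq_bracket _ _ e). Qed.

Lemma semistable_ceq xi xi' : ceq xi xi' -> semistable xi -> semistable xi'.
Proof.
move=> e [n w]; split=> i; last by rewrite (cwt_ceq _ e).
exact: ceq_neq0 e (n i).
Qed.

Lemma stable_ceq xi xi' : ceq xi xi' -> stable xi -> stable xi'.
Proof.
move=> e [n w]; split=> i; last by rewrite (cwt_ceq _ e).
exact: ceq_neq0 e (n i).
Qed.

Lemma polystable_limit_ceq zeta zeta' xi : ceq zeta zeta' ->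
  polystable_limit zeta xi -> exists2 xi', polystable_limit zeta' xi' & ceq xi xi'.
Proof.
move=> e [ss [[st ->]|[c cw ->]]].
  exists zeta' => //; split; first exact: semistable_ceq ss.
  by left; split=> //; exact: stable_ceq st.
exists (two_point C (fun i => bracket (zeta' c) (zeta' i) != 0)).
  split; first exact: semistable_ceq ss.
  by right; exists c => //; rewrite (cwt_ceq _ e).
rewrite -(@two_point_ext C I (fun i => bracket (zeta c) (zeta i) != 0)).
  exact: ceq_refl.
by move=> i; rewrite (ceq_bracket _ _ e).
Qed.

Lemma polystable_limit_exists zeta : semistable zeta ->
  exists xi, polystable_limit zeta xi.
Proof.
move=> ss; have [n w] := ss.
have [/existsP[c /eqP cw]|/existsPn H] := boolP [exists c, cwt zeta c == 1].
  by exists (two_point C (fun i => bracket (zeta c) (zeta i) != 0)); split=> //;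
    right; exists c.
exists zeta; split=> //; left; split=> //; split=> // i.
by rewrite lt_neqAle H w.
Qed.

Lemma class_eq xi c i j : (forall i, xi i != 0) -> bracket (xi c) (xi i) == 0 ->
  bracket (xi c) (xi j) == 0 -> bracket (xi i) (xi j) == 0.
Proof.
move=> n ci cj; apply: (@bracket_trans _ _ (xi c)) => //.
by rewrite bracketC_eq0.
Qed.

Lemma class_subset xi i D : \sum_(j | D j) y j = 1 ->
  (forall j, bracket (xi i) (xi j) == 0 -> D j) ->
  cwt xi i <= 1 /\ (cwt xi i = 1 -> forall j, D j -> bracket (xi i) (xi j) == 0).
Proof.
move=> Dw sub; rewrite -Dw (bigID (fun j => bracket (xi i) (xi j) == 0)) /=.
have -> : \sum_(j | D j && (bracket (xi i) (xi j) == 0)) y j = cwt xi i.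
  apply: eq_bigl => j; case: (boolP (bracket _ _ == 0)) => [/sub ->//|].
  by rewrite andbF.
split; first by rewrite lerDl; apply: sumr_ge0 => j _; exact: ltW.
move=> e; have /eqP : \sum_(j | D j && (bracket (xi i) (xi j) != 0)) y j = 0.
  by apply: (addrI (cwt xi i)); rewrite addr0 -e.
rewrite psumr_eq0 => [/allP H j Dj|j _]; last exact: ltW.
have := H j; rewrite mem_index_enum => /(_ isT).
by rewrite (gt_eqF (y_gt0 j)) implybF Dj /= negbK.
Qed.

(** Two classes of weight 1 in a total of 2 are equal or complementary, and exchanging the two
    points of the line is projective. *)
Lemma class_of_weight1 xi c D : (forall i, xi i != 0) -> cwt xi c = 1 ->
  \sum_(i | D i) y i = 1 ->
  (forall i j, D i -> D j = (bracket (xi i) (xi j) == 0)) ->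
  ceq (two_point C (fun i => bracket (xi c) (xi i) != 0)) (two_point C (predC D)).
Proof.
move=> n cw Dw cD; have [Dc|Dc] := boolP (D c).
  rewrite -(@two_point_ext _ _ (fun i => bracket (xi c) (xi i) != 0)).
    exact: ceq_refl.
  by move=> i /=; rewrite (cD c).
have dw : (fun i => bracket (xi c) (xi i) == 0) =1 predC D.
  apply: disjoint_weight => // j; apply/negP => /andP[Dj cj].
  by rewrite (cD j) // bracketC_eq0 cj in Dc.
rewrite -(two_point_ext _ dw) -[X in ceq X _]/(two_point C (fun i => ~~ _)).
exact/ceq_sym/two_pointN.
Qed.

Lemma polystable_limit_uniq zeta xi xi' :
  polystable_limit zeta xi -> polystable_limit zeta xi' -> ceq xi xi'.
Proof.
move=> [[n w] H] [_ H'].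
case: H H' => [[[_ st] ->]|[c cw ->]] [[[_ st'] ->]|[c' cw' ->]].
- exact: ceq_refl.
- by have := st c'; rewrite cw' ltxx.
- by have := st' c; rewrite cw ltxx.
- apply: (class_of_weight1 n cw cw') => i j ci.
  by rewrite (@bracket_congl _ (zeta c') (zeta i)).
Qed.

(** The class [D] of weight 1 excludes stability, so the limit is a two-point configuration, and all
    classes of weight 1 define the same one. *)
Lemma polystable_limit_class zeta xi D : polystable_limit zeta xi ->
  \sum_(i | D i) y i = 1 ->
  (forall i j, D i -> D j = (bracket (zeta i) (zeta j) == 0)) ->
  ceq xi (two_point C (predC D)).
Proof.
move=> [[n w] H] Dw cD; case: H => [[[_ st] _]|[c cw ->]]; last first.
  exact: class_of_weight1 cD.
have [|/existsPn H] := boolP [exists i, D i]; last first.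
  by move: Dw; rewrite big_pred0 => [|i]; [lra|apply/negbTE].
case/existsP=> i Di; have := st i; rewrite /cwt.
have -> : \sum_(j | bracket (zeta i) (zeta j) == 0) y j = 1.
  by rewrite -[RHS]Dw; apply: eq_bigl => j; rewrite (cD i).
by rewrite ltxx.
Qed.

End Weights.

(** * Semistable components of stable curves *)

Section CurveTree.
Variables (C : fieldType) (n : nat).
Implicit Types (X Y : marked_curve C n).

(** The cardinals in [nnodes] and [log_degree] are those of classical sets. *)
Lemma card_mkset (T : finType) (p : pred T) :
  #|[set x | p x]%classic| = #|[pred x | p x]|.
Proof. by apply: eq_card => x; apply/idP/idP; rewrite !inE. Qed.

Section OneCurve.
Variable X : marked_curve C n.
Hypothesis gX : genus0_curve X.
Notation dirX := (dir (@adj _ _ X)).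
Notation branchX := (branch (@adj _ _ X)).

Lemma curve_tree : tree (@adj _ _ X).
Proof.
case: (gX) => [[? ?] ? card _ _]; split=> //; rewrite card_ord.
by move: card; rewrite /nnodes card_mkset.
Qed.

Lemma contractionE v i : contraction (X := X) v i =
  if comp X i == v then mark X i else node v (dirX v (comp X i)).
Proof.
rewrite /contraction; case: eqP => // /eqP iv.
have [vd du] := dirP curve_tree iv.
(* The default value of [dir] would make [v] adjacent to itself. *)
move: vd du; rewrite /dir; case: pickP => [w //|] /=.
by move=> _; case: curve_tree => _ -> .
Qed.

Lemma adj_dir v u : u != v -> adj v (dirX v u).
Proof. by move=> uv; have [] := dirP curve_tree uv. Qed.

Lemma contraction_neq0 v i : contraction (X := X) v i != 0.
Proof.
case: gX => _ _ _ [nod _] [mk _]; rewrite contractionE.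
by have [_|iv] // := eqVneq (comp X i) v; apply: nod; apply: adj_dir.
Qed.

Lemma contraction_class v i j :
  (bracket (contraction (X := X) v i) (contraction v j) == 0) =
  if comp X i == v
  then (comp X j == v) && (bracket (mark X i) (mark X j) == 0)
  else (comp X j != v) && (dirX v (comp X i) == dirX v (comp X j)).
Proof.
case: (gX) => _ _ _ [_ nod] [_ mk]; rewrite !contractionE.
have [iv|iv] := eqVneq (comp X i) v; have [jv|jv] //= := eqVneq (comp X j) v.
- by apply/negbTE; rewrite -iv mk // adj_dir // iv.
- by apply/negbTE; rewrite bracketC oppr_eq0 -jv mk // adj_dir // jv.
- have [->|d] := eqVneq (dirX v (comp X i)) (dirX v (comp X j)); first by rewrite bracketvv eqxx.
  by apply/negbTE; rewrite nod // adj_dir.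
Qed.

Lemma branch_class v w i j : adj v w -> branchX v w (comp X i) ->
  branchX v w (comp X j) = (bracket (contraction v i) (contraction v j) == 0).
Proof.
move=> vw /andP[iv /eqP di]; rewrite contraction_class (negPf iv) di.
by rewrite /branch [w == _]eq_sym.
Qed.

Lemma separates_sym v i j : separates (X := X) v i j = separates v j i.
Proof. by rewrite /separates bracketC_eq0. Qed.

(** For two components, the branch at each in the direction of the other together cover the tree.
    Hence one of these branches holds two of the three points, which its component does not
    separate. *)
Lemma median_eq v a b c :
  separates v a b -> separates v b c -> separates v a c ->
  median X a b c = Some v.
Proof.
move=> ab bc ac; rewrite /median; case: pickP => [v'|/(_ v)]; last first.
  by rewrite /= ab bc ac.
case/and3P=> ab' bc' ac'; congr Some; apply/eqP/negPn/negP => v'v.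
have v'v2 : v != v' by rewrite eq_sym.
have cov i : branchX v (dirX v v') (comp X i) || branchX v' (dirX v' v) (comp X i).
  exact: branch_cover curve_tree _ _ _ v'v2.
have excl u u' i j : u' != u -> separates u i j ->
    branchX u (dirX u u') (comp X i) -> branchX u (dirX u u') (comp X j) -> False.
  move=> uu' /negP ij bi bj; apply: ij.
  by rewrite -(branch_class j (adj_dir uu') bi).
case/orP: (cov a) (cov b) (cov c) => [ha|ha] /orP[hb|hb] /orP[hc|hc];
by [apply: (excl v v' a b)|apply: (excl v v' a c)|apply: (excl v v' b c)|
    apply: (excl v' v a b)|apply: (excl v' v a c)|apply: (excl v' v b c)].
Qed.

Lemma median_swap a b c : median X c b a = median X a b c.
Proof.
rewrite /median; apply: eq_pick => v /=.
by rewrite ![separates v c _]separates_sym [separates v b a]separates_sym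
  andbCA !andbA.
Qed.

Lemma medianP a b c v : median X a b c = Some v ->
  [/\ separates v a b, separates v b c & separates v a c].
Proof. by rewrite /median; case: pickP => // u /and3P[? ? ?] [<-]. Qed.

End OneCurve.

Lemma curve_iso_contraction X Y (gX : genus0_curve X) (gY : genus0_curve Y)
    (f : 'I_(ncomp X) -> 'I_(ncomp Y)) (g : 'I_(ncomp X) -> 'M[C]_2) :
    bijective f -> (forall v, g v \in unitmx) ->
    (forall v w, adj (f v) (f w) = adj v w) ->
    (forall v w, adj v w ->
       bracket (node v w *m g v) (node (f v) (f w)) = 0) ->
    (forall i, comp Y i = f (comp X i) /\
       bracket (mark X i *m g (comp X i)) (mark Y i) = 0) ->
  forall v, ceq (contraction v) (contraction (f v)).
Proof.
move=> bf gu fa fn fm v; have finj := bij_inj bf.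
exists (g v) => // i; apply/bracket_eq0.
- by rewrite mul_unitmx2_neq0 // contraction_neq0.
- exact: contraction_neq0.
have [ci mi] := fm i; rewrite !contractionE // ci inj_eq //.
have [<-|iv] := eqVneq (comp X i) v; first by rewrite mi.
have vd := adj_dir gX iv.
have -> : dir (@adj _ _ Y) (f v) (f (comp X i)) = f (dir (@adj _ _ X) v (comp X i)).
  have [_ du] := dirP (curve_tree gX) iv.
  apply: (dir_eq (curve_tree gY)).
  - by rewrite inj_eq.
  - by rewrite fa.
  have /connectP[p ep lp] := du; apply/connectP; exists (map f p).
    rewrite path_map; apply: sub_path ep => a b /=.
    by rewrite /off /= fa !inj_eq.
  by rewrite last_map -lp.
by rewrite fn.
Qed.

Lemma curve_iso_refl X : curve_iso X X.
Proof.
exists id, (fun => 1%:M); split=> //; first by exists id.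
- by move=> v; rewrite unitmx1.
- by move=> v w _; rewrite mulmx1 bracketvv.
- by move=> i; rewrite mulmx1 bracketvv.
Qed.

Lemma bracket_invmx (u v : 'rV[C]_2) g : g \in unitmx ->
  bracket (u *m g) v = 0 -> bracket (v *m invmx g) u = 0.
Proof.
move=> gu e; have /eqP : bracket (u *m g *m invmx g) (v *m invmx g) = 0.
  by rewrite bracketM e mulr0.
by rewrite mulmxK // bracketC_eq0 => /eqP.
Qed.

Lemma curve_iso_sym X Y : curve_iso X Y -> curve_iso Y X.
Proof.
case=> f [g [[f' fK f'K] gu fa fn fm]].
exists f', (fun v => invmx (g (f' v))); split.
- by exists f.
- by move=> v; rewrite unitmx_inv.
- by move=> v w; rewrite -fa !f'K.
- move=> v w vw; apply: bracket_invmx => //.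
  by have := fn (f' v) (f' w); rewrite !f'K; apply; rewrite -fa !f'K.
- move=> i; have [ci mi] := fm i; rewrite ci fK; split=> //.
  exact: bracket_invmx.
Qed.

Lemma curve_iso_trans X Y Z : genus0_curve X -> genus0_curve Y ->
  genus0_curve Z -> curve_iso X Y -> curve_iso Y Z -> curve_iso X Z.
Proof.
move=> [_ _ _ [nX _] [mX _]] [_ _ _ [nY _] [mY _]] [_ _ _ [nZ _] [mZ _]].
move=> [f [g [bf gu fa fn fm]]] [f' [g' [bf' gu' fa' fn' fm']]].
have tr u v w h h' : h \in unitmx -> h' \in unitmx -> u != 0 -> v != 0 ->
    w != 0 -> bracket (u *m h) v = 0 -> bracket (v *m h') w = 0 ->
    bracket (u *m (h *m h')) w = 0 :> C.
  move=> hu hu' u0 v0 w0 uv vw; apply/eqP; rewrite mulmxA.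
  apply: (@bracket_trans _ _ (v *m h')); rewrite ?mul_unitmx2_neq0 //.
    by rewrite bracketM uv mulr0.
  by rewrite vw.
exists (f' \o f), (fun v => g v *m g' (f v)); split.
- exact: bij_comp.
- by move=> v; rewrite unitmx_mul gu gu'.
- by move=> v w /=; rewrite fa' fa.
- move=> v w vw /=; apply: (tr _ (node (f v) (f w))) => //.
  + exact: nX.
  + by apply: nY; rewrite fa.
  + by apply: nZ; rewrite fa' fa.
  + exact: fn.
  + by apply: fn'; rewrite fa.
- move=> i /=; have [ci mi] := fm i; have [ci' mi'] := fm' i.
  split; first by rewrite ci' ci.
  apply: (tr _ (mark Y i)) => //; by rewrite -ci.
Qed.

End CurveTree.

Section StableCurves.
Variables (C : fieldType) (n : nat) (A : 'I_n -> rat).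
Hypothesis wA : weight_data A.
Implicit Types (X : marked_curve C n).

Lemma weight_gt0 i : 0 < A i. Proof. by case: wA => /(_ i)/andP[]. Qed.
Lemma weight_le1 i : A i <= 1. Proof. by case: wA => /(_ i)/andP[]. Qed.

Section OneStableCurve.
Variable X : marked_curve C n.
Hypothesis sX : stable_curve A X.
Let gX : genus0_curve X. Proof. by case: sX. Qed.
Notation adjX := (@adj _ _ X).
Notation dirX := (dir (@adj _ _ X)).
Notation branchX := (branch (@adj _ _ X)).

Lemma log_degree_gt0 v :
  2 < #|[pred w | adj (m := X) v w]|%:R + \sum_(i | comp X i == v) A i.
Proof.
case: sX => _ /(_ v) + _; rewrite /log_degree (card_mkset (fun w => adj v w)).
by lra.
Qed.

(** At the far end of the branch is a component with a single node. Ampleness requires marks of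
    total weight above 1 on it, and one mark weighs at most 1. *)
Lemma branch_two_marks v w : adj v w -> exists i j,
  [/\ i != j, branchX v w (comp X i) & branchX v w (comp X j)].
Proof.
move: v w; apply: (branch_ind (curve_tree gX)).
move=> v w vw IH.
have [/existsP[w' /andP[ww' w'v]]|/existsPn leaf] :=
    boolP [exists w', adj w w' && (w' != v)].
  have [i [j [ij bi bj]]] := IH w' ww' w'v.
  exists i, j; split=> //;
  exact: (branch_sub (curve_tree gX) vw ww').
have := log_degree_gt0 w.
have -> : #|[pred w' | adj w w']| = 1%N.
  rewrite -(card1 v); apply: eq_card => w'; rewrite !inE.
  apply/idP/eqP => [ww'|->]; last by case: (curve_tree gX) => ->.
  by have := leaf w'; rewrite ww' /= negbK => /eqP.
move=> deg.
have on_w i : comp X i == w -> branchX v w (comp X i).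
  move=> /eqP ->; rewrite /branch.
  rewrite (dir_adj (curve_tree gX) vw).
  by rewrite eqxx andbT eq_sym (adj_neq (curve_tree gX)).
have [/existsP[i wi]|/existsPn no] := boolP [exists i, comp X i == w]; last first.
  by move: deg; rewrite big_pred0 => [|i]; [lra|apply/negbTE].
have [/existsP[j /andP[wj ji]]|/existsPn no] :=
    boolP [exists j, (comp X j == w) && (j != i)].
  by exists i, j; rewrite eq_sym ji !on_w.
move: deg; rewrite (bigD1 i) //= big_pred0 => [|j]; last exact/negbTE.
by have := weight_le1 i; lra.
Qed.

Lemma coincide_sum v c : comp X c = v ->
  \sum_(i | (comp X i == v) && (bracket (mark X c) (mark X i) == 0)) A i <= 1.
Proof.
move=> cv; case: sX => _ _ /(_ [set i | (comp X i == v) &&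
  (bracket (mark X c) (mark X i) == 0)]%SET) H.
rewrite (eq_bigl (fun i => i \in [set i | (comp X i == v) &&
  (bracket (mark X c) (mark X i) == 0)]%SET)) => [|i]; last by rewrite inE.
apply: H => i j; rewrite !inE => /andP[/eqP iv ci] /andP[/eqP jv cj].
rewrite /coincide iv jv eqxx /=.
case: gX => _ _ _ _ [mk _]; apply: (@bracket_trans _ _ (mark X c)) => //.
by rewrite bracketC_eq0.
Qed.

(* The at most two special points on v carrying b and c contribute at most 2 to
   the degree of K + sum of a_i s_i, which would then not be ample on v. *)
Lemma third_class v b c : exists a, separates (X := X) v a b && separates v a c.
Proof.
have [/existsP//|/existsPn H] :=
  boolP [exists a, separates (X := X) v a b && separates v a c].
exfalso; have {}H a : (bracket (contraction v b) (contraction v a) == 0) ||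
    (bracket (contraction v c) (contraction (X := X) v a) == 0).
  have := H a; rewrite negb_and /separates !negbK.
  by rewrite ![bracket (contraction v a) _ == 0]bracketC_eq0.
(* The class of a mark [d] on [v] has weight at most 1 and involves no node; the class of a mark
   elsewhere is one node and no mark of [v]. As every node leads to some mark, [b] and [c] account
   for all nodes. *)
pose on d := (comp X d == v)%:R : rat.
have sum_on d : \sum_(i | (comp X i == v) &&
    (bracket (contraction v d) (contraction (X := X) v i) == 0)) A i <= on d.
  rewrite /on; have [dv|dv] := eqVneq (comp X d) v.
    apply: le_trans (coincide_sum dv); rewrite le_eqVlt; apply/orP; left.
    apply/eqP/eq_bigl => i; rewrite contraction_class // dv eqxx andbA.
    by case: (comp X i == v).
  rewrite big_pred0 // => i; rewrite contraction_class // (negPf dv).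
  by case: (comp X i == v).
have sum_v : \sum_(i | comp X i == v) A i <= on b + on c.
  apply: le_trans (lerD (sum_on b) (sum_on c)).
  rewrite [X in _ <= X + _]big_mkcond [X in _ <= _ + X]big_mkcond /= -big_split /=.
  rewrite big_mkcond /=; apply: ler_sum => i _.
  have := H i; have := weight_gt0 i.
  case: (comp X i == v) => /=; last by move=> _ _; lra.
  case: (bracket (contraction v b) _ == 0);
  by case: (bracket (contraction v c) _ == 0) => //=; lra.
have card_v : (#|[pred w | adj (m := X) v w]|)%:R <= 2 - on b - on c :> rat.
  pose s d := if comp X d == v then [::] else [:: dirX v (comp X d)].
  have szs d : (size (s d))%:R = 1 - on d :> rat.
    by rewrite /s /on; case: eqP => _ /=; rewrite ?subrr ?subr0.
  have : (#|[pred w | adj (m := X) v w]| <= size (s b ++ s c))%N.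
    apply: leq_trans (card_size _); apply: subset_leq_card.
    apply/fintype.subsetP => w; rewrite inE => vw.
    have [i [_ [_ /andP[iv /eqP iw] _]]] := branch_two_marks vw.
    have in_s d : (bracket (contraction v d) (contraction (X := X) v i) == 0) ->
        w \in s d.
      rewrite contraction_class // /s (negPf iv); case: eqP => //= _.
      by rewrite iw inE eq_sym.
    by rewrite mem_cat; case/orP: (H i) => /in_s ->; rewrite ?orbT.
  by rewrite size_cat -(ler_nat rat) natrD !szs; lra.
by have := log_degree_gt0 v; lra.
Qed.

Section Weighted.
Variables (R : realFieldType) (y : 'I_n -> R).
Hypotheses (y_gt0 : forall i, 0 < y i) (y_sum : \sum_i y i = 2).
Hypothesis y_dom : forall D : pred 'I_n,
  \sum_(i | D i) A i <= 1 -> \sum_(i | D i) y i <= 1.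

Let wbranch v w := \sum_(i | branchX v w (comp X i)) y i.

(** A class of the contraction is either a set of coinciding marks of [v], bounded through [y_dom],
    or the set of marks in one branch. *)
Lemma semistable_of_branches v :
  (forall w, adj v w -> wbranch v w <= 1) ->
  semistable y (contraction (X := X) v).
Proof.
move=> H; split=> [i|i]; first exact: contraction_neq0.
rewrite /cwt; have [iv|iv] := eqVneq (comp X i) v.
  apply: y_dom; apply: le_trans (coincide_sum iv); rewrite le_eqVlt; apply/orP; left.
  by apply/eqP/eq_bigl => j; rewrite contraction_class // iv eqxx.
apply: le_trans (H _ (adj_dir gX iv)); rewrite le_eqVlt; apply/orP; left.
apply/eqP/eq_bigl => j; rewrite -(branch_class gX _ (adj_dir gX iv)) //.
by rewrite /branch iv eqxx.
Qed.

(** From an edge into a branch of weight above 1, walk on into heavy branches. The branch left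
    behind weighs less than 1, so the walk never turns back and stops at a component without heavy
    branches. *)
Lemma semistable_component : exists v, semistable y (contraction (X := X) v).
Proof.
have [/existsP[v /existsP[w /andP[vw bad]]]|/existsPn ok] :=
    boolP [exists v, exists w, adj v w && (1 < wbranch v w)]; last first.
  have n0 : (0 < n)%N.
    by move: y_sum; case: (n) y => // y0; rewrite big_ord0; lra.
  exists (comp X (Ordinal n0)); apply: semistable_of_branches => w vw.
  have := ok (comp X (Ordinal n0)); rewrite negb_exists => /forallP/(_ w).
  by rewrite vw /= -leNgt.
move: v w vw bad; apply: (branch_ind (curve_tree gX)) => v w vw IH bad.
have [/existsP[w' /andP[ww' bad']]|/existsPn ok] :=
    boolP [exists w', adj w w' && (1 < wbranch w w')]; last first.
  exists w; apply: semistable_of_branches => w' ww'.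
  by have := ok w'; rewrite ww' /= -leNgt.
apply: (IH w') => //; apply/eqP => w'v; move: bad'; rewrite w'v ltNge => /negP; apply.
have := y_sum; rewrite (bigID (fun i => branchX v w (comp X i))) /= /wbranch.
rewrite [in X in _ -> X](eq_bigl (fun i => ~~ branchX v w (comp X i))); last first.
  move=> i.
  exact: (branchC (curve_tree gX)).
by move: bad; rewrite /wbranch; lra.
Qed.

Definition curve_limit (Z : marked_curve C n) xi :=
  exists v, polystable_limit y (contraction (X := Z) v) xi.

Lemma curve_limit_exists : exists xi, curve_limit X xi.
Proof.
have [v /polystable_limit_exists[xi ?]] := semistable_component.
by exists xi, v.
Qed.

(** For distinct semistable components, the two branches facing each other cover all marks and each
    weigh at most 1. So both weigh 1 and are complementary, and each limit is the two-point
    configuration of this partition, up to exchanging the points. *)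
Lemma curve_limit_uniq xi xi' : curve_limit X xi -> curve_limit X xi' -> ceq xi xi'.
Proof.
move=> [v Hv] [v' Hv']; have [vv'|vv'] := eqVneq v v'.
  by rewrite -vv' in Hv'; exact: (polystable_limit_uniq y_gt0 y_sum Hv Hv').
have v'v : v' != v by rewrite eq_sym.
pose D i := branchX v (dirX v v') (comp X i).
pose D' i := branchX v' (dirX v' v) (comp X i).
have cD i j : D i -> D j = (bracket (contraction v i) (contraction v j) == 0).
  exact: branch_class (adj_dir gX v'v).
have cD' i j : D' i -> D' j = (bracket (contraction v' i) (contraction v' j) == 0).
  exact: branch_class (adj_dir gX vv').
have w1 u (E : pred 'I_n) : semistable y (contraction (X := X) u) ->
    (forall i j, E i -> E j = (bracket (contraction u i) (contraction u j) == 0)) ->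
    \sum_(i | E i) y i <= 1.
  move=> [_ w] cE; have [/existsP[i Ei]|/existsPn no] := boolP [exists i, E i].
    apply: le_trans (w i); rewrite le_eqVlt; apply/orP; left.
    by apply/eqP/eq_bigl => j; rewrite (cE i).
  by rewrite big_pred0 ?ler01 // => i; apply/negbTE.
have [|||Dw Dw' DD'] := cover_weight y_gt0 y_sum (D := D) (D' := D').
- by apply: (w1 v) => //; case: Hv.
- by apply: (w1 v') => //; case: Hv'.
- move=> i.
  exact: (branch_cover (curve_tree gX)).
have e := polystable_limit_class y_gt0 y_sum Hv Dw cD.
have e' := polystable_limit_class y_gt0 y_sum Hv' Dw' cD'.
apply: ceq_trans e _; apply: ceq_sym; apply: ceq_trans e' _.
rewrite -(two_point_ext C (_ : (fun i => ~~ ~~ D i) =1 predC D')) => [|i].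
  exact/ceq_sym/two_pointN.
by rewrite /= DD' /= negbK.
Qed.

End Weighted.
End OneStableCurve.

Lemma curve_limit_iso (R : realFieldType) (y : 'I_n -> R) X Y xi :
  genus0_curve X -> genus0_curve Y -> curve_iso X Y ->
  curve_limit y X xi -> exists2 xi', curve_limit y Y xi' & ceq xi xi'.
Proof.
move=> gX gY [f [g [bf gu fa fn fm]]] [v Hv].
have e := curve_iso_contraction gX gY bf gu fa fn fm v.
by have [xi' ? ?] := polystable_limit_ceq e Hv; exists xi' => //; exists (f v).
Qed.

End StableCurves.

(** * Smooth curves and smoothings *)

Section SmoothCurves.
Variables (C : fieldType) (n : nat).
Implicit Types (z : 'I_n -> 'rV[C]_2).

Definition generic_config z := forall i j, i != j -> bracket (z i) (z j) != 0.

Definition smooth_curve z : marked_curve C n :=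
  @MarkedCurve C n 1 (fun _ _ => false) (fun _ _ => 0) (fun _ => ord0) z.

Lemma contraction_smooth z v i : contraction (X := smooth_curve z) v i = z i.
Proof. by rewrite /contraction [v]ord1 eqxx. Qed.

Lemma separates_smooth z v i j :
  separates (X := smooth_curve z) v i j = (bracket (z i) (z j) != 0).
Proof. by rewrite /separates !contraction_smooth. Qed.

Lemma generic_config_neq0 z : (1 < n)%N -> generic_config z -> forall i, z i != 0.
Proof.
move=> n1 gz i; have [j ji] : exists j : 'I_n, j != i.
  have n0 : (0 < n)%N by lia.
  have [->|i0] := eqVneq i (Ordinal n0); first by exists (Ordinal n1).
  by exists (Ordinal n0); rewrite eq_sym.
apply: contra_neq (gz _ _ ji) => ->.
by rewrite /bracket !mxE !mulr0 subrr.
Qed.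

Lemma smooth_genus0 z : (forall i, z i != 0) -> genus0_curve (smooth_curve z).
Proof.
move=> z0; split=> //.
- by move=> v w; rewrite !ord1 connect0.
- rewrite /nnodes (_ : #|_| = 0%N) //.
  by rewrite (card_mkset (fun e : 'I_1 * 'I_1 => false)) card0.
Qed.

Lemma smooth_stable (A : 'I_n -> rat) z : weight_data A ->
  (forall i, z i != 0) -> generic_config z -> stable_curve A (smooth_curve z).
Proof.
move=> [wA sA] z0 gz; split; first exact: smooth_genus0.
- move=> v; rewrite /log_degree (card_mkset (fun w : 'I_1 => false)) card0.
  rewrite (eq_bigl xpredT) => [|i]; last by rewrite /= !ord1.
  by lra.
- move=> I HI; have [->|/finset.set0Pn[i iI]] := eqVneq I finset.set0.
    by rewrite finset.big_set0.
  rewrite (eq_bigl (pred1 i)) => [|j].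
    by rewrite big_pred1_eq; have /andP[] := wA i.
  apply/idP/eqP => [jI|->//]; apply/eqP/negPn/negP => ji.
  by have := HI _ _ jI iI; rewrite /coincide /= (negPf (gz _ _ ji)).
Qed.

Lemma cross_ratio_contraction (X : marked_curve C n) v a b c i :
  median X a b c = Some v ->
  cross_ratio (a, b, c, i) X =
    (bracket (contraction v i) (contraction v a) *
     bracket (contraction v b) (contraction v c)) /
    (bracket (contraction v i) (contraction v c) *
     bracket (contraction v b) (contraction v a)).
Proof. by rewrite /cross_ratio => ->. Qed.

Lemma smooth_cross_ratio z a b c i : (forall i, z i != 0) ->
  bracket (z a) (z b) != 0 -> bracket (z b) (z c) != 0 ->
  bracket (z a) (z c) != 0 -> bracket (z i) (z c) != 0 ->
  cross_ratio_dom (a, b, c, i) (smooth_curve z) /\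
  cross_ratio (a, b, c, i) (smooth_curve z) =
    (bracket (z i) (z a) * bracket (z b) (z c)) /
    (bracket (z i) (z c) * bracket (z b) (z a)).
Proof.
move=> z0 ab bc ac ic.
have m : median (smooth_curve z) a b c = Some ord0.
  by apply: median_eq; rewrite ?separates_smooth //; exact: smooth_genus0.
split; first by rewrite /cross_ratio_dom m separates_smooth.
by rewrite (cross_ratio_contraction _ m) !contraction_smooth.
Qed.

Lemma smooth_curve_ceq z z' : ceq z z' -> curve_iso (smooth_curve z) (smooth_curve z').
Proof.
move=> [g gu H]; exists id, (fun=> g); split=> //; first by exists id.
move=> i; split=> //=; have [c c0 ->] := H i.
by rewrite bracketZr bracketvv mulr0.
Qed.

(** A node of [v] would lead to a branch with two marks, which the contraction identifies; so [v]
    has no node and is the whole curve. *)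
Lemma curve_iso_smooth (A : 'I_n -> rat) (X : marked_curve C n) v :
  weight_data A -> stable_curve A X ->
  generic_config (contraction (X := X) v) ->
  curve_iso X (smooth_curve (contraction v)).
Proof.
move=> wA sX gv; have gX : genus0_curve X by case: sX.
have leaf w : adj v w = false.
  apply/negP => vw; have [i [j [ij bi bj]]] := branch_two_marks wA sX vw.
  have := gv i j ij.
  by rewrite -(branch_class gX _ vw bi) bj.
have all_v u : u = v.
  have [_ _ conn _] := curve_tree gX.
  by have /connectP[[|w p] /=] := conn v u; rewrite ?leaf.
exists (fun=> ord0), (fun=> 1%:M); split.
- exists (fun=> v) => x; first by rewrite [RHS]all_v.
  by rewrite [RHS]ord1.
- by move=> u; rewrite unitmx1.
- by move=> a b; rewrite (all_v a) leaf.
- by move=> a b; rewrite (all_v a) leaf.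
- move=> i; split=> //=; rewrite mulmx1 contractionE // (all_v (comp X i)) eqxx.
  by rewrite bracketvv.
Qed.

Lemma generic_config_stable (R : realFieldType) (y : 'I_n -> R) z :
  (forall i, z i != 0) -> (forall i, y i < 1) ->
  generic_config z -> stable y z.
Proof.
move=> z0 y1 gz; split=> // i; rewrite /cwt (eq_bigl (pred1 i)) => [|j].
  by rewrite big_pred1_eq.
apply/idP/eqP => [ij|->]; last by rewrite bracketvv.
by apply/eqP/negPn/negP => ji; rewrite (negPf (gz _ _ _)) // eq_sym in ij.
Qed.

End SmoothCurves.

(** * Smoothing the nodes of a stable curve *)

Section Smoothing.
Variables (C : numFieldType) (n : nat).

Definition perp (p : 'rV[C]_2) : 'rV[C]_2 :=
  if p 0 0 == 0 then row2 (- (p 0 1)^-1) 0 else row2 0 (p 0 0)^-1.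

Lemma bracket_perp p : p != 0 -> bracket p (perp p) = 1.
Proof.
rewrite row2_eq0 /perp negb_and; have [e /= p1|p0 _] := eqVneq (p 0 0) 0.
  by rewrite /bracket !row2E mulr0 sub0r mulrN opprK divff.
by rewrite /bracket !row2E mulr0 subr0 divff.
Qed.

(* A change of coordinates between two components glued at the points p and q,
   which degenerates for t = 0 to the contraction to the point q. *)
Definition transition (p q : 'rV[C]_2) (t : C) (a : 'rV[C]_2) : 'rV[C]_2 :=
  bracket a p *: q + (t * bracket a (perp p)) *: perp q.

(** The three-term Plücker relation. *)
Lemma bracket_decomposition (a b p q : 'rV[C]_2) :
  bracket a p * bracket b q - bracket a q * bracket b p =
  bracket a b * bracket p q.
Proof. by rewrite /bracket; ring. Qed.

Lemma transition_bracket p q t a b : p != 0 -> q != 0 ->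
  bracket (transition p q t a) (transition p q t b) = t * bracket a b.
Proof.
move=> p0 q0; rewrite /transition bracketDl !bracketDr !bracketZl !bracketZr.
rewrite !bracketvv [bracket (perp q) q]bracketC !bracket_perp //.
have := bracket_decomposition a b p (perp p); rewrite bracket_perp // mulr1 => <-.
by ring.
Qed.

Lemma transitionK p q t a : p != 0 -> q != 0 ->
  transition q p t (transition p q t a) = - t *: a.
Proof.
move=> p0 q0; have e := bracket_perp p0.
rewrite /transition !bracketDl !bracketZl !bracketvv [bracket (perp q) q]bracketC.
rewrite !bracket_perp // !mulr0 !add0r !addr0 mulr1 mulrN1.
by apply: row2_eq; rewrite !mxE -[X in _ = _ * X]mulr1 -e /bracket; ring.
Qed.

Definition poly_vector (h : C -> 'rV[C]_2) :=
  exists p q : {poly C}, forall t, h t = row2 p.[t] q.[t].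

Lemma poly_vector_bracket h h' : poly_vector h -> poly_vector h' ->
  exists p : {poly C}, forall t, bracket (h t) (h' t) = p.[t].
Proof.
move=> [p [q hE]] [p' [q' hE']]; exists (p * q' - q * p') => t.
by rewrite hE hE' /bracket !row2E !hornerE.
Qed.

Lemma poly_vector_transition p q h : poly_vector h ->
  poly_vector (fun t => transition p q t (h t)).
Proof.
move=> [r [s hE]].
have cst (v : 'rV[C]_2) : poly_vector (fun=> v).
  by exists (v 0 0)%:P, (v 0 1)%:P => t; rewrite !hornerC -row2_eta.
have ph : poly_vector h by exists r, s.
have [b1 b1E] := poly_vector_bracket ph (cst p).
have [b2 b2E] := poly_vector_bracket ph (cst (perp p)).
exists ((q 0 0) *: b1 + (perp q 0 0) *: ('X * b2)),
       ((q 0 1) *: b1 + (perp q 0 1) *: ('X * b2)) => t.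
rewrite /transition b1E b2E.
by apply: row2_eq; rewrite !row2E !mxE !(hornerD, hornerZ, hornerM, hornerX); ring.
Qed.

Lemma poly_vector_line (u v : 'rV[C]_2) : poly_vector (fun t => u + t *: v).
Proof.
exists ((u 0 0)%:P + (v 0 0) *: 'X), ((u 0 1)%:P + (v 0 1) *: 'X) => t.
by apply: row2_eq;
  rewrite !row2E !mxE !(hornerD, hornerZ, hornerC, hornerX); ring.
Qed.

(* The vectors (1, i) make the brackets of any two of the perturbed vectors
   polynomials of degree 2. *)
Definition perturb (z : 'I_n -> 'rV[C]_2) (t : C) (i : 'I_n) : 'rV[C]_2 :=
  z i + t *: row2 1 i%:R.

Lemma perturb_bracket z i j : i != j -> exists P : {poly C},
  [/\ P != 0, P.[0] = bracket (z i) (z j) &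
      forall t, bracket (perturb z t i) (perturb z t j) = P.[t]].
Proof.
move=> ij; pose u := row2 1 i%:R : 'rV[C]_2; pose v := row2 1 j%:R : 'rV[C]_2.
exists ((bracket (z i) (z j))%:P + (bracket (z i) v + bracket u (z j)) *: 'X
        + (bracket u v) *: 'X^2); split.
(* The coefficient of degree 2 is j - i, nonzero in characteristic 0. *)
- apply: contra_neq ij => /(congr1 (fun p : {poly C} => p`_2)).
  rewrite !coefD !coefZ coefC coefX coefXn coef0 /= mulr0 !add0r mulr1.
  rewrite /bracket !row2E mul1r mulr1 => /eqP; rewrite subr_eq0 eqr_nat.
  by move=> /eqP ?; apply/val_inj.
- by rewrite !(hornerD, hornerZ, hornerC, hornerX, hornerXn) expr0n /= !mulr0 !addr0.
- move=> t; rewrite !(hornerD, hornerZ, hornerC, hornerX, hornerXn) /perturb.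
  by rewrite -/u -/v bracketDl !bracketDr !bracketZl !bracketZr; ring.
Qed.

Variables (A : 'I_n -> rat) (X : marked_curve C n).
Hypotheses (wA : weight_data A) (sX : stable_curve A X).
Let gX : genus0_curve X. Proof. by case: sX. Qed.
Notation dirX := (dir (@adj _ _ X)).

(** Each mark, perturbed on its own component, is transported to the others through the transitions
    along the path. At t = 0 a transition collapses to the node, up to the bracket with the node
    left behind, which is nonzero; this gives the contraction. *)
Lemma smoothing_family : exists Y : 'I_n -> 'I_(ncomp X) -> C -> 'rV[C]_2,
  [/\ forall i t, Y i (comp X i) t = perturb (mark X) t i,
      forall i v, comp X i != v -> forall t, Y i v t =
        transition (node (dirX v (comp X i)) v) (node v (dirX v (comp X i))) t
          (Y i (dirX v (comp X i)) t),
      forall i v, poly_vector (Y i v) &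
      forall i v, exists2 c, c != 0 & Y i v 0 = c *: contraction v i].
Proof.
have /choice[Y HY] i : exists f : 'I_(ncomp X) -> C -> 'rV[C]_2,
    f (comp X i) = (fun t => perturb (mark X) t i) /\
    forall v, v != comp X i -> f v = fun t =>
      transition (node (dirX v (comp X i)) v) (node v (dirX v (comp X i))) t
        (f (dirX v (comp X i)) t).
  exact: (dir_rec (curve_tree gX) _ _ (fun v g t =>
    transition (node (dirX v (comp X i)) v) (node v (dirX v (comp X i))) t (g t))).
have Y0 i t : Y i (comp X i) t = perturb (mark X) t i by case: (HY i) => ->.
have YS i v t : comp X i != v -> Y i v t =
    transition (node (dirX v (comp X i)) v) (node v (dirX v (comp X i))) t
        (Y i (dirX v (comp X i)) t).
  by case: (HY i) => _ H iv; rewrite H // eq_sym.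
exists Y; split=> //.
- by move=> i v iv t; apply: YS.
- move=> i; apply: (dir_ind (curve_tree gX) (u := comp X i)).
    by case: (HY i) => -> _; exact: poly_vector_line.
  move=> v vi; case: (HY i) => _ /(_ v vi) -> /=.
  exact: poly_vector_transition.
- move=> i; apply: (dir_ind (curve_tree gX) (u := comp X i)).
    exists 1; rewrite ?oner_eq0 // Y0 /perturb scale0r addr0 scale1r.
    by rewrite contractionE // eqxx.
  move=> v vi [c c0 Yc]; have iv : comp X i != v by rewrite eq_sym.
  rewrite YS // Yc; set w := dirX v (comp X i).
  have vw : adj v w := adj_dir gX iv.
  have wv : adj w v by case: (curve_tree gX) => ->.
  rewrite /transition mul0r scale0r addr0 bracketZl.
  exists (c * bracket (contraction w i) (node w v)); last first.
    by rewrite (contractionE gX v) (negPf iv).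
  rewrite mulf_neq0 // contractionE //.
  case: gX => _ _ _ [_ nod] [_ mk].
  have [iw|iw] := eqVneq (comp X i) w.
    by have := mk i v; rewrite iw; apply.
  apply: nod => //; first exact: adj_dir.
  (* The node of [w] towards the mark is not the one back to [v], since the mark lies in only one of
     the two branches of this edge. *)
  apply/eqP => d.
  have := branchC (curve_tree gX) (comp X i) vw.
  by rewrite /branch iw iv d -/w !eqxx.
Qed.

(** For t nonzero, crossing an edge multiplies all brackets by t up to rescaling the vectors, so
    every component shows the same configuration and any one may define [z]. The polynomials [B]
    record it as seen from [v], where the limit at 0 is the contraction to [v]. *)
Lemma smoothing : exists (z : C -> 'I_n -> 'rV[C]_2) (D : {poly C}),
  [/\ D != 0, forall t, t != 0 -> D.[t] != 0 -> generic_config (z t) &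
      forall v : 'I_(ncomp X), exists (B : 'I_n -> 'I_n -> {poly C}) (c : 'I_n -> C),
        [/\ forall i, c i != 0,
            forall i j, (B i j).[0] =
              c i * c j * bracket (contraction v i) (contraction v j) &
            forall t, t != 0 -> exists (k : C) (s : 'I_n -> C),
              [/\ k != 0, forall i, s i != 0 &
                  forall i j, (B i j).[t] =
                    k * (s i * s j) * bracket (z t i) (z t j)]]].
Proof.
have [Y [Y0 YS Yp Yc]] := smoothing_family.
have /choice[P PE] (x : 'I_n * 'I_n * 'I_(ncomp X)) : exists p : {poly C},
    forall t, bracket (Y x.1.1 x.2 t) (Y x.1.2 x.2 t) = p.[t].
  exact: poly_vector_bracket.
pose B v i j := P (i, j, v).
have BE v i j t : bracket (Y i v t) (Y j v t) = (B v i j).[t] by apply: (PE (i, j, v)).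
have [_ _ _ [nod _] _] := gX.
have [sadj _ _ _] := curve_tree gX.
have move_edge v w t : adj v w -> t != 0 -> exists s : 'I_n -> C,
    (forall i, s i != 0) /\
    forall i, s i *: Y i w t = transition (node v w) (node w v) t (Y i v t).
  move=> vw t0; have wv : adj w v by rewrite sadj.
  (* Marks beyond the node are moved back across it, at the cost of the factor -t of [transitionK];
     for the others the step is the defining one of [Y]. *)
  exists (fun i => if branch (@adj _ _ X) v w (comp X i) then - t else 1).
  split=> i; first by case: ifP; rewrite ?oppr_eq0 ?oner_eq0.
  case: ifP => [/andP[iv /eqP d]|/negbT]; last first.
    rewrite -branchC //; last exact: curve_tree.
    by case/andP=> iw /eqP d; rewrite scale1r YS // d.
  by rewrite (YS i v iv) d transitionK // nod.
have prop r v t : t != 0 -> exists (k : C) (s : 'I_n -> C),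
    [/\ k != 0, forall i, s i != 0 &
     forall i j, (B v i j).[t] = k * (s i * s j) * bracket (Y i r t) (Y j r t)].
  move=> t0; move: v; apply: (adj_ind (curve_tree gX) (v := r)).
    exists 1, (fun=> 1); split=> [|i|i j]; rewrite ?oner_eq0 //.
    by rewrite -BE !mulr1 mul1r.
  move=> v w vw [k [s [k0 s0 E]]]; have [s' [s'0 E']] := move_edge v w t vw t0.
  exists (t * k), (fun i => s i / s' i); split=> [|i|i j].
  - by rewrite mulf_neq0.
  - by rewrite mulf_neq0 ?invr_eq0.
  have : bracket (s' i *: Y i w t) (s' j *: Y j w t) = t * (B v i j).[t].
    by rewrite !E' transition_bracket ?nod // ?BE // sadj.
  rewrite bracketZl bracketZr E BE => e.
  have -> : (B w i j).[t] = (s' i * (s' j * (B w i j).[t])) / (s' i * s' j).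
    by field; rewrite !s'0.
  by rewrite e; field; rewrite !s'0.
have B0 v i j : (B v i j).[0] = (sval (cid2 (Yc i v))) * (sval (cid2 (Yc j v))) *
    bracket (contraction v i) (contraction v j).
  rewrite -BE; case: (cid2 (Yc i v)) => c /= c0 ->.
  by case: (cid2 (Yc j v)) => d /= d0 ->; rewrite bracketZl bracketZr mulrA.
(* By [prop] one component suffices, and that of mark i is used: there the perturbation separates i
   from marks of the same component, and the value at 0 separates it from the rest. *)
have Bneq0 r i j : i != j -> B r i j != 0.
  move=> ij; suff [v Bv] : exists v, B v i j != 0.
    apply: contra_neq Bv => Br.
    apply: (@poly_eq_cofinite _ _ _ 1) => [|t t0 _]; first exact: oner_neq0.
    have [k [s [_ _ ->]]] := prop r v t t0.
    by rewrite BE Br horner0 mulr0.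
  have [eij|neij] := eqVneq (comp X i) (comp X j).
    exists (comp X i); have [p [p0 _ pE]] := perturb_bracket (mark X) ij.
    apply: contra_neq p0 => Bz.
    apply: (@poly_eq_cofinite _ _ _ 1) => [|t t0 _]; first exact: oner_neq0.
    rewrite -pE -!Y0 -eij horner0.
    by rewrite BE Bz horner0.
  exists (comp X i); apply/eqP => Bz.
  have := B0 (comp X i) i j; rewrite Bz horner0 => /esym/eqP.
  case: (cid2 _) => c /= c0 _; case: (cid2 _) => d /= d0 _.
  rewrite !mulf_eq0 (negPf c0) (negPf d0) /= contraction_class // eqxx.
  by rewrite eq_sym (negPf neij).
have n0 : (0 < n)%N.
  have [_] := wA; case: (n) A => // A0; rewrite big_ord0; lra.
pose r := comp X (Ordinal n0).
exists (fun t i => Y i r t), (\prod_(x : 'I_n * 'I_n | x.1 != x.2) B r x.1 x.2).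
split.
- by apply/prodf_neq0 => -[i j] /= ij; exact: Bneq0.
- move=> t t0; rewrite horner_prod => /prodf_neq0 H i j ij.
  by rewrite BE; apply: (H (i, j)).
- move=> v; exists (B v), (fun i => sval (cid2 (Yc i v))); split=> //.
    by move=> i; case: (cid2 _).
  by move=> t; apply: prop.
Qed.

(** A cross-ratio has degree 0 in each vector, so the scalars in [smoothing] cancel and it becomes a
    quotient of the polynomials [B] of the median component. *)
Lemma smooth_dense (e : gexpr C ('I_n * 'I_n * 'I_n * 'I_n)) :
  (1 < n)%N -> gbasic (@cross_ratio_dom C n) (@cross_ratio C n) e X ->
  exists z, [/\ forall i, z i != 0, generic_config z &
    gbasic (@cross_ratio_dom C n) (@cross_ratio C n) e (smooth_curve z)].
Proof.
move=> n1 eX; have [z [D [D0 gz H]]] := smoothing.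
have [|t [t0 Dt et]] := gbasic_specialization (x := fun t => smooth_curve (z t)) D0 _ eX.
  move=> [[[a b] c] i]; rewrite /cross_ratio_dom.
  case m: (median X a b c) => [v|] // ic.
  have [ab bc ac] := medianP m; have [B [k [k0 B0 Bt]]] := H v.
  have nz p q : separates v p q -> (B p q).[0] != 0.
    by move=> pq; rewrite B0 !mulf_neq0.
  exists (B i a * B b c), (B i c * B b a); split.
  - by rewrite hornerM mulf_neq0 ?nz // separates_sym.
  - rewrite (cross_ratio_contraction _ m) !hornerM !B0.
    have ba : bracket (contraction v b) (contraction v a) != 0.
      by move: ab; rewrite separates_sym.
    have ic' : bracket (contraction v i) (contraction v c) != 0 by [].
    by field; rewrite !k0 ic' ba.
  - move=> t t0 Dt q0; have g := gz t t0 Dt.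
    have nij p q : separates v p q -> bracket (z t p) (z t q) != 0.
      move=> pq; apply: g; apply: contraTneq pq => ->.
      by rewrite /separates bracketvv eqxx.
    have [d ->] := smooth_cross_ratio
      (generic_config_neq0 n1 g) (nij _ _ ab) (nij _ _ bc) (nij _ _ ac) (nij _ _ ic).
    split; first exact: d.
    have [k' [s [k'0 s0 E]]] := Bt t t0; rewrite !hornerM !E.
    have ba : bracket (z t b) (z t a) != 0.
      by apply: nij; rewrite separates_sym.
    have ic' := nij _ _ ic.
    by field; rewrite !s0 k'0 ic' ba.
exists (z t); split=> //; last exact: gz.
exact: generic_config_neq0 (gz t t0 Dt).
Qed.

End Smoothing.

(** * Planes and configurations *)

Section Grassmann.
Variables (C : fieldType) (n : nat).
Implicit Types (xi : 'I_n -> 'rV[C]_2) (L : grassmannian C n).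

Definition config_mx xi : 'M[C]_(2, n) := \matrix_(k, j) xi j 0 k.

(** The Gelfand-MacPherson correspondence between planes and configurations: [L] is the row space of
    the matrix with columns [xi]. *)
Definition spans L xi := sval L = limg (linfun (mulmxr (config_mx xi))).

Lemma mul_config_mx (u : 'rV[C]_2) xi j :
  (u *m config_mx xi) 0 j = u 0 0 * xi j 0 0 + u 0 1 * xi j 0 1.
Proof.
rewrite mxE !big_ord_recl big_ord0 addr0 !mxE.
by congr (_ + u 0 _ * xi j 0 _); exact/val_inj.
Qed.

Lemma spansP L xi w : spans L xi ->
  reflect (exists u, w = u *m config_mx xi) (w \in sval L).
Proof.
move=> ->; apply: (iffP memv_imgP) => [[u _ ->]|[u ->]].
  by exists u; rewrite lfunE.
by exists u; rewrite ?memvf // lfunE.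
Qed.

Lemma vbasis_grassmannian L : exists e0 e1,
  [/\ vbasis (sval L) = [:: e0; e1] :> seq _, sval L = <<[:: e0; e1]>>%VS &
      free [:: e0; e1]].
Proof.
have fr := basis_free (vbasisP (sval L)).
have sp := span_basis (vbasisP (sval L)).
have : size (vbasis (sval L)) = 2 by rewrite size_tuple; case: L {fr sp}.
case: (tval (vbasis (sval L))) fr sp => [|e0 [|e1 []]] //= fr sp _.
by exists e0, e1; split=> //; rewrite sp.
Qed.

(** [d] is the determinant of the base change from the rows of the matrix to [vbasis]. *)
Lemma spans_plucker L xi : spans L xi -> exists2 d, d != 0 &
  forall i j, plucker L i j = d * bracket (xi i) (xi j).
Proof.
move=> sL; have [e0 [e1 [be Le fe]]] := vbasis_grassmannian L.
have /(spansP _ sL)[a0 ae0] : e0 \in sval L by rewrite Le memv_span ?mem_head.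
have /(spansP _ sL)[a1 ae1] : e1 \in sval L.
  by rewrite Le memv_span // !inE eqxx orbT.
exists (bracket a0 a1) => [|i j]; last first.
  by rewrite /plucker be /= ae0 ae1 !mul_config_mx /bracket; ring.
move: fe; rewrite free_cons seq1_free span_seq1 => /andP[+ e10].
apply: contra => ba; apply/vlineP.
have a10 : a1 != 0 by apply: contra_neq e10 => a10; rewrite ae1 a10 mul0mx.
have [a00|a00] := eqVneq a0 0.
  by exists 0; rewrite ae0 a00 mul0mx scale0r.
rewrite bracketC_eq0 in ba; have [c _ ac] := (bracket_eq0 a10 a00).1 ba.
by exists c; rewrite ae0 ae1 ac -scalemxAl.
Qed.

Lemma spans_exists xi i j : bracket (xi i) (xi j) != 0 -> exists L, spans L xi.
Proof.
move=> ij; pose f : 'Hom('rV[C]_2, 'rV[C]_n) := linfun (mulmxr (config_mx xi)).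
suff dim2 : \dim (limg f) = 2 by exists (exist _ (limg f) dim2).
rewrite limg_dim_eq ?dimvf ?dim_matrix //.
apply/eqP; rewrite capfv -subv0; apply/subvP => u.
rewrite memv_ker memv0 lfunE /= => /eqP/rowP u0.
have := u0 i; have := u0 j; rewrite !mul_config_mx !mxE => uj ui.
rewrite row2_eq0; apply/andP; split; apply/eqP/(mulIf ij); rewrite mul0r.
  transitivity ((u 0 0 * xi i 0 0 + u 0 1 * xi i 0 1) * xi j 0 1 -
                (u 0 0 * xi j 0 0 + u 0 1 * xi j 0 1) * xi i 0 1).
    by rewrite /bracket; ring.
  by rewrite ui uj !mul0r subrr.
transitivity ((u 0 0 * xi j 0 0 + u 0 1 * xi j 0 1) * xi i 0 0 -
              (u 0 0 * xi i 0 0 + u 0 1 * xi i 0 1) * xi j 0 0).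
  by rewrite /bracket; ring.
by rewrite ui uj !mul0r subrr.
Qed.

Lemma spans_basis L : exists xi, spans L xi.
Proof.
have [e0 [e1 [be Le fe]]] := vbasis_grassmannian L.
exists (fun j => row2 (e0 0 j) (e1 0 j)); rewrite /spans Le.
have uE u : u *m config_mx (fun j => row2 (e0 0 j) (e1 0 j)) =
    u 0 0 *: e0 + u 0 1 *: e1.
  by apply/rowP => j; rewrite mul_config_mx !row2E !mxE.
apply/vspaceP => w; apply/idP/memv_imgP => [|[u _ ->]].
  rewrite span_cons span_seq1 => /memv_addP[_ /vlineP[a ->] [_ /vlineP[b ->] ->]].
  by exists (row2 a b); rewrite ?memvf // lfunE /= uE !row2E.
rewrite lfunE /= uE memvD // memvZ // memv_span // !inE eqxx ?orbT //.
Qed.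

Lemma spans_det L xi : spans L xi -> exists i j, bracket (xi i) (xi j) != 0.
Proof.
move=> sL; have [d d0 pl] := spans_plucker sL.
have [e0 [e1 [be Le fe]]] := vbasis_grassmannian L.
have [/existsP[i /existsP[j ij]]|/existsPn H] :=
    boolP [exists i, exists j, bracket (xi i) (xi j) != 0]; first by exists i, j.
have {}H i j : e0 0 i * e1 0 j = e0 0 j * e1 0 i.
  apply/eqP; rewrite -subr_eq0.
  have := H i; rewrite negb_exists => /forallP/(_ j); rewrite negbK => /eqP ij.
  by have := pl i j; rewrite /plucker be /= ij mulr0 => ->.
move: fe; rewrite free_cons seq1_free span_seq1 => /andP[/negP ne e10]; case: ne.
have [j ej] : exists j, e1 0 j != 0.
  have [/existsP//|/existsPn e1z] := boolP [exists j, e1 0 j != 0].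
  case/eqP: e10; apply/rowP => j; rewrite mxE; apply/eqP.
  by have := e1z j; rewrite negbK.
apply/vlineP; exists (e0 0 j / e1 0 j); apply/rowP => i; rewrite mxE.
by rewrite mulrAC -H mulfK.
Qed.

Lemma spans_ceq L xi xi' : spans L xi -> spans L xi' -> ceq xi xi'.
Proof.
move=> sL sL'.
have in_L k : row k (config_mx xi') \in sval L.
  by apply/(spansP _ sL'); exists (delta_mx 0 k); rewrite rowE.
have /(spansP _ sL)[a0 e0] := in_L 0; have /(spansP _ sL)[a1 e1] := in_L 1.
pose g : 'M[C]_2 := \matrix_(i, j) (if j == 0 then a0 0 i else a1 0 i).
have gE i : xi' i = xi i *m g.
  apply: row2_eq; rewrite mul_rV2E !mxE /=.
    by have /rowP/(_ i) := e0; rewrite mul_config_mx !mxE => ->; ring.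
  by have /rowP/(_ i) := e1; rewrite mul_config_mx !mxE => ->; ring.
exists g; last by move=> i; exists 1; rewrite ?oner_eq0 // scale1r.
have [i [j]] := spans_det sL'; rewrite !gE bracketM mulf_eq0 negb_or.
by rewrite unitmx2 => /andP[].
Qed.

Lemma spans_torus L L' xi (t : 'rV[C]_n) : (forall i, t 0 i != 0) ->
  spans L xi -> sval L' = (linfun (mulmxr (diag_mx t)) @: sval L)%VS ->
  spans L' (fun i => t 0 i *: xi i).
Proof.
move=> t0 sL e; rewrite /spans e; apply/vspaceP => w.
have tE (u : 'rV[C]_2) : u *m config_mx (fun i => t 0 i *: xi i) =
    u *m config_mx xi *m diag_mx t.
  apply/rowP => i; rewrite mul_mx_diag mxE !mul_config_mx.
  by rewrite !mxE; ring.
apply/memv_imgP/memv_imgP => [[v vL ->]|[u _ ->]]; last first.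
  exists (u *m config_mx xi); first by apply/(spansP _ sL); exists u.
  by rewrite !lfunE /= tE.
have /(spansP _ sL)[u ->] := vL; exists u; rewrite ?memvf //.
by rewrite !lfunE /= tE.
Qed.

(** The torus rescales the columns, and a linear map of the column vectors is a change of basis of
    the plane. *)
Lemma torus_orbitP L L' xi xi' : spans L xi -> spans L' xi' ->
  torus_orbit L L' <-> ceq xi xi'.
Proof.
move=> sL sL'; split=> [[t t0 LL']|[g gu H]].
  have := spans_ceq (spans_torus t0 sL LL') sL'; apply: ceq_trans.
  exists 1%:M; first exact: unitmx1.
  by move=> i; exists (t 0 i) => //; rewrite mulmx1.
have /choice[c cE] i : exists c, c != 0 /\ xi' i = c *: (xi i *m g).
  by have [c] := H i; exists c.
exists (\row_i c i) => [i|]; first by rewrite mxE; case: (cE i).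
have e (u : 'rV[C]_2) : u *m config_mx xi' =
    (u *m g^T) *m config_mx xi *m diag_mx (\row_i c i).
  apply/rowP => i; rewrite mul_mx_diag mxE !mul_config_mx.
  have [_ ->] := cE i; rewrite !mxE !big_ord_recl !big_ord0 !addr0 !mxE.
  have -> : lift ord0 ord0 = 1 :> 'I_2 by exact/val_inj.
  by ring.
apply/vspaceP => w; apply/idP/memv_imgP => [/(spansP _ sL')[u ->]|].
  exists (u *m g^T *m config_mx xi); last by rewrite lfunE /= e.
  by apply/(spansP _ sL); exists (u *m g^T).
case=> v /(spansP _ sL)[u ->] ->; apply/(spansP _ sL').
by exists (u *m invmx g^T); rewrite lfunE /= e mulmxKV // unitmx_tr.
Qed.

Lemma torus_orbit_equivalence : equivalence_prop (@torus_orbit C n).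
Proof.
split=> [L|L L' LL'|L L' L'' LL' LL''].
- have [xi s] := spans_basis L; exact/(torus_orbitP s s)/ceq_refl.
- have [xi s] := spans_basis L; have [xi' s'] := spans_basis L'.
  by apply/(torus_orbitP s' s)/ceq_sym/(torus_orbitP s s').
- have [xi s] := spans_basis L; have [xi' s'] := spans_basis L'.
  have [xi'' s''] := spans_basis L''.
  apply/(torus_orbitP s s''); apply: (@ceq_trans _ _ _ xi').
    exact/(torus_orbitP s s').
  exact/(torus_orbitP s' s'').
Qed.

Definition matroid xi : {set {set 'I_n}} :=
  [set I : {set 'I_n} | [exists i, exists j,
     (bracket (xi i) (xi j) != 0) && (I == [set i; j])]]%SET.

Lemma matroid_pair xi i j :
  ([set i; j]%SET \in matroid xi) = (bracket (xi i) (xi j) != 0).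
Proof.
rewrite inE; apply/existsP/idP => [[a /existsP[b /andP[ab /eqP e]]]|ij]; last first.
  by exists i; apply/existsP; exists j; rewrite ij eqxx.
have nab : a != b by apply: contraTneq ab => ->; rewrite bracketvv eqxx.
have : a \in [set i; j]%SET by rewrite e set21.
have : b \in [set i; j]%SET by rewrite e set22.
rewrite !inE => /orP[] /eqP eb /orP[] /eqP ea; rewrite -?ea -?eb //.
- by rewrite ea eb eqxx in nab.
- by rewrite bracketC_eq0.
- by rewrite ea eb eqxx in nab.
Qed.

Lemma spans_stratum L xi : spans L xi -> stratum (matroid xi) L.
Proof.
move=> sL; have [d d0 pl] := spans_plucker sL; split=> [I|i j _].
  rewrite inE => /existsP[i /existsP[j /andP[ij /eqP ->]]].
  rewrite cards2; have [e|//] := eqVneq i j; move: ij; rewrite e.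
  by rewrite bracketvv eqxx.
by rewrite matroid_pair pl mulf_eq0 negb_or d0.
Qed.

End Grassmann.

(** * Matroid polytopes *)

Section MatroidPolytopes.
Variables (C : fieldType) (R : realType) (n : nat).
Implicit Types (xi : 'I_n -> 'rV[C]_2) (x y : 'rV[R]_n).

(** A probability [w] on ordered pairs of distinct points, with marginals adding up to y, becomes a
    convex combination of vertices once the two orders of each pair are merged. *)
Lemma pair_polytope xi y (w : 'I_n -> 'I_n -> R) :
  (forall i j, 0 <= w i j) ->
  (forall i j, w i j != 0 -> bracket (xi i) (xi j) != 0) ->
  \sum_i \sum_j w i j = 1 ->
  (forall k, y 0 k = \sum_j w k j + \sum_i w i k) ->
  matroid_polytope (matroid xi) y.
Proof.
move=> w0 wxi w1 wy.
pose c (I : {set 'I_n}) := \sum_(p : 'I_n * 'I_n | [set p.1; p.2]%SET == I) w p.1 p.2.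
have cE (V : lmodType R) (F : {set 'I_n} -> V) :
    \sum_(I in matroid xi) c I *: F I =
    \sum_(p : 'I_n * 'I_n) w p.1 p.2 *: F [set p.1; p.2]%SET.
  rewrite [RHS](partition_big (fun p => [set p.1; p.2]%SET) xpredT) //=.
  rewrite [RHS](bigID (fun I => I \in matroid xi)) /= [X in _ + X]big1 ?addr0.
    apply: eq_bigr => I _; rewrite scaler_suml.
    by apply: eq_bigr => p /eqP ->.
  move=> I Ixi; apply: big1 => p /eqP pI.
  have -> : w p.1 p.2 = 0; last by rewrite scale0r.
  apply/eqP; apply: contraNT Ixi => /wxi.
  by rewrite -pI matroid_pair.
exists c; split.
- by move=> I; apply: sumr_ge0.
- have := cE R^o (fun=> 1); rewrite (eq_bigr c) => [->|I _]; last exact: mulr1.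
  rewrite (eq_bigr (fun p => w p.1 p.2)) => [|p _]; last exact: mulr1.
  by rewrite -w1 pair_big.
- rewrite cE; apply/rowP => k; rewrite summxE wy.
  have e p : (w p.1 p.2 *: indicator_vector R [set p.1; p.2]%SET) 0 k =
      (if p.1 == k then w p.1 p.2 else 0) + (if p.2 == k then w p.1 p.2 else 0).
    rewrite !mxE !inE ![k == _]eq_sym; case: p => i j /=.
    have [->|ik] := eqVneq i k; have [->|jk] := eqVneq j k => /=;
      rewrite ?mulr1 ?mulr0 ?addr0 ?add0r //.
    have [->|/wxi] := eqVneq (w k k) 0; first by rewrite addr0.
    by rewrite bracketvv eqxx.
  rewrite (eq_bigr _ (fun p _ => e p)) big_split /=; congr (_ + _).
    rewrite -(pair_big xpredT xpredT (fun i j => if i == k then w i j else 0)) /=.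
    rewrite [RHS](bigD1 k) //= eqxx [X in _ + X]big1 ?addr0 // => i ik.
    by rewrite big1 // => j _; rewrite (negPf ik).
  rewrite -(pair_big xpredT xpredT (fun i j => if j == k then w i j else 0)) /=.
  apply: eq_bigr => i _.
  rewrite [RHS](bigD1 k) //= eqxx [X in _ + X]big1 ?addr0 // => j jk.
  by rewrite (negPf jk).
Qed.

(** As both sides have weight 1, the product of the two restrictions of y is a probability with
    marginals y. *)
Lemma two_point_polytope (p : pred 'I_n) y : (forall i, 0 < y 0 i) ->
  \sum_(i | p i) y 0 i = 1 -> \sum_(i | ~~ p i) y 0 i = 1 ->
  matroid_polytope (matroid (two_point C p)) y.
Proof.
move=> y0 yp yq.
apply: (pair_polytope (w := fun i j => if p i && ~~ p j then y 0 i * y 0 j else 0)).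
- by move=> i j; case: ifP => // _; rewrite mulr_ge0 // ltW.
- move=> i j; case: ifP => [/andP[pi pj] _|]; last by rewrite eqxx.
  by rewrite two_point_bracket pi (negPf pj).
- rewrite -yp [RHS]big_mkcond; apply: eq_bigr => i _.
  case: (p i) => /=; last by rewrite big1.
  by rewrite -big_mkcond /= -mulr_sumr yq mulr1.
- move=> k; case pk: (p k) => /=.
    rewrite -big_mkcond /= -mulr_sumr yq mulr1.
    by rewrite big1 ?addr0 // => i _; rewrite andbF.
  rewrite big1 // add0r (eq_bigr (fun i => if p i then y 0 i * y 0 k else 0)).
    by rewrite -big_mkcond -mulr_suml yp mul1r.
  by move=> i _; rewrite andbT.
Qed.

Lemma three_group_polytope xi y (g : 'I_n -> 'I_3) :
  (forall i, 0 < y 0 i) -> \sum_i y 0 i = 2 ->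
  (forall i j, bracket (xi i) (xi j) == 0 -> g i = g j) ->
  (forall a, 0 < \sum_(i | g i == a) y 0 i <= 1) ->
  matroid_polytope (matroid xi) y.
Proof.
move=> y0 y2 gxi gs; pose s a := \sum_(i | g i == a) y 0 i.
have s0 a : s a != 0 by have /andP[/gt_eqF -> _] := gs a.
have s2 : \sum_a s a = 2 by rewrite -y2 [RHS](partition_big g xpredT).
have s_ge (a b : 'I_3) : a != b -> 1 <= s a + s b.
  move=> ab; have : \sum_(d | (d != a) && (d != b)) s d <= 1.
    apply: (@le_trans _ _ (\sum_(d : 'I_3 | (d != a) && (d != b)) 1)).
      by apply: ler_sum => d _; have /andP[] := gs d.
    rewrite sumr_const (_ : #|_| = 1%N) //.
    have := cardC1 a; rewrite card_ord (cardD1 b (predC1 a)).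
    have -> : b \in predC1 a by rewrite /in_mem /= eq_sym.
    case=> e; rewrite -[RHS]e; apply: eq_card => d.
    by rewrite /in_mem /= /in_mem /= andbC.
  by move: s2; rewrite (bigD1 a) //= (bigD1 b) 1?eq_sym //=; lra.
(* Groups a and b share the mass [s a + s b - 1]: these masses have sum 1 over the three pairs, and
   sum [s a] over the two pairs containing a. The mass is spread in proportion to y and halved
   between the two orders. *)
pose w i j := if g i == g j then 0 else
  y 0 i * y 0 j * (s (g i) + s (g j) - 1) / (s (g i) * s (g j)) / 2.
have wC i j : w i j = w j i.
  by rewrite /w [g j == _]eq_sym; case: ifP => // _; rewrite [y 0 i * _]mulrC
    [s (g i) + _]addrC [s (g i) * _]mulrC.
have wsum k : \sum_j w k j = y 0 k / 2.
  rewrite (partition_big g xpredT) //= (bigD1 (g k)) //= big1 => [|j /eqP gj].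
    rewrite add0r.
    have e b : b != g k -> \sum_(j | g j == b) w k j =
        y 0 k / (2 * s (g k)) * (s (g k) + s b - 1).
      move=> bk; rewrite (eq_bigr (fun j =>
        y 0 k * (s (g k) + s b - 1) / (s (g k) * s b) / 2 * y 0 j)) => [|j /eqP gj].
        rewrite -mulr_sumr -/(s b).
        by have := s0 b; have := s0 (g k) => *; field; apply/andP.
      rewrite /w gj eq_sym (negPf bk).
      by have := s0 b; have := s0 (g k) => *; field; apply/andP.
    rewrite (eq_bigr _ e) -mulr_sumr.
    have -> : \sum_(b | b != g k) (s (g k) + s b - 1) = s (g k).
      have -> : \sum_(b | b != g k) (s (g k) + s b - 1) =
          (s (g k) - 1) *+ #|[pred b | b != g k]| + \sum_(b | b != g k) s b.
        rewrite -sumr_const -big_split /=; apply: eq_bigr => b _.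
        by rewrite addrAC.
      have -> : #|[pred b | b != g k]| = 2%N.
        by transitivity #|predC1 (g k)|; [apply: eq_card|rewrite cardC1 card_ord].
      by have := s2; rewrite (bigD1 (g k)) //= mulr2n; lra.
    by have := s0 (g k) => ?; field.
  by rewrite /w gj eqxx.
apply: (pair_polytope (w := w)).
- move=> i j; rewrite /w; case: eqP => // /eqP gij.
  have /andP[si _] := gs (g i); have /andP[sj _] := gs (g j).
  apply: divr_ge0 => //; apply: divr_ge0; last by rewrite ltW // mulr_gt0.
  apply: mulr_ge0; first by rewrite mulr_ge0 // ltW.
  by rewrite subr_ge0 s_ge.
- move=> i j; rewrite /w; have [_|gij _] := eqVneq (g i) (g j).
    by rewrite eqxx.
  by apply: contraNN gij => /gxi ->.
- by rewrite (eq_bigr _ (fun i _ => wsum i)) -mulr_suml y2 divff // pnatr_eq0.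
- move=> k; rewrite wsum (eq_bigr (w k)) => [|i _]; last exact: wC.
  by rewrite wsum; lra.
Qed.

(** The groups are a largest union [B] of classes of weight at most 1, one further class [K], and
    the rest. By maximality [B] and [K] weigh more than 1 together, so the rest weighs less than 1;
    strictness for [K] makes [B] and the rest positive. *)
Lemma stable_three_groups xi y : (forall i, 0 < y 0 i) -> \sum_i y 0 i = 2 ->
  stable (fun i => y 0 i) xi -> exists g : 'I_n -> 'I_3,
  (forall i j, bracket (xi i) (xi j) == 0 -> g i = g j) /\
  (forall a, 0 < \sum_(i | g i == a) y 0 i <= 1).
Proof.
move=> y0 y2 [xi0 st].
pose wt (B : {set 'I_n}) := \sum_(i in B) y 0 i.
pose ok (B : {set 'I_n}) := (wt B <= 1) &&
  [forall i in B, forall j, (bracket (xi i) (xi j) == 0) ==> (j \in B)].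
have ok0 : ok finset.set0.
  rewrite /ok /wt finset.big_set0 ler01; apply/forallP => i.
  by rewrite inE.
case: (@arg_maxnP _ finset.set0 ok (fun B => #|B|) ok0) => B /andP[wB clB] Bmax.
have {}clB i j : i \in B -> bracket (xi i) (xi j) == 0 -> j \in B.
  by move=> iB ij; have /forallP/(_ i) := clB;
    rewrite iB => /forallP/(_ j); rewrite ij.
have [k kB] : exists k, k \notin B.
  have [/existsP//|/existsPn H] := boolP [exists k, k \notin B].
  move: wB; rewrite /wt (eq_bigl xpredT) => [|i]; first by rewrite y2; lra.
  by have := H i; rewrite negbK.
pose K i := bracket (xi k) (xi i) == 0.
have KB i : K i -> i \notin B.
  by move=> ki; apply: contra kB => iB; apply: clB iB _; rewrite bracketC_eq0.
have KK i j : bracket (xi i) (xi j) == 0 -> K i = K j.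
  move=> ij; rewrite /K ![bracket (xi k) _ == 0]bracketC_eq0.
  exact: bracket_congl.
have wK : \sum_(i | K i) y 0 i < 1 by exact: st.
have wK0 : 0 < \sum_(i | K i) y 0 i.
  by rewrite (bigD1 k) /K ?bracketvv //= ltr_wpDr // sumr_ge0 // => i _; exact: ltW.
have wBK : 1 < wt B + \sum_(i | K i) y 0 i.
  rewrite ltNge; apply/negP => le1.
  pose B' := [set i | (i \in B) || K i]%SET.
  have wB' : wt B' = wt B + \sum_(i | K i) y 0 i.
    rewrite /wt (bigID (fun i => i \in B)) /=; congr (_ + _); apply: eq_bigl => i.
      by rewrite inE; case: (i \in B); rewrite ?andbF.
    by rewrite inE; have := KB i; case: (i \in B); case: (K i) => //= /(_ isT).
  have : ok B'.
    rewrite /ok wB' le1; apply/forallP => i; apply/implyP; rewrite inE => iB.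
    apply/forallP => j; apply/implyP => ij; rewrite inE -(KK i j) //.
    by case/orP: iB => [/clB/(_ ij) ->|->]; rewrite ?orbT.
  move/Bmax => le_card; have : (#|B'| <= #|B|)%N by [].
  rewrite leqNgt => /negP; apply; apply: proper_card.
  apply/properP; split; first by apply/fintype.subsetP => i iB; rewrite inE iB.
  by exists k; rewrite // inE /K bracketvv eqxx orbT.
pose g i : 'I_3 := if i \in B then inord 0 else if K i then inord 1 else inord 2.
have ne01 : (inord 0 == inord 1 :> 'I_3) = false by rewrite -val_eqE /= !inordK.
have ne02 : (inord 0 == inord 2 :> 'I_3) = false by rewrite -val_eqE /= !inordK.
have ne12 : (inord 1 == inord 2 :> 'I_3) = false by rewrite -val_eqE /= !inordK.
exists g; split=> [i j ij|a].
  rewrite /g (KK i j ij); congr (if _ then _ else _).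
  by apply/idP/idP => ?; [apply: (clB i)|apply: (clB j)]; rewrite // bracketC_eq0.
have s0 : \sum_(i | g i == inord 0) y 0 i = wt B.
  apply: eq_bigl => i; rewrite /g; case: ifP => _; first exact: eqxx.
  by case: ifP => _; rewrite eq_sym ?ne01 ?ne02.
have s1 : \sum_(i | g i == inord 1) y 0 i = \sum_(i | K i) y 0 i.
  apply: eq_bigl => i; rewrite /g; have := KB i; case: ifP => _ Ki.
    by rewrite ne01; case: (K i) Ki => // /(_ isT).
  by case: ifP => _; rewrite ?eqxx // eq_sym ne12.
have s2 : \sum_(i | g i == inord 2) y 0 i = 2 - wt B - \sum_(i | K i) y 0 i.
  rewrite -s0 -s1 -y2 [X in _ = X - _ - _](partition_big g xpredT) //=.
  rewrite !big_ord_recl big_ord0.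
  have -> : ord0 = inord 0 :> 'I_3 by apply/val_inj; rewrite /= inordK.
  have -> : lift (inord 0) ord0 = inord 1 :> 'I_3.
    by apply/val_inj; rewrite /= !inordK.
  have -> : lift (inord 0) (lift ord0 ord0) = inord 2 :> 'I_3.
    by apply/val_inj; rewrite /= !inordK.
  by lra.
have : a \in [:: inord 0; inord 1; inord 2].
  by rewrite !inE -!val_eqE /= !inordK //; case: a => [[|[|[|]]]].
by rewrite !inE => /or3P[] /eqP ->; rewrite ?s0 ?s1 ?s2; apply/andP; split; lra.
Qed.

Lemma matroid_polytope_sum (sigma : {set {set 'I_n}}) (D : {set 'I_n}) (a : R) x :
  (forall I, I \in sigma -> #|I :&: D|%:R = a) ->
  matroid_polytope sigma x -> \sum_(i in D) x 0 i = a.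
Proof.
move=> sD [c [c0 c1 ->]].
under eq_bigr do rewrite summxE.
rewrite exchange_big /= -[RHS]mul1r -c1 mulr_suml; apply: eq_bigr => I Is.
rewrite -(sD I Is).
under eq_bigr do rewrite !mxE.
rewrite -mulr_sumr; congr (_ * _).
rewrite -sum1_card natr_sum big_mkcond [RHS]big_mkcond /=; apply: eq_bigr => i _.
by rewrite !inE; case: (i \in I); case: (i \in D).
Qed.

Lemma affine_hull_sum (P : set 'rV[R]_n) (D : {set 'I_n}) (a : R) x :
  (forall y, P y -> \sum_(i in D) y 0 i = a) ->
  affine_hull P x -> \sum_(i in D) x 0 i = a.
Proof.
move=> PD [m [p [c [Pp c1 ->]]]].
under eq_bigr do rewrite summxE.
rewrite exchange_big /= -[RHS]mul1r -c1 mulr_suml; apply: eq_bigr => j _.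
rewrite -(PD (p j)) // mulr_sumr; apply: eq_bigr => i _.
by rewrite mxE.
Qed.

Lemma matroid_sum2 xi I : I \in matroid xi -> #|I| = 2.
Proof.
rewrite inE => /existsP[i /existsP[j /andP[ij /eqP ->]]].
by rewrite cards2; have [e|//] := eqVneq i j; move: ij; rewrite e bracketvv eqxx.
Qed.

Lemma pos_lower_bound (I : finType) (f : I -> R) : (forall i, 0 < f i) ->
  exists2 d, 0 < d & forall i, d <= f i.
Proof.
move=> f0; exists (\big[Order.min/1]_i f i).
  by apply: lt_bigmin => //; exact: ltr01.
by move=> i; exact: bigmin_le.
Qed.

Lemma near_box (P : set 'rV[R]_n) x e : 0 < e ->
  (forall y, (forall i, `|x 0 i - y 0 i| < e) -> P y) -> \forall y \near x, P y.
Proof.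
move=> e0 H; apply/nbhs_ballP; exists e => //= y [_ xy]; apply: H => i.
exact: (xy 0 i).
Qed.

Lemma near_sum_lt x (a : R) (D : pred 'I_n) e : 0 < e ->
  \sum_(i | D i) x 0 i + e * n%:R < a ->
  forall y, (forall i, `|x 0 i - y 0 i| < e) -> \sum_(i | D i) y 0 i < a.
Proof.
move=> e0 xa y xy; apply: le_lt_trans xa.
have -> : e * n%:R = \sum_(i < n) e by rewrite sumr_const card_ord mulr_natr.
rewrite [X in _ + X](bigID D) /= addrA -big_split /=.
apply: (@le_trans _ _ (\sum_(i | D i) (x 0 i + e))).
  by apply: ler_sum => i _; have := xy i; rewrite ltr_distl; lra.
by rewrite lerDl; apply: sumr_ge0 => i _; exact: ltW.
Qed.

Lemma relative_interior_sum2 xi x : matroid_polytope (matroid xi) x ->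
  (\forall y \near x, \sum_i (y : 'rV[R]_n) 0 i = 2 ->
     affine_hull (matroid_polytope (matroid xi)) y ->
     matroid_polytope (matroid xi) y) ->
  relative_interior (matroid_polytope (matroid xi)) x.
Proof.
move=> Px nx; split=> //; near=> y => hy.
have : \sum_(i in [set: 'I_n]%SET) y 0 i = 2.
  apply: affine_hull_sum hy => z; apply: matroid_polytope_sum => I Ixi.
  by rewrite finset.setIT (matroid_sum2 Ixi).
rewrite (eq_bigl xpredT) => [y2|i]; last by rewrite inE.
by move: y2 hy; near: y.
Unshelve. all: by end_near.
Qed.

(** Stability and positivity are open conditions on x, so nearby points of the hyperplane of sum 2
    lie in the polytope as well. *)
Lemma stable_relative_interior xi x : (forall i, 0 < x 0 i) ->
  \sum_i x 0 i = 2 -> stable (fun i => x 0 i) xi ->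
  relative_interior (matroid_polytope (matroid xi)) x.
Proof.
move=> x0 x2 st.
have inP y : (forall i, 0 < y 0 i) -> \sum_i y 0 i = 2 ->
    stable (fun i => y 0 i) xi -> matroid_polytope (matroid xi) y.
  move=> y0 y2 sty; have [g [gxi gs]] := stable_three_groups y0 y2 sty.
  exact: three_group_polytope gs.
apply: relative_interior_sum2; first exact: inP.
have [xi0 st1] := st.
have [d d0 dx] := pos_lower_bound x0.
have [|d' d'0 dx'] := @pos_lower_bound _ (fun i => 1 - cwt (fun i => x 0 i) xi i).
  by move=> i; rewrite subr_gt0.
(* Changing up to n coordinates by less than e moves a sum by less than either margin. *)
pose e := Order.min d d' / n.+1%:R.
have m0 : 0 < Order.min d d' by rewrite lt_min d0.
have e0 : 0 < e by rewrite divr_gt0.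
have en : e * n%:R < Order.min d d'.
  by rewrite /e mulrAC ltr_pdivrMr // ltr_pM2l // ltr_nat.
have ed : e <= d.
  apply: (@le_trans _ _ (Order.min d d')); last by rewrite ge_min lexx.
  by rewrite /e ler_pdivrMr // ler_peMr ?ler1n // ltW.
apply: (near_box e0) => y xy y2 _; apply: inP => // [i|].
  by have := xy i; have := dx i; rewrite ltr_distl; lra.
split=> // i; apply: near_sum_lt xy => //.
have := dx' i; have : Order.min d d' <= d' by rewrite ge_min lexx orbT.
by rewrite -/(cwt (fun i => x 0 i) xi i); lra.
Qed.

(** The affine hull keeps the sum over each side equal to 1, so near x only positivity is at
    stake. *)
Lemma two_point_relative_interior (p : pred 'I_n) x : (forall i, 0 < x 0 i) ->
  \sum_(i | p i) x 0 i = 1 -> \sum_(i | ~~ p i) x 0 i = 1 ->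
  relative_interior (matroid_polytope (matroid (two_point C p))) x.
Proof.
move=> x0 xp xq; split; first exact: two_point_polytope.
have [d d0 dx] := pos_lower_bound x0.
apply: (near_box d0) => y xy hy.
have card1 (q : pred 'I_n) (qE : q =1 p \/ q =1 predC p) I :
    I \in matroid (two_point C p) -> #|I :&: [set i | q i]%SET|%:R = 1 :> R.
  rewrite inE => /existsP[i /existsP[j /andP[+ /eqP ->]]].
  rewrite two_point_bracket => pij; rewrite (_ : #|_| = 1%N) //.
  have qij : q i = ~~ q j.
    case: qE => qE; rewrite !qE /=; move: pij; case: (p i); case: (p j) => //.
  have ij : i != j by apply/eqP => e; move: qij; rewrite e; case: (q j).
  case qj: (q j) qij => qi.
    rewrite (_ : _ :&: _ = [set j]%SET) ?cards1 //; apply/setP => k.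
    rewrite !inE; have [->|ki] /= := eqVneq k i; first by rewrite qi (negPf ij).
    by have [->|//] := eqVneq k j; rewrite qj.
  rewrite (_ : _ :&: _ = [set i]%SET) ?cards1 //; apply/setP => k.
  rewrite !inE; have [->|ki] /= := eqVneq k i; first by rewrite qi.
  by have [->|//] := eqVneq k j; rewrite qj.
have sumq (q : pred 'I_n) : q =1 p \/ q =1 predC p -> \sum_(i | q i) y 0 i = 1.
  move=> qE; rewrite (eq_bigl (fun i => i \in [set i | q i]%SET)) => [|i].
    apply: affine_hull_sum hy => z; apply: matroid_polytope_sum.
    exact: card1.
  by rewrite inE.
apply: two_point_polytope => [i||].
- by have := xy i; have := dx i; rewrite ltr_distl; lra.
- by apply: sumq; left.
- by apply: (sumq (predC p)); right.
Qed.

Lemma affine_hull_sub (P : set 'rV[R]_n) x : P x -> affine_hull P x.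
Proof.
move=> Px; exists 1%N, (fun=> x), (fun=> 1); split=> //.
  by rewrite big_ord1.
by rewrite big_ord1 scale1r.
Qed.

Lemma affine_hull_shift (P : set 'rV[R]_n) (a : R) x u v :
  affine_hull P x -> P u -> P v -> affine_hull P (x + a *: (u - v)).
Proof.
move=> [m [p [c [Pp c1 ->]]]] Pu Pv.
pose ins T (t : T) k (f : 'I_k -> T) (i : 'I_k.+1) := oapp f t (unlift ord0 i).
have ins0 T (t : T) k f : @ins T t k f ord0 = t by rewrite /ins unlift_none.
have insS T (t : T) k f i : @ins T t k f (lift ord0 i) = f i.
  by rewrite /ins liftK.
exists m.+2, (ins _ u _ (ins _ v _ p)), (ins _ a _ (ins _ (- a) _ c)); split.
- move=> i; case: (unliftP ord0 i) => [j|] ->; rewrite ?ins0 ?insS //.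
  by case: (unliftP ord0 j) => [l|] ->; rewrite ?ins0 ?insS.
- rewrite !big_ord_recl !(ins0, insS).
  by rewrite (eq_bigr c) => [|i _]; rewrite ?c1 ?addNKr // !insS.
- rewrite !big_ord_recl !(ins0, insS).
  rewrite [X in _ = _ + (_ + X)](eq_bigr (fun i => c i *: p i)) => [|i _].
    by rewrite scalerBr scaleNr [RHS]addrA addrC.
  by rewrite !insS.
Qed.

Lemma vertex_polytope (sigma : {set {set 'I_n}}) I : I \in sigma ->
  matroid_polytope sigma (indicator_vector R I).
Proof.
move=> Is; exists (fun J => (J == I)%:R); split.
- by move=> J; rewrite ler0n.
- by rewrite (bigD1 I) //= eqxx big1 ?addr0 // => J /andP[_ /negPf ->].
- rewrite (bigD1 I) //= eqxx scale1r big1 ?addr0 // => J /andP[_ /negPf ->].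
  by rewrite scale0r.
Qed.

Lemma hypersimplex_vertex (I : {set 'I_n}) : #|I| = 2 ->
  hypersimplex R n (indicator_vector R I).
Proof.
move=> I2; split=> [i|].
  by rewrite mxE; case: (i \in I); rewrite /= ?ler01 ?lexx.
have -> : 2 = #|I|%:R :> R by rewrite I2.
rewrite -sum1_card natr_sum [RHS]big_mkcond /=.
by apply: eq_bigr => i _; rewrite mxE; case: (i \in I).
Qed.

Lemma indicator_pairB (i j k : 'I_n) : k != i -> k != j ->
  indicator_vector R [set i; k]%SET - indicator_vector R [set j; k]%SET =
  delta_mx 0 i - delta_mx 0 j.
Proof.
move=> ki kj; apply/rowP => l; rewrite !mxE !inE eqxx /=.
have [->|lk] := eqVneq l k; last by rewrite !orbF.
by rewrite !orbT (negPf ki) (negPf kj) !subrr.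
Qed.

(** A relative interior point can be moved both ways along the difference of the vertices {i, k} and
    {j, k}, which changes coordinate i; the third index needs n at least 3. *)
Lemma hypersimplex_interior x i : (3 <= n)%N ->
  relative_interior (hypersimplex R n) x -> 0 < x 0 i < 1.
Proof.
move=> n3 [[x01 x2] /nbhs_ballP[e /= e0 xe]].
have [j [k [ji ki kj]]] : exists j k : 'I_n, [/\ j != i, k != i & k != j].
  have /finset.set0Pn[j jI] : [set~ i]%SET != finset.set0.
    by rewrite -card_gt0 cardsC1 card_ord; lia.
  have /finset.set0Pn[k] : ([set~ i] :\ j)%SET != finset.set0.
    have := cardsD1 j [set~ i]%SET; rewrite jI cardsC1 card_ord -card_gt0.
    by lia.
  by move: jI; rewrite !inE => ji /andP[kj ki]; exists j, k.
have shift a : `|a| < e -> 0 <= x 0 i + a <= 1.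
  move=> ae; pose y := x + a *: (indicator_vector R [set i; k]%SET -
                                 indicator_vector R [set j; k]%SET).
  have yE l : y 0 l = x 0 l + a * ((l == i)%:R - (l == j)%:R).
    by rewrite /y indicator_pairB // !mxE /=.
  have : hypersimplex R n y.
    apply: xe => [|].
      split=> // l m; rewrite ord1 /ball /= yE opprD addrA subrr sub0r normrN normrM.
      apply: le_lt_trans ae; rewrite ler_piMr // ler_norml.
      by case: (m == i); case: (m == j) => /=; lra.
    apply: affine_hull_shift; first by apply: affine_hull_sub.
      by apply: hypersimplex_vertex; rewrite cards2 eq_sym ki.
    by apply: hypersimplex_vertex; rewrite cards2 eq_sym kj.
  case=> /(_ i); rewrite yE eqxx [i == j]eq_sym (negPf ji) subr0 mulr1.
  by [].
have e2 : `|e / 2| < e by rewrite gtr0_norm; lra.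
have := shift (e / 2) e2; have := shift (- (e / 2)); rewrite normrN => /(_ e2).
lra.
Qed.

End MatroidPolytopes.

(** * Walls *)

Section ChamberWalls.
Variables (R : realType) (n : nat).
Implicit Types (x y : 'rV[R]_n).

Lemma stratum_matroid (C : fieldType) sigma (L : grassmannian C n) xi :
  spans L xi -> stratum sigma L -> sigma = matroid xi.
Proof.
move=> sL [s2 sP]; have [m2 mP] := spans_stratum sL.
apply/setP => I; have [/cards2P[i [j [ij ->]]]|I2] := boolP (#|I| == 2%N).
  have [ltij|ltji|/val_inj e] := ltngtP i j; last by rewrite e eqxx in ij.
    by rewrite -sP // -mP.
  by rewrite finset.setUC -sP // -mP.
by apply/idP/idP => [/s2|/m2] /eqP e; rewrite e in I2.
Qed.

Section Matroid.
Variables (C : fieldType) (xi : 'I_n -> 'rV[C]_2) (x : 'rV[R]_n).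
Hypotheses (Px : matroid_polytope (matroid xi) x) (x0 : forall i, 0 < x 0 i).

Lemma matroid_polytope_nonloop i : exists j, bracket (xi i) (xi j) != 0.
Proof.
have [/existsP//|/existsPn H] := boolP [exists j, bracket (xi i) (xi j) != 0].
have := x0 i; have -> : x 0 i = 0; last by rewrite ltxx.
have <- : \sum_(k in [set i]%SET) x 0 k = x 0 i by rewrite finset.big_set1.
apply: matroid_polytope_sum Px => I.
rewrite inE => /existsP[a /existsP[b /andP[ab /eqP ->]]].
rewrite (_ : _ :&: _ = finset.set0) ?cards0 //; apply/setP => k; rewrite !inE.
have [->|] := eqVneq k i; last by rewrite andbF.
rewrite andbT; apply/negP => /orP[] /eqP e; rewrite -e in ab.
  by have := H b; rewrite ab.
by have := H a; rewrite bracketC_eq0 ab.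
Qed.

(** Otherwise all points coincide with point i or point j. Each basis then meets the class of i
    exactly once, which puts x on the wall of that class. *)
Lemma no_wall_third : (forall S : {set 'I_n}, \sum_(i in S) x 0 i != 1) ->
  forall i j, exists k, (bracket (xi i) (xi k) != 0) && (bracket (xi j) (xi k) != 0).
Proof.
move=> nowall i j; have xi0 k : xi k != 0.
  have [l] := matroid_polytope_nonloop k; apply: contra_neq => ->.
  by rewrite /bracket !mxE !mul0r subrr.
have [/existsP//|/existsPn H] := boolP [exists k,
  (bracket (xi i) (xi k) != 0) && (bracket (xi j) (xi k) != 0)].
have {}H k : (bracket (xi i) (xi k) == 0) || (bracket (xi j) (xi k) == 0).
  by have := H k; rewrite negb_and !negbK.
have [l il] := matroid_polytope_nonloop i.
have jl : bracket (xi j) (xi l) == 0 by have := H l; rewrite (negPf il).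
have ij : bracket (xi i) (xi j) != 0.
  by apply: contra il => ij; apply: bracket_trans ij jl.
pose S := [set k | bracket (xi i) (xi k) == 0]%SET.
have /eqP[] := nowall S; apply: matroid_polytope_sum Px => I.
rewrite inE => /existsP[a /existsP[b /andP[ab /eqP ->]]].
have aS : (b \in S) = (a \notin S).
  rewrite !inE; have [ia|ia] /= := boolP (bracket (xi i) (xi a) == 0).
    apply: contraNF ab => ib; apply: bracket_trans ib => //.
    by rewrite bracketC_eq0.
  have ja : bracket (xi j) (xi a) == 0 by have := H a; rewrite (negPf ia).
  have [//|jb] := orP (H b).
  have := ab; rewrite (bracket_trans (xi0 a) (xi0 j) (xi0 b)) //.
  by rewrite bracketC_eq0.
have nab : a != b by apply: contraTneq ab => ->; rewrite bracketvv eqxx.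
have [aI|aI] := boolP (a \in S).
  rewrite (_ : _ :&: _ = [set a]%SET) ?cards1 //; apply/setP => k.
  rewrite finset.in_setI finset.in_set2 finset.in_set1.
  have [->|ka] /= := eqVneq k a; first by rewrite aI.
  by have [->|//] := eqVneq k b; rewrite aS aI.
rewrite (_ : _ :&: _ = [set b]%SET) ?cards1 //; apply/setP => k.
rewrite finset.in_setI finset.in_set2 finset.in_set1.
have [->|ka] /= := eqVneq k a; first by rewrite (negPf aI) (negPf nab).
by have [->|//] := eqVneq k b; rewrite aS aI.
Qed.

(** The directions e_i - e_0 span the hyperplane, and each is a difference of the vertices {i, k}
    and {0, k}, with k from [no_wall_third]. *)
Lemma no_wall_affine_hull : (forall S : {set 'I_n}, \sum_(i in S) x 0 i != 1) ->
  forall y, \sum_i y 0 i = 2 -> affine_hull (matroid_polytope (matroid xi)) y.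
Proof.
move=> nowall y y2; have n0 : (0 < n)%N.
  by rewrite lt0n; apply/eqP => n0; move: y2; rewrite big1 => [|i]; [lra|
    have := ltn_ord i; rewrite {2}n0].
pose i0 := Ordinal n0.
have x2 : \sum_i x 0 i = 2.
  rewrite (eq_bigl (fun i => i \in [set: 'I_n]%SET)) => [|i]; last by rewrite inE.
  apply: matroid_polytope_sum Px => I Ixi.
  by rewrite finset.setIT (matroid_sum2 Ixi).
have yE : y = x + \sum_i (y 0 i - x 0 i) *: (delta_mx 0 i - delta_mx 0 i0).
  under eq_bigr do rewrite scalerBr; rewrite sumrB -scaler_suml sumrB y2 x2 subrr.
  rewrite scale0r subr0; under eq_bigr do rewrite scalerBl; rewrite sumrB.
  by rewrite -!row_sum_delta addrC subrK.
rewrite yE; elim: (index_enum _) => [|i r IH].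
  by rewrite big_nil addr0; apply: affine_hull_sub.
rewrite big_cons addrA addrAC; have [k /andP[ik i0k]] := no_wall_third nowall i i0.
have ne a b : bracket (xi a) (xi b) != 0 -> b != a.
  by move=> ab; apply: contraTneq ab => ->; rewrite bracketvv eqxx.
rewrite -(@indicator_pairB _ _ i i0 k) ?ne //.
by apply: affine_hull_shift => //; apply: vertex_polytope; rewrite matroid_pair.
Qed.

End Matroid.

Lemma no_wall_chamber_open (omega : {set {set {set 'I_n}}}) x :
  is_chamber R omega -> chamber R omega x -> (forall i, 0 < x 0 i) ->
  (forall S : {set 'I_n}, \sum_(i in S) x 0 i != 1) ->
  \forall y \near x, \sum_i (y : 'rV[R]_n) 0 i = 2 -> chamber R omega y.
Proof.
move=> [adm _ _] xch x0 nowall.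
have : \forall y \near x, forall sigma : {set {set 'I_n}}, sigma \in omega ->
    \sum_i (y : 'rV[R]_n) 0 i = 2 -> relative_interior (matroid_polytope sigma) y.
  apply: (@filter_forall _ _ (fun sigma (y : 'rV[R]_n) => sigma \in omega ->
    \sum_i y 0 i = 2 -> relative_interior (matroid_polytope sigma) y) (nbhs x) _) => sigma.
  have [so|so] := boolP (sigma \in omega); last by apply: nearW.
  have [Px nx] := xch _ so.
  have [L sL] := adm _ so; have [xi spL] := spans_basis L.
  have sE := stratum_matroid spL sL; rewrite sE in Px nx *.
  have nx' := near_join nx.
  near=> y => _ y2; split; last by near: y.
  have : affine_hull (matroid_polytope (matroid xi)) y.
    exact: (no_wall_affine_hull Px).
  by near: y.
apply: filterS => y H y2 sigma so; exact: H.
Unshelve. all: by end_near.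
Qed.

(** The chamber contains a ball of the hyperplane of sum 2, hence n - 1 independent differences. *)
Lemma no_wall_dim (omega : {set {set {set 'I_n}}}) x : (0 < n)%N ->
  is_chamber R omega -> chamber R omega x -> (forall i, 0 < x 0 i) ->
  \sum_i x 0 i = 2 ->
  (forall S : {set 'I_n}, \sum_(i in S) x 0 i != 1) ->
  (n.-1 <= affine_dim (chamber R omega))%N.
Proof.
move=> n0 ch xch x0 x2 nowall.
have /nbhs_ballP[e /= e0 xe] := no_wall_chamber_open ch xch x0 nowall.
have ltn : (n.-1 < n.+1)%N by lia.
rewrite /affine_dim; apply: (bigop.bigmax_sup (Ordinal ltn)) => //=.
apply/asboolP.
have nE : n = n.-1.+1 by rewrite prednK.
pose i0 := Ordinal n0.
pose up (i : 'I_n.-1) : 'I_n := cast_ord (esym nE) (lift ord0 i).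
have up0 i : up i != i0 by rewrite -val_eqE.
exists (\matrix_i ((e / 2) *: (delta_mx 0 (up i) - delta_mx 0 i0))).
  apply/row_freeP; exists ((e / 2)^-1 *: \matrix_(j, i) (j == up i)%:R).
  apply/matrixP => i j; rewrite -scalemxAr mxE mxE.
  rewrite (bigD1 (up j)) //= !mxE /= !eqxx big1 => [|k kj]; last first.
    by rewrite !mxE (negPf kj) mulr0.
  rewrite subr0 addr0 mulr1 mulrA mulVf ?mul1r //.
    by congr (_%:R); rewrite eq_sym -!val_eqE /= /bump /= !add1n eqSS.
  by rewrite mulf_neq0 ?invr_eq0 ?pnatr_eq0 // gt_eqF.
move=> i; exists (x + (e / 2) *: (delta_mx 0 (up i) - delta_mx 0 i0)), x; split=> //.
  apply: xe.
    split=> // a b; rewrite ord1 /ball /= !mxE /=.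
    rewrite opprD addrA subrr sub0r normrN normrM gtr0_norm ?divr_gt0 //.
    apply: (@le_lt_trans _ _ (e / 2)); last by rewrite ltr_pdivrMr // ltr_pMr // ltr1n.
    apply: ler_piMr; first by rewrite ltW // divr_gt0.
    by rewrite ler_norml; case: (b == up i); case: (b == i0) => /=; lra.
  under eq_bigr do rewrite !mxE /=.
  rewrite big_split /= x2 -mulr_sumr sumrB.
  have sum1 (j : 'I_n) : \sum_k (k == j)%:R = 1 :> R.
    by rewrite (bigD1 j) //= eqxx big1 ?addr0 // => b /negPf ->.
  by rewrite !sum1 subrr mulr0 addr0.
by rewrite rowK addrAC subrr add0r.
Qed.

End ChamberWalls.

(** * Cross-ratio coordinates *)

Section LocalCoordinates.
Variables (C : numFieldType) (n : nat) (sg : 'I_n -> bool) (a b c : 'I_n).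
Local Notation gen := ('I_n * 'I_n * 'I_n * 'I_n)%type.

(** With a, b, c at 0, 1, oo, the points near c need the chart at infinity; exchanging a and c
    inverts the coordinate. [sg] selects the chart. *)
Definition coord_gen (i : 'I_n) : gen := if sg i then (a, b, c, i) else (c, b, a, i).

Definition coord (X : marked_curve C n) (i : 'I_n) : 'rV[C]_2 :=
  if sg i then row2 (cross_ratio (a, b, c, i) X) 1
  else row2 1 (cross_ratio (c, b, a, i) X).

Definition coord_expr (i : 'I_n) : gexpr C gen * gexpr C gen :=
  if sg i then (GGen C (a, b, c, i), GConst _ 1)
  else (GConst _ 1, GGen C (c, b, a, i)).

Definition bracket_expr (i j : 'I_n) : gexpr C gen :=
  gsub (GMul (coord_expr i).1 (coord_expr j).2)
       (GMul (coord_expr i).2 (coord_expr j).1).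

Lemma coord_ceq X : genus0_curve X ->
  (forall i, cross_ratio_dom (coord_gen i) X) ->
  exists2 v, median X a b c = Some v & ceq (contraction v) (coord X).
Proof.
move=> gX dX; have [v m] : exists v, median X a b c = Some v.
  have := dX a; rewrite /coord_gen /cross_ratio_dom.
  case: (sg a); rewrite ?(median_swap X a b c) //;
  by case: (median X a b c) => // v; exists v.
have m' : median X c b a = Some v by rewrite median_swap.
have [ab bc ac] := medianP m; rewrite /separates in ab bc ac.
set xi := contraction v in ab bc ac *.
have ba : bracket (xi b) (xi a) != 0 by rewrite bracketC_eq0.
exists v => //.
(* The projective map taking a, b, c to 0, 1, oo. *)
pose g : 'M[C]_2 := \matrix_(k, l)
  if l == 0 then (if k == 0 then xi a 0 1 else - xi a 0 0) * bracket (xi b) (xi c)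
  else (if k == 0 then xi c 0 1 else - xi c 0 0) * bracket (xi b) (xi a).
have gE u : u *m g = row2 (bracket u (xi a) * bracket (xi b) (xi c))
                          (bracket u (xi c) * bracket (xi b) (xi a)).
  apply: row2_eq; rewrite mul_rV2E !mxE /= [bracket u _]bracketE; ring.
exists g.
  rewrite unitmx2 /det2 !mxE /=.
  have -> : xi a 0 1 * bracket (xi b) (xi c) * (- xi c 0 0 * bracket (xi b) (xi a))
    - xi c 0 1 * bracket (xi b) (xi a) * (- xi a 0 0 * bracket (xi b) (xi c)) =
    bracket (xi b) (xi c) * bracket (xi b) (xi a) * bracket (xi a) (xi c).
    by rewrite [bracket (xi a) (xi c)]bracketE; ring.
  by rewrite !mulf_neq0.
move=> i; rewrite gE; have := dX i; rewrite /coord_gen /coord.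
case: (sg i) => /=.
  rewrite m => ic; rewrite /separates -/xi in ic.
  exists (bracket (xi i) (xi c) * bracket (xi b) (xi a))^-1.
    by rewrite invr_eq0 mulf_neq0.
  by apply: row2_eq; rewrite !(mxE, row2E) /= -?/xi; field; rewrite ic ba.
rewrite m' => ia; rewrite /separates -/xi in ia.
exists (bracket (xi i) (xi a) * bracket (xi b) (xi c))^-1.
  by rewrite invr_eq0 mulf_neq0.
by apply: row2_eq; rewrite !(mxE, row2E) /= -?/xi; field; rewrite ia bc.
Qed.

Variables (T : Type) (h : T -> marked_curve C n).
Local Notation dom := (fun s t => cross_ratio_dom s (h t)).
Local Notation val := (fun s t => cross_ratio s (h t)).

Lemma bracket_expr_defined i j t :
  (forall i, cross_ratio_dom (coord_gen i) (h t)) ->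
  gdefined dom (bracket_expr i j) t.
Proof.
move=> H; have := H i; have := H j.
rewrite /coord_gen /bracket_expr /coord_expr.
by case: (sg i); case: (sg j) => /= *; do !split.
Qed.

Lemma bracket_expr_eval i j t :
  geval val (bracket_expr i j) t = bracket (coord (h t) i) (coord (h t) j).
Proof.
rewrite /bracket_expr geval_gsub /coord_expr /coord /bracket.
by case: (sg i); case: (sg j); rewrite !row2E /=.
Qed.

(** An expression 0 * s + 1 has the value 1 but is defined only where the generator s is: it turns a
    domain condition into a basic open set. *)
Definition coord_nbhd (Q : rel 'I_n) : gexpr C gen :=
  GMul (gprod (enum 'I_n) (fun i =>
          GAdd (GMul (GConst _ 0) (GGen C (coord_gen i))) (GConst _ 1)))
       (gprod [seq q <- enum {: 'I_n * 'I_n} | Q q.1 q.2]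
          (fun q => bracket_expr q.1 q.2)).

Lemma coord_nbhdP Q t : gbasic dom val (coord_nbhd Q) t <->
  (forall i, cross_ratio_dom (coord_gen i) (h t)) /\
  (forall i j, Q i j -> bracket (coord (h t) i) (coord (h t) j) != 0).
Proof.
split.
  move=> /gbasic_mul[/gbasic_prod D /gbasic_prod N].
  have D' i : cross_ratio_dom (coord_gen i) (h t).
    by have [|[[]]] := D i; rewrite ?mem_enum.
  split=> // i j qij; have [|_] := N (i, j).
    by rewrite mem_filter qij mem_enum.
  by rewrite bracket_expr_eval.
move=> [D N]; apply/gbasic_mul; split; apply/gbasic_prod.
  move=> i _; split; first by split=> //; split=> //; exact: D.
  by rewrite /= mul0r add0r oner_eq0.
move=> [i j]; rewrite mem_filter => /andP[/= qij _].
split; first exact: bracket_expr_defined.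
by rewrite bracket_expr_eval N.
Qed.

End LocalCoordinates.

Lemma gdefined_comp (C : fieldType) (T T' S : Type) (dom : S -> set T')
    (h : T -> T') (e : gexpr C S) t :
  gdefined (fun s t => dom s (h t)) e t <-> gdefined dom e (h t).
Proof. by elim: e => [a|s|e1 ? e2 ?|e1 ? e2 ?] /=; tauto. Qed.

Lemma geval_comp (C : fieldType) (T T' S : Type) (val : S -> T' -> C)
    (h : T -> T') (e : gexpr C S) t :
  geval (fun s t => val s (h t)) e t = geval val e (h t).
Proof. by elim: e => //= e1 -> e2 ->. Qed.

(** * The reduction morphism *)

Section Morphism.
Variables (C : numFieldType) (R : realType) (n : nat).
Variables (omega : {set {set {set 'I_n}}}) (x : 'rV[R]_n).
Hypothesis n_ge3 : (3 <= n)%N.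
Hypothesis omegaP : forall sigma, admissible C sigma ->
  relative_interior (matroid_polytope sigma) x -> sigma \in omega.
Hypotheses (x_gt0 : forall i, 0 < x 0 i) (x_lt1 : forall i, x 0 i < 1).
Hypothesis x_sum : \sum_i x 0 i = 2.
Variables (A : 'I_n -> rat) (p q : 'I_n -> 'I_n).
Hypotheses (wA : weight_data A) (pK : cancel p q) (qK : cancel q p).

(* Marked points and coordinates of the Grassmannian are matched by p. *)
Let y (i : 'I_n) : R := x 0 (q i).

Hypothesis y_dom : forall D : pred 'I_n,
  \sum_(i | D i) A i <= 1 -> \sum_(i | D i) y i <= 1.

Let y_gt0 i : 0 < y i. Proof. exact: x_gt0. Qed.
Let y_lt1 i : y i < 1. Proof. exact: x_lt1. Qed.

Let reindex_y (D : pred 'I_n) : \sum_(i | D i) y i = \sum_(j | D (p j)) x 0 j.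
Proof.
rewrite (reindex p) /=; last by apply: onW_bij; exists q.
by apply: eq_bigr => j _; rewrite /y pK.
Qed.

Let y_sum : \sum_i y i = 2.
Proof. by rewrite reindex_y x_sum. Qed.

Local Notation curve := {X : marked_curve C n | stable_curve A X}.
Local Notation union := (strata_union C omega).
Local Notation cdom := (fun s (X : curve) => cross_ratio_dom s (sval X)).
Local Notation cval := (fun s (X : curve) => cross_ratio s (sval X)).
Local Notation pdom := (fun (s : ('I_n * 'I_n) * ('I_n * 'I_n)) (L : union) =>
  plucker (sval L) s.2.1 s.2.2 != 0).
Local Notation pval := (fun (s : ('I_n * 'I_n) * ('I_n * 'I_n)) (L : union) =>
  plucker (sval L) s.1.1 s.1.2 / plucker (sval L) s.2.1 s.2.2).
Local Notation ciso := (fun X Y : curve => curve_iso (sval X) (sval Y)).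
Local Notation torb := (fun L L' : union => torus_orbit (sval L) (sval L')).

Let genus0 (X : curve) : genus0_curve (sval X).
Proof. by case: X => X []. Qed.

Lemma ciso_equivalence : equivalence_prop ciso.
Proof.
split=> [X|X Y|X Y Z]; first exact: curve_iso_refl.
  exact: curve_iso_sym.
exact: curve_iso_trans.
Qed.

Lemma torb_equivalence : equivalence_prop torb.
Proof.
have [r s t] := torus_orbit_equivalence C n.
by split=> [L|L L'|L L' L'']; [apply: r|apply: s|apply: t].
Qed.

Lemma realize xi :
  relative_interior (matroid_polytope (matroid (xi \o p))) x ->
  exists L : union, spans (sval L) (xi \o p).
Proof.
move=> rx; have [[c [_ c1 _]] _] := rx.
(* Coefficients with sum 1 require some basis, so the columns span the line's ambient plane. *)
have [/existsP[I Im]|/existsPn no] := boolP [exists I, I \in matroid (xi \o p)];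
    last first.
  by move: c1; rewrite big_pred0 => [/esym/eqP|I];
    [rewrite oner_eq0|apply/negbTE].
move: Im; rewrite inE => /existsP[i /existsP[j /andP[ij _]]].
have [L sL] := spans_exists ij; have st := spans_stratum sL.
suff Lw : exists2 sigma, sigma \in omega & stratum sigma L.
  by exists (exist _ L Lw).
exists (matroid (xi \o p)) => //; apply: omegaP => //.
by exists L.
Qed.

Lemma stable_realize xi : stable y xi ->
  exists L : union, spans (sval L) (xi \o p).
Proof.
move=> [xi0 st]; apply: realize; apply: stable_relative_interior => //.
split=> [j|j]; first exact: xi0.
by have := st (p j); rewrite /cwt reindex_y.
Qed.

Lemma two_point_realize (r : pred 'I_n) : \sum_(i | ~~ r i) y i = 1 ->
  exists L : union, spans (sval L) (two_point C r \o p).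
Proof.
move=> r1; apply: realize.
have -> : two_point C r \o p = two_point C (r \o p) by [].
apply: two_point_relative_interior => //=; rewrite -?(reindex_y (fun i => ~~ r i)) //.
by have := y_sum; rewrite (bigID r) /= r1 reindex_y; lra.
Qed.

Lemma limit_realize (X : marked_curve C n) xi : curve_limit y X xi ->
  exists L : union, spans (sval L) (xi \o p).
Proof.
move=> [v [_ [[st ->]|[c cw ->]]]]; first exact: stable_realize.
apply: two_point_realize; rewrite -[RHS]cw.
by apply: eq_bigl => i; rewrite negbK.
Qed.

Lemma limit_model_exists (X : curve) : exists (L : union) xi,
  curve_limit y (sval X) xi /\ spans (sval L) (xi \o p).
Proof.
have [xi Hxi] := curve_limit_exists (proj2_sig X) y_sum y_dom.
by have [L sL] := limit_realize Hxi; exists L, xi.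
Qed.

(** An arbitrary choice of plane; only its torus orbit is determined by the curve. *)
Definition model (X : curve) : union := sval (cid (limit_model_exists X)).

Lemma modelP X : exists xi,
  curve_limit y (sval X) xi /\ spans (sval (model X)) (xi \o p).
Proof. by rewrite /model; case: cid. Qed.

Lemma ceq_comp (xi xi' : 'I_n -> 'rV[C]_2) (r : 'I_n -> 'I_n) :
  ceq xi xi' -> ceq (xi \o r) (xi' \o r).
Proof. by case=> g gu H; exists g; [exact: gu|move=> i; exact: (H (r i))]. Qed.

Lemma model_torb X (L : union) xi : curve_limit y (sval X) xi ->
  spans (sval L) (xi \o p) -> torb (model X) L.
Proof.
move=> Hxi sL; have [xi' [Hxi' sX]] := modelP X.
apply/(torus_orbitP sX sL)/ceq_comp.
exact: (curve_limit_uniq (proj2_sig X) y_gt0 y_sum).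
Qed.

Lemma model_iso X Y : ciso X Y -> torb (model X) (model Y).
Proof.
move=> XY; have [xi [Hxi sX]] := modelP X; have [zeta [Hz sY]] := modelP Y.
have [xi' Hxi' e] := curve_limit_iso (genus0 X) (genus0 Y) XY Hxi.
apply/(torus_orbitP sX sY)/ceq_comp; apply: ceq_trans e _.
exact: (curve_limit_uniq (proj2_sig Y) y_gt0 y_sum).
Qed.

Lemma spans_ratio (L : union) zeta (s : ('I_n * 'I_n) * ('I_n * 'I_n)) :
  spans (sval L) zeta ->
  (pdom s L <-> bracket (zeta s.2.1) (zeta s.2.2) != 0) /\
  pval s L = bracket (zeta s.1.1) (zeta s.1.2) / bracket (zeta s.2.1) (zeta s.2.2).
Proof.
move=> sL; have [d d0 pl] := spans_plucker sL.
rewrite !pl mulf_eq0 negb_or d0 /=; split=> //.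
by rewrite -mulf_div divff // mul1r.
Qed.

(** * The local lift near a given curve *)

Section LocalModel.
Variables (X0 : curve) (v0 : 'I_(ncomp (sval X0))) (a b c : 'I_n).
Hypotheses (ab0 : separates v0 a b) (bc0 : separates v0 b c)
  (ac0 : separates v0 a c).
Let sg i := separates v0 i c.
Local Notation z X := (coord sg a b c (sval X)).
Local Notation dX X := (forall i, cross_ratio_dom (coord_gen sg a b c i) (sval X)).

Let med0 : median (sval X0) a b c = Some v0.
Proof. by apply: median_eq. Qed.

Let med0' : median (sval X0) c b a = Some v0.
Proof. by rewrite median_swap. Qed.

Let sg_sep i j : ~~ sg i -> sg j -> separates v0 i j.
Proof.
rewrite /sg /separates !negbK => ic jc; apply: contra jc => ij.
apply: (@bracket_trans _ _ (contraction v0 i)); rewrite ?contraction_neq0 //.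
by rewrite bracketC_eq0.
Qed.

Let dom0 : dX X0.
Proof.
move=> i; rewrite /coord_gen; case: ifP => ic /=; first by rewrite med0.
rewrite med0'; apply: sg_sep; first by rewrite ic.
exact: ac0.
Qed.

Let coord_ceq0 : ceq (contraction v0) (z X0).
Proof.
by have [v] := coord_ceq (genus0 X0) dom0; rewrite med0 => -[<-].
Qed.

Let rho (s : ('I_n * 'I_n) * ('I_n * 'I_n)) :=
  (bracket_expr C sg a b c (p s.1.1) (p s.1.2),
   bracket_expr C sg a b c (p s.2.1) (p s.2.2)).

Let bev i j (X : curve) :
  geval cval (bracket_expr C sg a b c i j) X = bracket (z X i) (z X j).
Proof. exact: (@bracket_expr_eval C n sg a b c curve (@sval _ _)). Qed.

Let bdef i j (X : curve) : dX X -> gdefined cdom (bracket_expr C sg a b c i j) X.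
Proof. exact: (@bracket_expr_defined C n sg a b c curve (@sval _ _)). Qed.

Let nbhdP (Q : rel 'I_n) (X : curve) :
  gbasic cdom cval (coord_nbhd C sg a b c Q) X <->
  dX X /\ (forall i j, Q i j -> bracket (z X i) (z X j) != 0).
Proof. exact: (@coord_nbhdP C n sg a b c curve (@sval _ _)). Qed.

Let gratio_rho s (X : curve) : gratio cval (rho s) X =
  bracket (z X (p s.1.1)) (z X (p s.1.2)) / bracket (z X (p s.2.1)) (z X (p s.2.2)).
Proof. by rewrite /gratio; congr (_ / _); exact: bev. Qed.

(** The cross-ratio coordinates are a representative themselves, so all weights are zero and the
    translates constant. *)
Lemma local_lift_stable : stable y (contraction v0) ->
  local_lift cdom cval pdom pval torb model X0.
Proof.
move=> st0; have stz : stable y (z X0) := stable_ceq coord_ceq0 st0.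
have [t0' st0'] := stable_realize stz.
pose Q i j := bracket (z X0 i) (z X0 j) != 0.
have pd s : pdom s t0' -> Q (p s.2.1) (p s.2.2).
  by move=> ds; apply/(spans_ratio s st0').1.
have lim (X : curve) xi : ceq (contraction (X := sval X) xi) (z X) -> stable y (z X) ->
    forall L : union, spans (sval L) (z X \o p) -> torb (model X) L.
  move=> e stX L sL; have stv := stable_ceq (ceq_sym e) stX.
  have [zeta [Hz sX]] := modelP X.
  apply/(torus_orbitP sX sL)/ceq_comp; apply: ceq_trans e.
  apply: (curve_limit_uniq (proj2_sig X) y_gt0 y_sum Hz).
  exists xi; split; last by left.
  by case: stv => ? w; split=> // i; exact: ltW.
exists (coord_nbhd C sg a b c Q), t0', (fun=> 1%N), rho; split.
- exact/nbhdP.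
- exact: lim coord_ceq0 stz _ st0'.
- move=> s X ds /nbhdP[dX N].
  split; first exact: bdef.
  split; first exact: bdef.
  by rewrite bev N // pd.
- move=> s ds; split=> //=.
  by rewrite gratio_rho (spans_ratio s st0').2.
- move=> X /nbhdP[dX N]; right=> l l0.
  have [v m e] := coord_ceq (genus0 X) dX.
  have stX : stable y (z X).
    split=> i; first by apply: ceq_neq0 e _; exact: contraction_neq0.
    (* The neighbourhood keeps the nonzero brackets nonzero, so classes can only shrink and
       stability persists. *)
    apply: le_lt_trans (stz.2 i); rewrite /cwt [X in _ <= X](bigID
      (fun j => bracket (z X i) (z X j) == 0)) /=.
    rewrite (eq_bigl (fun j => (bracket (z X0 i) (z X0 j) == 0) &&
        (bracket (z X i) (z X j) == 0))) => [|j]; last first.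
      case: eqP => [ij|]; rewrite ?andbF ?andbT //; apply/esym/negPn/negP => /N.
      by rewrite ij eqxx.
    by rewrite lerDl; apply: sumr_ge0 => j _; exact: ltW.
  have [t' st'] := stable_realize stX; exists t'; first exact: lim e stX _ st'.
  move=> s ds; split.
    by apply/(spans_ratio s st').1; apply: N; exact: pd.
  by rewrite gratio_rho (spans_ratio s st').2 expr1.
Qed.

Let coord_at (X : curve) : dX X ->
  [/\ z X c = row2 1 0, z X a = row2 0 1 & z X b = row2 1 1].
Proof.
move=> dXX; have [v m _] := coord_ceq (genus0 X) dXX.
have m' : median (sval X) c b a = Some v by rewrite median_swap.
have [ab bc ac] := medianP m; rewrite /separates in ab bc ac.
have sc : sg c = false by rewrite /sg /separates bracketvv eqxx.
rewrite /coord sc [sg a]ac0 [sg b]bc0.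
rewrite !(cross_ratio_contraction _ m) (cross_ratio_contraction _ m').
rewrite !bracketvv !mul0r; split=> //.
have ba : bracket (contraction v b) (contraction v a) != 0 by rewrite bracketC_eq0.
by congr row2; rewrite [X in X / _]mulrC divff // mulf_neq0.
Qed.

Let coord_sg (X : curve) i : sg i -> z X i 0 1 = 1.
Proof. by rewrite /coord => ->; rewrite row2E. Qed.

Let coord_nsg (X : curve) i : ~~ sg i -> z X i 0 0 = 1.
Proof. by rewrite /coord => /negPf ->; rewrite row2E. Qed.

(** The one-parameter group multiplies a bracket by l to the number of its indices in the class of
    c, minus 1. Denominators nonzero at the limit have one index on each side, hence factor 1. *)
Let weight (s : ('I_n * 'I_n) * ('I_n * 'I_n)) := ((~~ sg (p s.1.1)) + (~~ sg (p s.1.2)))%N.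

Let cross i j := sg i != sg j.

(** If the class of c sits at infinity, a bracket between it and a finite point no longer depends on
    the finite coordinate, and agrees with that of the two-point configuration. *)
Let two_point_weight (t0' : union) (X : curve) :
  spans (sval t0') (two_point C sg \o p) ->
  (forall i, sg i -> z X i 0 1 = 1) ->
  (forall i, ~~ sg i -> z X i = row2 1 0) ->
  lift_limit cval pdom pval t0' weight rho X.
Proof.
move=> st0' z1 z0 s ds.
have [[d1 _] ->] := spans_ratio s st0'; have := d1 ds.
rewrite gratio_rho two_point_bracket => nlm.
have crossE i j : sg i != sg j -> bracket (z X i) (z X j) =
    bracket (two_point C sg i) (two_point C sg j).
  rewrite /two_point; case si: (sg i); case sj: (sg j) => // _.
    by rewrite (z0 j) ?sj // /bracket !row2E z1 // !mulr1 !mulr0.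
  by rewrite (z0 i) ?si // /bracket !row2E z1 // !mul1r !mul0r.
rewrite [bracket (z X (p s.2.1)) _]crossE // /weight /=.
case si: (sg (p s.1.1)); case sj: (sg (p s.1.2)) => /=; split=> //.
- by rewrite /two_point si sj bracketvv mul0r.
- by rewrite crossE ?si ?sj.
- by rewrite crossE ?si ?sj.
- by rewrite /two_point si sj bracketvv mul0r.
- move=> _; apply: etrans (bev (p s.1.1) (p s.1.2) X) _.
  by rewrite !z0 ?si ?sj // bracketvv.
Qed.

(** The neighbourhood asks that no point of the class of c meet a point outside it. Nearby classes
    then lie within one of two sets of weight 1, so every nearby configuration is semistable. *)
Lemma local_lift_strict : semistable y (contraction v0) ->
  cwt y (contraction v0) c = 1 ->
  local_lift cdom cval pdom pval torb model X0.
Proof.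
move=> ss0 cw.
have Kw : \sum_(i | ~~ sg i) y i = 1.
  by rewrite -[RHS]cw; apply: eq_bigl => i; rewrite /sg /separates negbK bracketC_eq0.
have Kw' : \sum_(i | sg i) y i = 1.
  by have := y_sum; rewrite (bigID sg) /= Kw; lra.
have [t0' st0'] := two_point_realize Kw.
have pd s : pdom s t0' -> cross (p s.2.1) (p s.2.2).
  move=> ds; have := (spans_ratio s st0').1.1 ds.
  by rewrite two_point_bracket.
have z0_degenerate i : ~~ sg i -> z X0 i = row2 1 0.
  move=> si; have [zc _ _] := coord_at dom0.
  apply: row2_eq; rewrite row2E; first exact: coord_nsg.
  have : bracket (z X0 i) (z X0 c) == 0.
    by rewrite (ceq_bracket _ _ coord_ceq0); move: si; rewrite /sg /separates negbK.
  by rewrite zc /bracket !row2E mulr0 mulr1 sub0r oppr_eq0 => /eqP.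
have par_sg (X : curve) i j : (forall i j, cross i j -> bracket (z X i) (z X j) != 0) ->
    bracket (z X i) (z X j) == 0 -> sg j = sg i.
  move=> N ij; have [//|sij] := eqVneq (sg j) (sg i).
  by have := N i j; rewrite ij /cross eq_sym sij => /(_ isT).
have class_sg (X : curve) i : (forall i j, cross i j -> bracket (z X i) (z X j) != 0) ->
    cwt y (z X) i <= 1 /\ (cwt y (z X) i = 1 ->
      forall j, sg j = sg i -> bracket (z X i) (z X j) == 0).
  move=> N; have [|j ij|le1 eq1] := @class_subset _ _ _ _ y_gt0 (z X) i (fun j => sg j == sg i).
  - by case: (sg i); [rewrite -[RHS]Kw'|rewrite -[RHS]Kw]; apply: eq_bigl => j;
      case: (sg j).
  - by rewrite (par_sg X i j).
  - by split=> // /eq1 H j sij; apply: H; rewrite sij.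
have model_degenerate (X : curve) : dX X ->
    (forall i j, cross i j -> bracket (z X i) (z X j) != 0) ->
    (forall i, ~~ sg i -> z X i = row2 1 0) -> torb (model X) t0'.
  move=> dXX N deg; have [v m e] := coord_ceq (genus0 X) dXX.
  have par i : (bracket (contraction v c) (contraction v i) == 0) = ~~ sg i.
    rewrite -(ceq_bracket _ _ e); have [zc _ _] := coord_at dXX.
    case si: (sg i) => /=; last by rewrite zc deg ?si // bracketvv eqxx.
    apply/negbTE/N; rewrite /cross si /sg /separates bracketvv eqxx.
    by [].
  apply: model_torb st0'; exists v; split.
    split=> [i|i]; first exact: contraction_neq0.
    by rewrite -(cwt_ceq y i e); case: (class_sg X i N).
  right; exists c; last by apply: two_point_ext => i; rewrite par negbK.
  by rewrite /cwt -[RHS]Kw; apply: eq_bigl => i; rewrite par.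
have cross0 i j : cross i j -> bracket (z X0 i) (z X0 j) != 0.
  rewrite (ceq_bracket _ _ coord_ceq0) /cross => ij.
  case si: (sg i) ij; case sj: (sg j) => // _.
    by rewrite bracketC_eq0; apply: sg_sep; rewrite ?sj.
  by apply: sg_sep; rewrite ?si.
exists (coord_nbhd C sg a b c cross), t0', weight, rho; split.
- exact/nbhdP.
- exact: model_degenerate.
- move=> s X ds /nbhdP[dXX N].
  split; first exact: bdef.
  split; first exact: bdef.
  by rewrite bev N // pd.
- by apply: (two_point_weight st0') => // i si; rewrite coord_sg.
- move=> X /nbhdP[dXX N].
  (* If the class of c stays together, the limit is still [t0']. Otherwise neither side is a single
     class, since a and b remain apart, and the configuration is stable. *)
  have [deg|ndeg] := pselect (forall i, ~~ sg i -> z X i = row2 1 0).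
    left; split; first exact: model_degenerate.
    by apply: (two_point_weight st0') => // i si; rewrite coord_sg.
  right=> l l0; have [zc za zb] := coord_at dXX.
  have [v m e] := coord_ceq (genus0 X) dXX.
  have zX0 i : z X i != 0 by apply: ceq_neq0 e _; exact: contraction_neq0.
  have stX : stable y (z X).
    split=> // i; have [le1 eq1] := class_sg X i N.
    rewrite lt_neqAle le1 andbT; apply/negP => /eqP /eq1 H.
    have [si|si] := boolP (sg i).
      have : bracket (z X a) (z X b) == 0.
        by apply: (class_eq (c := i)) => //; apply: H; rewrite si; [exact: ac0|exact: bc0].
      by rewrite za zb /bracket !row2E mul0r mul1r sub0r oppr_eq0 oner_eq0.
    apply: ndeg => j sj; have : bracket (z X j) (z X c) == 0.
      apply: (class_eq (c := i)) => //; apply: H.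
        by rewrite (negPf si) (negPf sj).
      by rewrite (negPf si) /sg /separates bracketvv eqxx.
    rewrite zc /bracket !row2E mulr0 mulr1 sub0r oppr_eq0 => /eqP zj1.
    by apply: row2_eq; rewrite row2E // coord_nsg.
  (* The projective map diag(1, l), followed by dividing the finite points by l, so that brackets
     between the two sides are unchanged. *)
  pose zl i := if sg i then row2 (z X i 0 0 / l) 1 else row2 1 (l * z X i 0 1).
  have ezl : ceq (z X) zl.
    exists (\matrix_(i, j) (if i == j then if i == 0 then 1 else l else 0)).
      by rewrite unitmx2 /det2 !mxE /= mulr0 subr0 mul1r.
    have gE i : z X i *m (\matrix_(i, j) (if i == j then if i == 0 then 1 else l else 0))
        = row2 (z X i 0 0) (l * z X i 0 1).
      by apply: row2_eq; rewrite mul_rV2E !mxE /=; ring.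
    move=> i; rewrite gE /zl; have [si|si] := boolP (sg i).
      rewrite coord_sg // mulr1.
      exists l^-1; rewrite ?invr_eq0 //; apply: row2_eq; rewrite !(mxE, row2E) /=.
        by rewrite mulrC.
      by rewrite mulVf.
    by exists 1; rewrite ?oner_eq0 // coord_nsg // scale1r.
  have stl := stable_ceq ezl stX.
  have [t' st'] := stable_realize stl; exists t'.
    have stv := stable_ceq (ceq_sym e) stX.
    have [zeta [Hz sX]] := modelP X.
    apply/(torus_orbitP sX st')/ceq_comp; apply: ceq_trans (ceq_trans e ezl).
    apply: (curve_limit_uniq (proj2_sig X) y_gt0 y_sum Hz).
    exists v; split; last by left.
    by case: stv => ? w; split=> // i; exact: ltW.
  have brl i j : l * bracket (zl i) (zl j) =
      l ^+ (~~ sg i + ~~ sg j) * bracket (z X i) (z X j).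
    rewrite /zl /bracket; case si: (sg i); case sj: (sg j); rewrite !row2E /=.
    - by rewrite (@coord_sg X i) // (@coord_sg X j) // expr0; field.
    - by rewrite (@coord_sg X i) // (@coord_nsg X j) ?sj // expr1; field.
    - by rewrite (@coord_sg X j) // (@coord_nsg X i) ?si // expr1; field.
    - by rewrite (@coord_nsg X i) ?si // (@coord_nsg X j) ?sj // expr2; ring.
  move=> s ds; have clm := pd s ds; split.
    apply/(spans_ratio s st').1; rewrite /= (ceq_bracket _ _ ezl).
    exact: N.
  rewrite gratio_rho (spans_ratio s st').2 /=.
  have -> : bracket (zl (p s.2.1)) (zl (p s.2.2)) =
      bracket (z X (p s.2.1)) (z X (p s.2.2)).
    apply: (mulfI l0); rewrite brl; move: clm; rewrite /cross.
    by case: (sg _); case: (sg _) => //= _; rewrite expr1.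
  by rewrite mulrA brl -mulrA.
Qed.

End LocalModel.

Lemma local_lift_model X0 : local_lift cdom cval pdom pval torb model X0.
Proof.
have [xi [[v0 [ss H]] _]] := modelP X0.
(* In the strictly semistable case c must come from a class of weight 1; a and b are then free. *)
have pick c : exists a b,
    [/\ separates v0 a b, separates v0 b c & separates v0 a c].
  have [b /andP[bc _]] := third_class wA (proj2_sig X0) v0 c c.
  have [a /andP[ab ac]] := third_class wA (proj2_sig X0) v0 b c.
  by exists a, b.
case: H => [[st _]|[c cw _]].
  have n0 : (0 < n)%N by lia.
  have [a [b [ab bc ac]]] := pick (Ordinal n0).
  exact: (local_lift_stable ab bc ac).
have [a [b [ab bc ac]]] := pick c.
exact: (local_lift_strict ab bc ac).
Qed.

Local Notation HS := (hassett_space C A).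
Local Notation PS := (parameter_space C omega).

Definition reduction (K : HS) : PS :=
  to_class torb (model (sval (cid (to_class_surj K)))).

Lemma reductionE X : reduction (to_class ciso X) = to_class torb (model X).
Proof.
rewrite /reduction; case: cid => Y /= /(to_class_eq ciso_equivalence) XY.
apply/(to_class_eq torb_equivalence)/model_iso.
exact: curve_iso_sym.
Qed.

Lemma reduction_morphism_on (U : set HS) (V : set PS) : zopen U ->
  (forall X : curve, U (to_class ciso X) -> V (to_class torb (model X))) ->
  morphism_on U V reduction.
Proof.
move=> Uo UV; apply: (quotient_morphism_on torb_equivalence Uo _ UV) => X _.
  exact: reductionE.
exact: local_lift_model.
Qed.

(** * The loci of distinct points and the inverse map *)

Definition generic_curve (X : curve) :=
  exists v, generic_config (contraction (X := sval X) v).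

Lemma generic_curve_iso X Y : ciso X Y -> generic_curve X -> generic_curve Y.
Proof.
move=> [f [g [bf gu fa fn fm]]] [v gv]; exists (f v) => i j ij.
rewrite (ceq_bracket _ _ (curve_iso_contraction (genus0 X) (genus0 Y) bf gu fa fn fm v)).
exact: gv.
Qed.

Lemma generic_stable (xi : 'I_n -> 'rV[C]_2) : generic_config xi -> stable y xi.
Proof.
move=> gxi; apply: generic_config_stable => //.
by apply: generic_config_neq0 gxi; lia.
Qed.

Lemma generic_model (X : curve) v : generic_config (contraction (X := sval X) v) ->
  exists2 xi, ceq (contraction (X := sval X) v) xi &
    spans (sval (model X)) (xi \o p).
Proof.
move=> gv; have [xi [Hxi sX]] := modelP X; exists xi => //.
have stv := generic_stable gv.
apply: (curve_limit_uniq (proj2_sig X) y_gt0 y_sum) Hxi.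
exists v; split; last by left.
by case: stv => ? w; split=> // i; exact: ltW.
Qed.

Definition generic_plane (L : union) :=
  forall i j, i != j -> plucker (sval L) i j != 0.

Lemma generic_planeP (L : union) xi : spans (sval L) (xi \o p) ->
  generic_plane L <-> generic_config xi.
Proof.
move=> sL; have [d d0 pl] := spans_plucker sL; split=> gL i j ij.
  have qij : q i != q j by rewrite (can_eq qK).
  by have := gL _ _ qij; rewrite pl /= !qK mulf_eq0 (negPf d0).
by rewrite pl mulf_neq0 //= gL // (can_eq pK).
Qed.

Lemma spans_comp (L : union) : exists xi, spans (sval L) (xi \o p).
Proof.
have [xi sL] := spans_basis (sval L); exists (xi \o q).
have -> // : (xi \o q) \o p = xi.
by apply/funext => i /=; rewrite pK.
Qed.

Lemma ceq_comp_inv (xi xi' : 'I_n -> 'rV[C]_2) :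
  ceq (xi \o p) (xi' \o p) -> ceq xi xi'.
Proof.
move=> /(ceq_comp q) [g gu H]; exists g => // i; have := H i.
by rewrite /= !qK.
Qed.

Lemma generic_plane_torb L L' : torb L L' -> generic_plane L -> generic_plane L'.
Proof.
have [xi sL] := spans_comp L; have [xi' sL'] := spans_comp L'.
move=> /(torus_orbitP sL sL')/ceq_comp_inv e /(generic_planeP sL) g.
by apply/(generic_planeP sL') => i j ij; rewrite (ceq_bracket _ _ e) g.
Qed.

Let U : set HS := [set K | exists2 X, K = to_class ciso X & generic_curve X].
Let V : set PS := [set K | exists2 L, K = to_class torb L & generic_plane L].

Let UE X : U (to_class ciso X) <-> generic_curve X.
Proof.
split=> [[Y /(to_class_eq ciso_equivalence) XY gY]|gX]; last by exists X.
by apply: generic_curve_iso gY; apply: curve_iso_sym.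
Qed.

Let VE L : V (to_class torb L) <-> generic_plane L.
Proof.
split=> [[L' /(to_class_eq torb_equivalence) LL' gL']|gL]; last by exists L.
have [_ sym _] := torb_equivalence.
exact: generic_plane_torb (sym _ _ LL') gL'.
Qed.

Let i0 : 'I_n := Ordinal (leq_trans (isT : 0 < 3) n_ge3)%N.
Let i1 : 'I_n := Ordinal (leq_trans (isT : 1 < 3) n_ge3)%N.
Let i2 : 'I_n := Ordinal (leq_trans (isT : 2 < 3) n_ge3)%N.

(** In the coordinate with [i0], [i1], [i2] at 0, 1, oo, definedness says that a point differs from
    [i2], and nonzero differences say that the finite points are distinct. *)
Lemma zopen_generic_curve : zopen U.
Proof.
move=> X /UE[v gv].
have sep i j : i != j -> separates v i j by exact: gv.
pose e (i : 'I_n) : gexpr C ('I_n * 'I_n * 'I_n * 'I_n) := GGen C (i0, i1, i2, i).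
have med (Y : curve) w : separates w i0 i1 -> separates w i1 i2 ->
    separates w i0 i2 -> median (sval Y) i0 i1 i2 = Some w.
  by move=> *; apply: median_eq.
pose rs := [seq x <- enum {: 'I_n * 'I_n} | [&& x.1 != x.2, x.1 != i2 & x.2 != i2]].
exists (gprod rs (fun x => gsub (e x.1) (e x.2))).
  apply/gbasic_prod => -[i j]; rewrite mem_filter => /andP[/and3P[/= ij i2' j2'] _].
  have mX : median (sval X) i0 i1 i2 = Some v by apply: med; apply: sep.
  split; first by rewrite /= mX; do !split; apply: sep.
  rewrite geval_gsub /= /cross_ratio mX.
  set xi := contraction v; have b10 : bracket (xi i1) (xi i0) != 0 by apply: gv.
  have b12 : bracket (xi i1) (xi i2) != 0 by apply: gv.
  have bi2 : bracket (xi i) (xi i2) != 0 by apply: gv.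
  have bj2 : bracket (xi j) (xi i2) != 0 by apply: gv.
  have b02 : bracket (xi i0) (xi i2) != 0 by apply: gv.
  have bij : bracket (xi i) (xi j) != 0 by apply: gv.
  have -> : bracket (xi i) (xi i0) * bracket (xi i1) (xi i2) /
      (bracket (xi i) (xi i2) * bracket (xi i1) (xi i0)) -
    bracket (xi j) (xi i0) * bracket (xi i1) (xi i2) /
      (bracket (xi j) (xi i2) * bracket (xi i1) (xi i0)) =
    bracket (xi i1) (xi i2) * (bracket (xi i) (xi i0) * bracket (xi j) (xi i2) -
      bracket (xi i) (xi i2) * bracket (xi j) (xi i0)) /
    (bracket (xi i) (xi i2) * bracket (xi j) (xi i2) * bracket (xi i1) (xi i0)).
    by field; rewrite bi2 bj2 b10.
  rewrite bracket_decomposition.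
  by rewrite !(mulf_neq0, invr_eq0).
move=> Y /gbasic_prod H; apply/UE.
have [w mY] : exists w, median (sval Y) i0 i1 i2 = Some w.
  have [|[d _] _] := H (i0, i1); first by rewrite mem_filter mem_enum.
  by move: d => /=; case: median => // w _; exists w.
have [w01 w12 w02] := medianP mY; exists w.
have fin i : i != i2 -> separates w i i2.
  (* Any pair containing i will do: its factor forces the coordinate of i to be defined. *)
  move=> i2'; have [k [ki k2]] : exists k, k != i /\ k != i2.
    have [->|ii0] := eqVneq i i0; first by exists i1.
    by exists i0; rewrite eq_sym.
  have [|[d _] _] := H (i, k).
    by rewrite mem_filter /= eq_sym ki i2' k2 mem_enum.
  by move: d; rewrite /= mY.
move=> i j ij; have [e2|i2'] := eqVneq i i2.
  by rewrite e2 bracketC_eq0; apply: fin; rewrite -e2 eq_sym.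
have [->|j2'] := eqVneq j i2; first exact: fin.
have [|_] := H (i, j); first by rewrite mem_filter /= ij i2' j2' mem_enum.
rewrite geval_gsub /= /cross_ratio mY => ne; apply: contra ne => bij.
have [k k0 ->] := (bracket_eq0 (contraction_neq0 (genus0 Y) w i)
  (contraction_neq0 (genus0 Y) w j)).1 bij.
have b10 : bracket (contraction w i1) (contraction w i0) != 0.
  by rewrite bracketC_eq0.
have bi2 : bracket (contraction w i) (contraction w i2) != 0 := fin i i2'.
by rewrite !bracketZl; apply/eqP; field; rewrite k0 b10 bi2.
Qed.

Lemma zdense_generic_curve : zdense U.
Proof.
move=> W Wo [K WK]; have [X KX] := to_class_surj K; rewrite KX in WK.
have [e eX eW] := Wo X WK.
have eX' : gbasic (@cross_ratio_dom C n) (@cross_ratio C n) e (sval X).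
  case: eX => d ev; split; first exact/(gdefined_comp (@cross_ratio_dom C n) (@sval _ _)).
  by rewrite -(geval_comp (@cross_ratio C n) (@sval _ _) e X).
have [|z [z0 gz [d ev]]] := smooth_dense wA (proj2_sig X) _ eX'; first by lia.
pose Z : curve := exist _ _ (smooth_stable wA z0 gz).
exists (to_class ciso Z); split.
  apply: eW; split; first exact/(gdefined_comp (@cross_ratio_dom C n) (@sval _ _)).
  by rewrite (geval_comp (@cross_ratio C n) (@sval _ _) e Z).
apply/UE; exists ord0 => i j ij.
by rewrite !contraction_smooth gz.
Qed.

Let eV : gexpr C (('I_n * 'I_n) * ('I_n * 'I_n)) :=
  gprod [seq x <- enum {: 'I_n * 'I_n} | x.1 != x.2]
    (fun x => GGen C (x, (i0, i1))).

Let eVP L : gbasic pdom pval eV L <-> generic_plane L.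
Proof.
split=> [/gbasic_prod H i j ij|gL].
  have [|_ /=] := H (i, j); first by rewrite mem_filter ij mem_enum.
  by rewrite mulf_eq0 negb_or => /andP[].
apply/gbasic_prod => -[i j]; rewrite mem_filter => /andP[/= ij _].
by split; rewrite /= ?mulf_neq0 ?invr_eq0 // gL.
Qed.

Lemma zopen_generic_plane : zopen V.
Proof. by move=> L /VE gL; exists eV => [|L' /eVP gL']; [exact/eVP|exact/VE]. Qed.

(** Perturbing the columns makes them distinct. Distinct points are stable, as every coordinate of x
    is below 1, so the perturbed planes stay in the union of strata. *)
Lemma zdense_generic_plane : zdense V.
Proof.
move=> W Wo [K WK]; have [L0 KL] := to_class_surj K; rewrite KL in WK.
have [e eL eW] := Wo L0 WK; have [xi sL0] := spans_comp L0.
have /choice[P PE] (u : 'I_n * 'I_n) : exists P : {poly C}, (u.1 != u.2 -> P != 0) /\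
    forall t, bracket (perturb xi t u.1) (perturb xi t u.2) = P.[t].
  have [e12|ne] := eqVneq u.1 u.2; last first.
    by have [P [? _ ?]] := perturb_bracket xi ne; exists P.
  by exists 0; split=> // t; rewrite e12 bracketvv horner0.
pose D := \prod_(u : 'I_n * 'I_n | u.1 != u.2) P u.
have D0 : D != 0 by apply/prodf_neq0 => u /(PE u).1.
have gD t : D.[t] != 0 -> generic_config (perturb xi t).
  rewrite horner_prod => /prodf_neq0 H i j ij.
  by rewrite (PE (i, j)).2; exact: (H (i, j)).
have /choice[Lt LtE] t : exists L : union, D.[t] != 0 ->
    spans (sval L) (perturb xi t \o p).
  have [_|/gD/generic_stable/stable_realize[L sL]] := eqVneq D.[t] 0.
    by exists L0.
  by exists L.
have [|t [t0 Dt et]] := gbasic_specialization (x := Lt) D0 _ eL.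
  move=> s ds; exists (P (p s.1.1, p s.1.2)), (P (p s.2.1, p s.2.2)).
  have p0 i : perturb xi 0 i = xi i by rewrite /perturb scale0r addr0.
  have [[d1 _] ->] := spans_ratio s sL0.
  rewrite -!(PE _).2 !p0; split=> //; first exact: d1.
  move=> t t0 Dt qt; have [[_ d2] ->] := spans_ratio s (LtE t Dt).
  rewrite !(PE (_, _)).2 /=; split=> //; apply: d2.
  by rewrite /= (PE (_, _)).2.
exists (to_class torb (Lt t)); split; first exact: eW.
by apply/VE/(generic_planeP (LtE t Dt)); exact: gD.
Qed.

(** The condition stands inside the existential to make the choice a total function; other planes
    receive the fixed curve marked at the points (1, i). *)
Lemma smooth_model_exists (L : union) : exists X : curve, generic_plane L ->
  exists z, [/\ spans (sval L) (z \o p), generic_config z &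
    sval X = smooth_curve z].
Proof.
have n1 : (1 < n)%N by lia.
have smooth z : generic_config z -> stable_curve A (smooth_curve (C := C) z).
  by move=> gz; apply: smooth_stable => //; exact: generic_config_neq0.
have [gL|ngL] := pselect (generic_plane L).
  have [z sL] := spans_comp L; have gz := (generic_planeP sL).1 gL.
  by exists (exist _ _ (smooth z gz)) => _; exists z.
pose w (i : 'I_n) : 'rV[C]_2 := row2 1 i%:R.
have gw : generic_config w.
  move=> i j ij; rewrite /bracket !row2E mul1r mulr1 subr_eq0 eqr_nat.
  by rewrite eq_sym.
by exists (exist _ _ (smooth w gw)) => /ngL.
Qed.

Definition smooth_model (L : union) : curve := sval (cid (smooth_model_exists L)).

Lemma smooth_modelP L : generic_plane L -> exists z,
  [/\ spans (sval L) (z \o p), generic_config z &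
    sval (smooth_model L) = smooth_curve z].
Proof. by rewrite /smooth_model; case: cid. Qed.

Lemma smooth_model_torb L L' : generic_plane L -> torb L L' ->
  ciso (smooth_model L) (smooth_model L').
Proof.
move=> gL LL'; have gL' := generic_plane_torb LL' gL.
have [z [sL gz ->]] := smooth_modelP gL.
have [z' [sL' gz' ->]] := smooth_modelP gL'.
exact/smooth_curve_ceq/ceq_comp_inv/(torus_orbitP sL sL').
Qed.

(** A cross-ratio is a quotient of products of Plücker coordinates, here all divided by the one of
    [i0], [i1], because the generators are quotients of two coordinates. *)
Lemma local_lift_smooth_model L0 : generic_plane L0 ->
  local_lift pdom pval cdom cval ciso smooth_model L0.
Proof.
move=> gL0; pose P i j := GGen C ((q i, q j), (i0, i1)).
pose rho (s : 'I_n * 'I_n * 'I_n * 'I_n) := let: (a, b, c, i) := s in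
  (GMul (P i a) (P b c), GMul (P i c) (P b a)).
have labels s : cdom s (smooth_model L0) -> let: (a, b, c, i) := s in
    [/\ a != b, b != c, a != c & i != c].
  have [z [_ _ ->]] := smooth_modelP gL0.
  move: s => [[[a b] c] i]; rewrite /cross_ratio_dom.
  case m: (median _ a b c) => [v|] // ic; have [ab bc ac] := medianP m.
  have ne j l : separates (X := smooth_curve z) v j l -> j != l.
    by apply: contraTneq => ->; rewrite /separates bracketvv eqxx.
  by split; apply: ne.
have val s L : generic_plane L -> cdom s (smooth_model L0) ->
    [/\ cdom s (smooth_model L), cval s (smooth_model L) = gratio pval (rho s) L,
        gdefined pdom (rho s).1 L & gbasic pdom pval (rho s).2 L].
  move=> gL /labels; have [z [sL gz ->]] := smooth_modelP gL.
  move: s => [[[a b] c] i] [ab bc ac ic].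
  have z0 : forall i, z i != 0 by apply: generic_config_neq0 gz; lia.
  have [d ->] := smooth_cross_ratio z0 (gz _ _ ab) (gz _ _ bc) (gz _ _ ac) (gz _ _ ic).
  have PE j l : pval ((q j, q l), (i0, i1)) L =
      bracket (z j) (z l) / bracket (z (p i0)) (z (p i1)).
    by rewrite (spans_ratio _ sL).2 /= !qK.
  have b01 : bracket (z (p i0)) (z (p i1)) != 0 by apply: gz; rewrite (can_eq pK).
  have ba : bracket (z b) (z a) != 0 by apply: gz; rewrite eq_sym.
  have bic := gz _ _ ic.
  have pl01 : plucker (sval L) i0 i1 != 0 by apply: gL.
  rewrite /gratio /rho /gbasic /= in PE *; rewrite !PE; split=> //.
    by field; rewrite ba b01 bic.
  by split=> //; rewrite !mulf_neq0 ?invr_eq0.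
exists eV, (smooth_model L0), (fun=> 1%N), rho; split.
- exact/eVP.
- exact: curve_iso_refl.
- by move=> s L ds /eVP gL; have [_ _ ? ?] := val s L gL ds.
- by move=> s ds; have [_ -> _ _] := val s L0 gL0 ds.
- move=> L /eVP gL; right=> l l0; exists (smooth_model L) => [|s ds].
    exact: curve_iso_refl.
  by have [? -> _ _] := val s L gL ds; rewrite expr1.
Qed.

Definition reduction_inverse (K : PS) : HS :=
  to_class ciso (smooth_model (sval (cid (to_class_surj K)))).

Lemma reduction_inverseE L : generic_plane L ->
  reduction_inverse (to_class torb L) = to_class ciso (smooth_model L).
Proof.
move=> gL; rewrite /reduction_inverse.
case: cid => L' /= /(to_class_eq torb_equivalence) LL'.
apply/(to_class_eq ciso_equivalence).
have [_ sym _] := ciso_equivalence.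
by apply: sym; apply: smooth_model_torb.
Qed.

Lemma generic_model_plane X : generic_curve X -> generic_plane (model X).
Proof.
move=> [v gv]; have [xi e sX] := generic_model gv.
by apply/(generic_planeP sX) => i j ij; rewrite (ceq_bracket _ _ e) gv.
Qed.

Lemma smooth_model_generic L : generic_plane L -> generic_curve (smooth_model L).
Proof.
move=> gL; have [z [sL gz e]] := smooth_modelP gL.
rewrite /generic_curve e; exists ord0 => i j ij.
by rewrite !contraction_smooth gz.
Qed.

Lemma smooth_modelK X : generic_curve X -> ciso (smooth_model (model X)) X.
Proof.
move=> gX; have [v gv] := gX; have [xi e sX] := generic_model gv.
have [z [sX' gz ->]] := smooth_modelP (generic_model_plane gX).
apply: curve_iso_sym.
have iso := curve_iso_smooth wA (proj2_sig X) gv.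
have e' : ceq (contraction v) z.
  by apply: ceq_trans e _; apply/ceq_comp_inv/(spans_ceq sX sX').
apply: curve_iso_trans iso (smooth_curve_ceq e'); first exact: genus0.
  by apply: smooth_genus0 => i; exact: contraction_neq0.
by apply: smooth_genus0; apply: generic_config_neq0 gz; lia.
Qed.

Lemma modelK L : generic_plane L -> torb (model (smooth_model L)) L.
Proof.
move=> gL; have [z [sL gz e]] := smooth_modelP gL.
apply: model_torb sL; have stz := generic_stable gz.
have cz v : contraction (X := smooth_curve z) v = z.
  by apply/funext => i; rewrite contraction_smooth.
rewrite e; exists ord0; rewrite cz; split; last by left.
by case: stz => ? w; split=> // i; exact: ltW.
Qed.

Lemma reduction_birational : birational_morphism reduction.
Proof.
split.
  by apply: reduction_morphism_on => //; exact: zopen_setT_quotient.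
exists U, V, reduction_inverse; split.
- by split; [exact: zopen_generic_curve|exact: zdense_generic_curve].
- by split; [exact: zopen_generic_plane|exact: zdense_generic_plane].
- apply: reduction_morphism_on; first exact: zopen_generic_curve.
  by move=> X /UE gX; apply/VE/generic_model_plane.
- apply: (quotient_morphism_on (F := smooth_model) ciso_equivalence).
  + exact: zopen_generic_plane.
  + by move=> L /VE; exact: reduction_inverseE.
  + by move=> L /VE gL; apply/UE/smooth_model_generic.
  + by move=> L /VE; exact: local_lift_smooth_model.
split=> K.
- have [X ->] := to_class_surj K => /UE gX.
  rewrite reductionE reduction_inverseE; last exact: generic_model_plane.
  exact/(to_class_eq ciso_equivalence)/smooth_modelK.
- have [L ->] := to_class_surj K => /VE gL.
  rewrite reduction_inverseE // reductionE.
  exact/(to_class_eq torb_equivalence)/modelK.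
Qed.

End Morphism.

(** * Choice of the wall *)

(** A set of sum 1 has at least two elements since each coordinate is below 1. This applies to [S]
    and to its complement, and gives the bounds on k. *)
Lemma wall_of_small_chamber (R : realType) (n : nat)
    (omega : {set {set {set 'I_n}}}) (x : 'rV[R]_n) : (3 <= n)%N ->
  is_chamber R omega -> chamber R omega x -> (forall i, 0 < x 0 i < 1) ->
  \sum_i x 0 i = 2 -> (affine_dim (chamber R omega) <= n - 2)%N ->
  exists S : {set 'I_n}, [/\ \sum_(i in S) x 0 i = 1, (1 < #|S|)%N & (1 < #|~: S|)%N].
Proof.
move=> n3 ch xch x01 x2 dim.
have [/existsP[S /eqP xS]|/existsPn nowall] :=
    boolP [exists S : {set 'I_n}, \sum_(i in S) x 0 i == 1]; last first.
  have x0 i : 0 < x 0 i by case/andP: (x01 i).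
  by have := no_wall_dim (ltnW (ltnW n3)) ch xch x0 x2 nowall; lia.
have card (D : {set 'I_n}) : \sum_(i in D) x 0 i = 1 -> (1 < #|D|)%N.
  move=> xD; have [|] := ltnP 1 #|D| => // D1; move: xD.
  have [D0|D0] := posnP #|D|.
    by move/eqP: D0; rewrite cards_eq0 => /eqP ->; rewrite finset.big_set0; lra.
  have /eqP/cards1P[i ->] : #|D| = 1%N by lia.
  by rewrite finset.big_set1; have /andP[_] := x01 i; lra.
exists S; split=> //; first exact: card.
apply: card; move: x2; rewrite (bigID (mem S)) /= xS.
rewrite [X in _ + X = _ -> _](eq_bigl (fun i => i \in ~: S)) => [|i]; last first.
  by rewrite inE.
lra.
Qed.

Lemma numbering (n : nat) (S : {set 'I_n}) : exists p q : 'I_n -> 'I_n,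
  [/\ cancel p q, cancel q p & forall j, (p j < #|S|)%N = (j \in S)].
Proof.
pose s := enum S ++ enum (~: S).
have ins j : j \in s by rewrite mem_cat !mem_enum finset.in_setC orbN.
have szs : size s = n.
  by rewrite size_cat -!cardE cardsC card_ord.
have lt j : (index j s < n)%N by rewrite -[X in (_ < X)%N]szs index_mem.
pose p j := Ordinal (lt j).
have pinj : injective p.
  move=> i j /(congr1 val) /= e.
  by rewrite -(nth_index i (ins i)) e nth_index.
have [q pK qK] := injF_bij pinj.
exists p, q; split=> // j; rewrite /= index_cat mem_enum.
case: ifP => jS; first by rewrite cardE index_mem mem_enum.
by rewrite -cardE ltnNge leq_addr.
Qed.

Theorem theorem17 (R : realType) (n : nat) (hn : (3 <= n)%N)
    (omega : {set {set {set 'I_n}}})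
    (chamber_omega : is_chamber R omega)
    (interior_omega :
       chamber R omega `<=` relative_interior (hypersimplex R n))
    (dim_omega : (affine_dim (chamber R omega) <= n - 2)%N) :
  exists k : nat, (2 <= k <= n - 2)%N /\
    forall A : 'I_n -> rat, losev_manin_weights k A ->
      exists f : hassett_space R[i] A -> parameter_space R[i] omega,
        birational_morphism f.
Proof.
have [_ [x xch] chamber_disj] := chamber_omega.
have x01 i : 0 < x 0 i < 1.
  exact: hypersimplex_interior hn (interior_omega _ xch).
have x0 i : 0 < x 0 i by case/andP: (x01 i).
have x1 i : x 0 i < 1 by case/andP: (x01 i).
have x2 : \sum_i x 0 i = 2 by have [[]] := interior_omega _ xch.
have [S [xS S1 SC1]] := wall_of_small_chamber hn chamber_omega xch x01 x2 dim_omega.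
(* White points are those outside the wall set; [numbering] gives them the first labels. *)
exists #|~: S|; split.
  by have := cardsC S; rewrite card_ord => ?; apply/andP; split; lia.
move=> A [wA white black blacksum].
have [p [q [pK qK pS]]] := numbering (~: S).
pose y i := x 0 (q i).
have y0 i : 0 < y i by exact: x0.
have yS : \sum_(i : 'I_n | (#|~: S| <= i)%N) y i = 1.
  rewrite (reindex p) /=; last by apply: onW_bij; exists q.
  rewrite -[RHS]xS; apply: eq_big => [j|j _]; last by rewrite /y pK.
  by rewrite leqNgt pS inE negbK.
have dominated (D : pred 'I_n) :
    \sum_(i | D i) A i <= 1 -> \sum_(i | D i) y i <= 1.
  (* A white point in [D] already has weight 1 and is alone there, with x-weight below 1. Otherwise
     [D] consists of black points, whose x-weight is at most that of the wall set, namely 1. *)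
  move=> AD; have [/existsP[i /andP[Di ik]]|/existsPn allblack] :=
      boolP [exists i, D i && (i < #|~: S|)%N].
    rewrite (bigD1 i) //= big_pred0 => [|j]; first by rewrite addr0 ltW // x1.
    apply/negP => /andP[Dj ji]; move: AD.
    rewrite (bigD1 i) //= (bigD1 j) /=; last by rewrite Dj.
    rewrite white //; have : 0 <= \sum_(k | D k && (k != i) && (k != j)) A k.
      by apply: sumr_ge0 => k _; rewrite ltW // (weight_gt0 wA).
    by have := weight_gt0 wA j; lra.
  rewrite -yS [X in _ <= X](bigID D) /=.
  rewrite (eq_bigl (fun i : 'I_n => (#|~: S| <= i)%N && D i)) => [|i].
    by rewrite lerDl; apply: sumr_ge0 => i _; rewrite ltW.
  by have := allblack i; case: (D i); rewrite ?andbF ?andbT //= -leqNgt => ->.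
(* The chamber misses the polytopes outside omega, so membership in omega can be read off at the
   single point x. *)
have omegaP sigma : admissible R[i] sigma ->
    relative_interior (matroid_polytope sigma) x -> sigma \in omega.
  move=> adm rx; apply/negPn/negP => nin.
  have : (chamber R omega `&` relative_interior (matroid_polytope sigma)) x by [].
  by rewrite chamber_disj.
eexists; exact: (reduction_birational hn omegaP x0 x1 x2 wA pK qK dominated).
Qed.
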